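(* Assume that Han's conjecture holds for local algebras. If an algebra $\Lambda$ admits a strongly stratifying chain $\{e_1,\dots,e_n\}$ with $e_i$ primitive for all $i$, then Han's conjecture is true for $\Lambda$.
   Context: Throughout, ''algebra'' means a finite dimensional associative unital algebra over a fixed field $k$. For an algebra $\Lambda$, $HH_*(\Lambda)=\mathrm{Tor}_*^{\Lambda\otimes_k\Lambda^{\mathrm{op}}}(\Lambda,\Lambda)$ is its Hochschild homology; it is called finite if there is $N$ with $HH_m(\Lambda)=0$ for all $m>N$. Han's conjecture holds (is true) for an algebra $\Lambda$ if the following implication holds: if $HH_*(\Lambda)$ is finite, then $\Lambda$ has finite global dimension. Let $e\in\Lambda$ be an idempotent and $f=1-e$. The ideal $\Lambda e\Lambda$ is strongly stratifying if: (1) $\mathrm{Tor}_n^{e\Lambda e}(\Lambda e,e\Lambda)=0$ for $n>0$; (2) $f\Lambda e\otimes_{e\Lambda e}e\Lambda f=0$; (3) $\mathrm{Tor}_n^{f\Lambda f}(\Lambda f,f\Lambda)=0$ for $n>0$. A strongly stratifying chain (or $n$-chain) of $\Lambda$ is an ordered complete system of orthogonal idempotents $\{e_1,\dots,e_n\}$ of $\Lambda$ (pairwise orthogonal idempotents with sum $1$) such that the filtration by ideals $0\subset\Lambda e_1\Lambda\subset\Lambda(e_1+e_2)\Lambda\subset\cdots\subset\Lambda(e_1+\dots+e_{n-1})\Lambda\subset\Lambda$ verifies that, for $1\le i\le n$, the quotient $\Lambda(e_1+\dots+e_i)\Lambda/\Lambda(e_1+\dots+e_{i-1})\Lambda$ is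 a strongly stratifying ideal of $\Lambda_{i-1}:=\Lambda/\Lambda(e_1+\dots+e_{i-1})\Lambda$ (with $\Lambda_0=\Lambda$); this quotient equals $\Lambda_{i-1}\overline{e_i}\Lambda_{i-1}$, where $\overline{e_i}$ is the class of $e_i$, and strongly stratifying is meant with respect to the idempotent $\overline{e_i}$. *)

(* Defs.v *)
From HB Require Import structures.
From mathcomp Require Import all_boot all_order all_algebra all_field.
From mathcomp Require Import generic_quotient.
From mathcomp Require Import boolp.

Set Implicit Arguments.
Unset Strict Implicit.
Unset Printing Implicit Defensive.

Import GRing.Theory.

Local Open Scope ring_scope.
Local Open Scope quotient_scope.

(* Conventions.  Rings are unital and possibly zero ([pzRingType]): corner    *)
(* rings and quotients may vanish.  Left A-modules are [lmodType A]; right    *)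
(* A-modules are [lmodType A^c], where A^c is the opposite ring.              *)

(* -------------------------------------------------------------------------- *)
(* Tensor products.  [ra] and [la] are the actions of the scalars S on the    *)
(* right of M and on the left of N.  An element of M (x)_S N is a finite      *)
(* formal sum of pairs (x, y), two sums being identified when no balanced     *)
(* biadditive map can tell them apart.  [tens_lift_bal], [tens_liftE] and     *)
(* [tens_lift_uniq] below are the usual universal property.                   *)

Section Tensor.

Variables (S : Type) (M N : zmodType) (ra : S -> M -> M) (la : S -> N -> N).

Record balanced (V : zmodType) (f : M -> N -> V) : Prop := Balanced {
  balDl : forall x x' y, f (x + x') y = f x y + f x' y;
  balDr : forall x y y', f x (y + y') = f x y + f x y';
  balZ : forall s x y, f (ra s x) y = f x (la s y)
}.

Definition formal_sum (V : zmodType) (f : M -> N -> V) (s : seq (M * N)) : V :=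
  \sum_(p <- s) f p.1 p.2.

Definition tens_eq (s t : seq (M * N)) : bool :=
  `[< forall (V : zmodType) (f : M -> N -> V),
        balanced f -> formal_sum f s = formal_sum f t >].

Lemma tens_eq_refl : reflexive tens_eq.
Proof. by move=> s; apply/asboolP. Qed.

Lemma tens_eq_sym : symmetric tens_eq.
Proof.
by move=> s t; apply/asboolP/asboolP => h V f fb; rewrite (h V f fb).
Qed.

Lemma tens_eq_trans : transitive tens_eq.
Proof.
move=> t s u /asboolP h1 /asboolP h2; apply/asboolP => V f fb.
by rewrite (h1 V f fb) (h2 V f fb).
Qed.

Canonical tens_equiv := EquivRel tens_eq tens_eq_refl tens_eq_sym tens_eq_trans.

Definition tens_of : Type := {eq_quot tens_equiv}.

HB.instance Definition _ := Choice.on tens_of.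

Definition tens_class (s : seq (M * N)) : tens_of := \pi_({eq_quot tens_equiv}) s.
Definition tens_repr (t : tens_of) : seq (M * N) :=
  repr (t : {eq_quot tens_equiv}).
Definition pure (x : M) (y : N) : tens_of := tens_class [:: (x, y)].
Definition tens_lift (V : zmodType) (f : M -> N -> V) (t : tens_of) : V :=
  formal_sum f (tens_repr t).

Lemma tens_reprK t : tens_class (tens_repr t) = t.
Proof. exact: reprK. Qed.

Lemma tens_classP s t : (forall (V : zmodType) (f : M -> N -> V),
  balanced f -> formal_sum f s = formal_sum f t) -> tens_class s = tens_class t.
Proof. by move=> h; apply/eqmodP; apply/asboolP. Qed.

Lemma tens_lift_class (V : zmodType) (f : M -> N -> V) s :
  balanced f -> tens_lift f (tens_class s) = formal_sum f s.
Proof.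
move=> fb; suff /asboolP h : tens_eq (tens_repr (tens_class s)) s by exact: h.
by apply/eqmodP; exact: reprK.
Qed.

Lemma formal_sum_cat (V : zmodType) (f : M -> N -> V) s t :
  formal_sum f (s ++ t) = formal_sum f s + formal_sum f t.
Proof. exact: big_cat. Qed.

Lemma bal0l (V : zmodType) (f : M -> N -> V) y : balanced f -> f 0 y = 0.
Proof.
by move=> fb; apply: (addIr (f 0 y)); rewrite -(balDl fb) !add0r.
Qed.

Lemma bal0r (V : zmodType) (f : M -> N -> V) x : balanced f -> f x 0 = 0.
Proof.
by move=> fb; apply: (addIr (f x 0)); rewrite -(balDr fb) !add0r.
Qed.

Lemma balNl (V : zmodType) (f : M -> N -> V) x y :
  balanced f -> f (- x) y = - f x y.
Proof.
move=> fb; apply: (addIr (f x y)).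
by rewrite -(balDl fb) !addNr bal0l.
Qed.

Definition tens_zero : tens_of := tens_class [::].
Definition tens_add (t u : tens_of) : tens_of :=
  tens_class (tens_repr t ++ tens_repr u).
Definition tens_opp (t : tens_of) : tens_of :=
  tens_class [seq (- p.1, p.2) | p <- tens_repr t].

Lemma tens_eqP (t u : tens_of) : (forall (V : zmodType) (f : M -> N -> V),
  balanced f -> tens_lift f t = tens_lift f u) -> t = u.
Proof. by move=> h; rewrite -(tens_reprK t) -(tens_reprK u); exact: tens_classP. Qed.

Lemma tens_lift_add (V : zmodType) (f : M -> N -> V) t u :
  balanced f -> tens_lift f (tens_add t u) = tens_lift f t + tens_lift f u.
Proof. by move=> fb; rewrite tens_lift_class ?formal_sum_cat. Qed.

Lemma tens_lift_zero (V : zmodType) (f : M -> N -> V) :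
  balanced f -> tens_lift f tens_zero = 0.
Proof. by move=> fb; rewrite tens_lift_class // /formal_sum big_nil. Qed.

Lemma tens_lift_opp (V : zmodType) (f : M -> N -> V) t :
  balanced f -> tens_lift f (tens_opp t) = - tens_lift f t.
Proof.
move=> fb; rewrite tens_lift_class // /tens_lift /formal_sum big_map -sumrN.
by apply: eq_bigr => p _; rewrite /= balNl.
Qed.

Lemma tens_addA : associative tens_add.
Proof. by move=> x y z; apply: tens_eqP => V f fb; rewrite !tens_lift_add // addrA. Qed.

Lemma tens_addC : commutative tens_add.
Proof. by move=> x y; apply: tens_eqP => V f fb; rewrite !tens_lift_add // addrC. Qed.

Lemma tens_add0 : left_id tens_zero tens_add.
Proof.
by move=> x; apply: tens_eqP => V f fb; rewrite tens_lift_add // tens_lift_zero // add0r.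
Qed.

Lemma tens_addN : left_inverse tens_zero tens_opp tens_add.
Proof.
move=> x; apply: tens_eqP => V f fb.
by rewrite tens_lift_add // tens_lift_opp // tens_lift_zero // addNr.
Qed.

HB.instance Definition _ :=
  GRing.isZmodule.Build tens_of tens_addA tens_addC tens_add0 tens_addN.

Lemma pure_balanced : balanced pure.
Proof.
split=> [x x' y|x y y'|s x y]; apply: tens_eqP => V f fb;
  rewrite ?tens_lift_add // !tens_lift_class // /formal_sum !big_seq1 /=.
- exact: balDl.
- exact: balDr.
- exact: balZ.
Qed.

Lemma tens_liftD (V : zmodType) (f : M -> N -> V) : balanced f ->
  {morph tens_lift f : t u / t + u}.
Proof. by move=> fb t u; exact: tens_lift_add. Qed.

Lemma tens_liftE (V : zmodType) (f : M -> N -> V) x y :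
  balanced f -> tens_lift f (pure x y) = f x y.
Proof. by move=> fb; rewrite tens_lift_class // /formal_sum big_seq1. Qed.

Lemma tens_classE s : tens_class s = \sum_(p <- s) pure p.1 p.2.
Proof.
elim: s => [|[x y] s IH]; first by rewrite big_nil.
rewrite big_cons -IH; apply: tens_eqP => V f fb.
by rewrite tens_lift_add // !tens_lift_class // -formal_sum_cat.
Qed.

Lemma tens_sumP t : exists s : seq (M * N), t = \sum_(p <- s) pure p.1 p.2.
Proof. by exists (tens_repr t); rewrite -tens_classE tens_reprK. Qed.

Lemma tens_lift_uniq (V : zmodType) (g h : tens_of -> V) :
  {morph g : t u / t + u} -> {morph h : t u / t + u} ->
  (forall x y, g (pure x y) = h (pure x y)) -> g =1 h.
Proof.
move=> gD hD gh t; have [s ->] := tens_sumP t.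
have g0 : g 0 = 0 by apply: (addIr (g 0)); rewrite -gD !add0r.
have h0 : h 0 = 0 by apply: (addIr (h 0)); rewrite -hD !add0r.
elim: s => [|p s IH]; first by rewrite big_nil g0 h0.
by rewrite big_cons gD hD IH gh.
Qed.

End Tensor.

Definition tens (A : pzRingType) (M : lmodType A^c) (N : lmodType A) : zmodType :=
  tens_of (fun (a : A) (x : M) => (a : A^c) *: x) (fun (a : A) (y : N) => a *: y).

Definition tens_map (A : pzRingType) (M M' : lmodType A^c) (N : lmodType A)
    (g : M -> M') : tens M N -> tens M' N :=
  tens_lift (fun (x : M) (y : N) => (pure _ _ (g x) y : tens M' N)).

Definition tens_trivial (A : pzRingType) (M : lmodType A^c) (N : lmodType A) : Prop :=
  forall t : tens M N, t = 0.

(* -------------------------------------------------------------------------- *)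

Definition projective (R : pzRingType) (P : lmodType R) : Prop :=
  forall (X Y : lmodType R) (g : {linear X -> Y}) (f : {linear P -> Y}),
    (forall y, exists x, g x = y) ->
    exists h : {linear P -> X}, forall p, g (h p) = f p.

Record proj_resolution (R : pzRingType) (M : lmodType R) := ProjResolution {
  res_obj :> nat -> lmodType R;
  res_diff : forall n, {linear res_obj n.+1 -> res_obj n};
  res_aug : {linear res_obj 0 -> M};
  res_proj : forall n, projective (res_obj n);
  res_aug_surj : forall m, exists x, res_aug x = m;
  res_exact0 : forall x, res_aug x = 0 <-> exists y, res_diff 0 y = x;
  res_exact : forall n x, res_diff n x = 0 <-> exists y, res_diff n.+1 y = x
}.

Definition finite_gldim (R : pzRingType) : Prop :=
  exists d : nat, forall M : lmodType R, exists P : proj_resolution M,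
    forall n, (d < n)%N -> forall x : P n, x = 0.

(* The homology of P (x)_A N at degree n is zero. *)
Definition tens_acyclic_at (A : pzRingType) (M : lmodType A^c)
    (P : proj_resolution M) (N : lmodType A) (n : nat) : Prop :=
  forall z : tens (P n) N,
    (match n return tens (P n) N -> Prop with
     | 0 => fun=> True
     | m.+1 => fun z => tens_map (res_diff P m) z = 0
     end) z ->
    exists w : tens (P n.+1) N, tens_map (res_diff P n) w = z.

(* Tor_n^A(M, N) = 0, computed from a projective resolution of M. *)
Definition Tor_zero (A : pzRingType) (M : lmodType A^c) (N : lmodType A)
    (n : nat) : Prop :=
  exists P : proj_resolution M, tens_acyclic_at P N n.

(* -------------------------------------------------------------------------- *)
(* The enveloping ring A (x)_k A^op and A as a module over it, on the left by *)
(* (a (x) b) x = a x b and on the right by x (a (x) b) = b x a.               *)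

Section Enveloping.

Variables (k : fieldType) (A : algType k).

Definition envelop : Type :=
  tens_of (fun (c : k) (x : A) => c *: x) (fun (c : k) (y : A) => c *: y).

HB.instance Definition _ := GRing.Zmodule.on envelop.

Definition epure (a b : A) : envelop := pure _ _ a b.

Definition env_lift (V : zmodType) (f : A -> A -> V) (t : envelop) : V :=
  @tens_lift k A A (fun c x => c *: x) (fun c y => c *: y) V f t.

Definition env_one : envelop := epure 1 1.
Definition env_mul (t u : envelop) : envelop :=
  env_lift (fun a b => env_lift (fun c d => epure (a * c) (d * b)) u) t.

Lemma epureDl a a' b : epure (a + a') b = epure a b + epure a' b.
Proof. exact: (balDl (pure_balanced _ _)). Qed.
Lemma epureDr a b b' : epure a (b + b') = epure a b + epure a b'.
Proof. exact: (balDr (pure_balanced _ _)). Qed.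
Lemma epureZ c a b : epure (c *: a) b = epure a (c *: b).
Proof. exact: (balZ (pure_balanced _ _)). Qed.

Let env_balanced (V : zmodType) (f : A -> A -> V) : Prop :=
  balanced (fun (c : k) (x : A) => c *: x) (fun (c : k) (y : A) => c *: y) f.

Lemma env_liftE (V : zmodType) (f : A -> A -> V) a b :
  env_balanced f -> env_lift f (epure a b) = f a b.
Proof. exact: tens_liftE. Qed.

Lemma env_liftD (V : zmodType) (f : A -> A -> V) :
  env_balanced f -> {morph env_lift f : t u / t + u}.
Proof. exact: tens_liftD. Qed.

Lemma env_mul_bal2 a b : env_balanced (fun c d => epure (a * c) (d * b)).
Proof.
split=> [x x' y|x y y'|s x y].
- by rewrite mulrDr epureDl.
- by rewrite mulrDl epureDr.
- by rewrite -scalerAr -scalerAl epureZ.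
Qed.

Lemma env_mul_bal1 u : env_balanced
  (fun a b => env_lift (fun c d => epure (a * c) (d * b)) u).
Proof.
split=> [x x' y|x y y'|s x y]; rewrite /env_lift /tens_lift /formal_sum -?big_split /=;
  apply: eq_bigr => p _.
- by rewrite mulrDl epureDl.
- by rewrite mulrDr epureDr.
- by rewrite -scalerAl -scalerAr epureZ.
Qed.

Lemma env_mulE a b c d :
  env_mul (epure a b) (epure c d) = epure (a * c) (d * b).
Proof.
by rewrite /env_mul (env_liftE _ _ (env_mul_bal1 _)) (env_liftE _ _ (env_mul_bal2 _ _)).
Qed.

Lemma env_mulDl : left_distributive env_mul +%R.
Proof. by move=> t t' u; exact: (env_liftD (env_mul_bal1 u)). Qed.

Lemma env_mulDr : right_distributive env_mul +%R.
Proof.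
move=> t u u'; rewrite /env_mul /env_lift [in LHS]/tens_lift [in RHS]/tens_lift /formal_sum -big_split /=.
by apply: eq_bigr => p _; exact: (env_liftD (env_mul_bal2 _ _)).
Qed.

Lemma env_ind (Q : envelop -> Prop) :
  (forall t u, Q t -> Q u -> Q (t + u)) -> (forall a b, Q (epure a b)) ->
  forall t, Q t.
Proof.
move=> QD Qp t; have [s ->] := tens_sumP t.
elim: s => [|p s IH]; last by rewrite big_cons; apply: QD.
rewrite big_nil; have <- : epure 0 0 = 0 by exact: (bal0l _ (pure_balanced _ _)).
exact: Qp.
Qed.

Lemma env_mulA : associative env_mul.
Proof.
move=> t u v; elim/env_ind: t => [t t' h h'|a b].
  by rewrite !env_mulDl h h'.
elim/env_ind: u => [u u' h h'|c d].
  by rewrite env_mulDl !env_mulDr env_mulDl h h'.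
elim/env_ind: v => [v v' h h'|x y].
  by rewrite !env_mulDr h h'.
by rewrite !env_mulE !mulrA.
Qed.

Lemma env_mul1l : left_id env_one env_mul.
Proof.
move=> t; elim/env_ind: t => [t t' h h'|a b]; first by rewrite env_mulDr h h'.
by rewrite env_mulE mul1r mulr1.
Qed.

Lemma env_mul1r : right_id env_one env_mul.
Proof.
move=> t; elim/env_ind: t => [t t' h h'|a b]; first by rewrite env_mulDl h h'.
by rewrite env_mulE mul1r mulr1.
Qed.

HB.instance Definition _ := GRing.Zmodule_isPzRing.Build envelop
  env_mulA env_mul1l env_mul1r env_mulDl env_mulDr.

Definition env_actl (t : envelop) (x : A) : A := env_lift (fun a b => a * x * b) t.
Definition env_actr (t : envelop) (x : A) : A := env_lift (fun a b => b * x * a) t.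

Lemma env_actl_bal x : env_balanced (fun a b => a * x * b).
Proof.
split=> [a a' b|a b b'|s a b]; first by rewrite !mulrDl.
  by rewrite mulrDr.
by rewrite -!scalerAl -scalerAr.
Qed.

Lemma env_actr_bal x : env_balanced (fun a b => b * x * a).
Proof.
split=> [a a' b|a b b'|s a b]; first by rewrite mulrDr.
  by rewrite !mulrDl.
by rewrite -!scalerAl -scalerAr.
Qed.

Lemma env_actlE a b x : env_actl (epure a b) x = a * x * b.
Proof. exact: (env_liftE _ _ (env_actl_bal x)). Qed.
Lemma env_actrE a b x : env_actr (epure a b) x = b * x * a.
Proof. exact: (env_liftE _ _ (env_actr_bal x)). Qed.

Lemma env_actlDl x : {morph env_actl^~ x : t u / t + u}.
Proof. exact: (env_liftD (env_actl_bal x)). Qed.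
Lemma env_actrDl x : {morph env_actr^~ x : t u / t + u}.
Proof. exact: (env_liftD (env_actr_bal x)). Qed.

Lemma env_actlDr : right_distributive env_actl +%R.
Proof.
move=> t x y; rewrite /env_actl /env_lift /tens_lift /formal_sum -big_split /=.
by apply: eq_bigr => p _; rewrite mulrDr mulrDl.
Qed.
Lemma env_actrDr : right_distributive env_actr +%R.
Proof.
move=> t x y; rewrite /env_actr /env_lift /tens_lift /formal_sum -big_split /=.
by apply: eq_bigr => p _; rewrite mulrDr mulrDl.
Qed.

Lemma env_actlA t u x : env_actl t (env_actl u x) = env_actl (t * u) x.
Proof.
elim/env_ind: t => [t t' h h'|a b]; first by rewrite mulrDl !env_actlDl h h'.
elim/env_ind: u => [u u' h h'|c d].
  by rewrite mulrDr !env_actlDl env_actlDr h h'.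
by rewrite [_ * _]env_mulE !env_actlE !mulrA.
Qed.

Lemma env_actrA t u x : env_actr t (env_actr u x) = env_actr (u * t) x.
Proof.
elim/env_ind: t => [t t' h h'|a b]; first by rewrite mulrDr !env_actrDl h h'.
elim/env_ind: u => [u u' h h'|c d].
  by rewrite mulrDl !env_actrDl env_actrDr h h'.
by rewrite [_ * _]env_mulE !env_actrE !mulrA.
Qed.

Lemma env_actl1 : left_id 1 env_actl.
Proof. by move=> x; rewrite [LHS](env_actlE 1 1 x) mul1r mulr1. Qed.
Lemma env_actr1 : left_id 1 env_actr.
Proof. by move=> x; rewrite [LHS](env_actrE 1 1 x) mul1r mulr1. Qed.

Definition regular_left : Type := A.
HB.instance Definition _ := GRing.Zmodule.on regular_left.
HB.instance Definition _ := GRing.Zmodule_isLmodule.Build envelop regular_left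
  env_actlA env_actl1 env_actlDr env_actlDl.

Definition regular_right : Type := A.
HB.instance Definition _ := GRing.Zmodule.on regular_right.
HB.instance Definition _ := GRing.Zmodule_isLmodule.Build envelop^c regular_right
  env_actrA env_actr1 env_actrDr env_actrDl.

Definition HH_zero (n : nat) : Prop :=
  @Tor_zero envelop regular_right regular_left n.

Definition HH_finite : Prop := exists N : nat, forall m, (N < m)%N -> HH_zero m.

Definition Han : Prop := HH_finite -> finite_gldim A.

End Enveloping.

(* -------------------------------------------------------------------------- *)

Record idem (R : pzRingType) := Idem {
  idem_val :> R;
  idemP : idem_val * idem_val = idem_val
}.

Lemma idem1_subproof (R : pzRingType) : (1 : R) * 1 = 1.
Proof. exact: mulr1. Qed.
Definition idem1 (R : pzRingType) : idem R := Idem (idem1_subproof R).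

Lemma idemC_subproof (R : pzRingType) (e : idem R) : (1 - (e : R)) * (1 - (e : R)) = 1 - (e : R).
Proof. by rewrite mulrBl mul1r mulrBr mulr1 idemP subrr subr0. Qed.
Definition idemC (R : pzRingType) (e : idem R) : idem R := Idem (idemC_subproof e).

(* The Peirce component a R b; as a and b are idempotents, it is the set of   *)
(* the x such that a x b = x.  It is a left a R a-module and a right          *)
(* b R b-module, and a ring with unit a when a = b.                           *)

Section Peirce.

Variables (R : pzRingType) (a b : idem R).

Definition peirce_pred : {pred R} := fun x => (a : R) * x * (b : R) == x.

Record peirce := Peirce { peirce_val :> R; peirce_valP : peirce_val \in peirce_pred }.

Lemma peirce_zmod_closed : zmod_closed peirce_pred.
Proof.
split=> [|x y]; rewrite !unfold_in ?mulr0 ?mul0r //.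
by move=> /eqP hx /eqP hy; rewrite mulrBr mulrBl hx hy.
Qed.

HB.instance Definition _ := GRing.isZmodClosed.Build R peirce_pred peirce_zmod_closed.
HB.instance Definition _ := [isSub for peirce_val].
HB.instance Definition _ := [Choice of peirce by <:].
HB.instance Definition _ := [SubChoice_isSubZmodule of peirce by <:].

Lemma peirceE (x : peirce) : (a : R) * (x : R) * (b : R) = (x : R).
Proof. exact/eqP/(peirce_valP x). Qed.
Lemma peirce_l (x : peirce) : (a : R) * (x : R) = (x : R).
Proof. by rewrite -[X in _ * X]peirceE !mulrA idemP peirceE. Qed.
Lemma peirce_r (x : peirce) : (x : R) * (b : R) = (x : R).
Proof. by rewrite -[X in X * _]peirceE -!mulrA idemP mulrA peirceE. Qed.

End Peirce.

Section Corner.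

Variables (R : pzRingType).

Lemma peirce_mul_subproof (a b c : idem R) (x : peirce a b) (y : peirce b c) :
  (x : R) * (y : R) \in peirce_pred a c.
Proof. by rewrite unfold_in mulrA peirce_l -mulrA peirce_r. Qed.

Definition peirce_mul (a b c : idem R) (x : peirce a b) (y : peirce b c) :
  peirce a c := Peirce (peirce_mul_subproof x y).

Lemma peirce_one_subproof (e : idem R) : (e : R) \in peirce_pred e e.
Proof. by rewrite unfold_in !idemP. Qed.

Definition peirce_one (e : idem R) : peirce e e := Peirce (peirce_one_subproof e).

Lemma peirce_mulA (a b c d : idem R) (x : peirce a b) (y : peirce b c) (z : peirce c d) :
  peirce_mul x (peirce_mul y z) = peirce_mul (peirce_mul x y) z.
Proof. by apply: val_inj; exact: mulrA. Qed.

Lemma peirce_mul1l (a b : idem R) (x : peirce a b) : peirce_mul (peirce_one a) x = x.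
Proof. by apply: val_inj; exact: peirce_l. Qed.

Lemma peirce_mul1r (a b : idem R) (x : peirce a b) : peirce_mul x (peirce_one b) = x.
Proof. by apply: val_inj; exact: peirce_r. Qed.

Lemma peirce_mulDl (a b c : idem R) (x x' : peirce a b) (y : peirce b c) :
  peirce_mul (x + x') y = peirce_mul x y + peirce_mul x' y.
Proof. by apply: val_inj; exact: mulrDl. Qed.

Lemma peirce_mulDr (a b c : idem R) (x : peirce a b) (y y' : peirce b c) :
  peirce_mul x (y + y') = peirce_mul x y + peirce_mul x y'.
Proof. by apply: val_inj; exact: mulrDr. Qed.

Definition corner (e : idem R) : Type := peirce e e.

HB.instance Definition _ (e : idem R) := GRing.Zmodule.on (corner e).
HB.instance Definition _ (e : idem R) := GRing.Zmodule_isPzRing.Build (corner e)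
  (@peirce_mulA e e e e) (@peirce_mul1l e e) (@peirce_mul1r e e)
  (@peirce_mulDl e e e) (@peirce_mulDr e e e).

Definition peirce_left (a b : idem R) : Type := peirce a b.

HB.instance Definition _ (a b : idem R) := GRing.Zmodule.on (peirce_left a b).
HB.instance Definition _ (a b : idem R) :=
  GRing.Zmodule_isLmodule.Build (corner a) (peirce_left a b)
  (fun (x y : corner a) (z : peirce_left a b) => @peirce_mulA a a a b x y z)
  (@peirce_mul1l a b) (@peirce_mulDr a a b)
  (fun z x y => @peirce_mulDl a a b x y z).

Definition peirce_right (a b : idem R) : Type := peirce a b.

HB.instance Definition _ (a b : idem R) := GRing.Zmodule.on (peirce_right a b).
HB.instance Definition _ (a b : idem R) :=
  GRing.Zmodule_isLmodule.Build (corner b)^c (peirce_right a b)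
  (fun (x y : (corner b)^c) (z : peirce_right a b) => esym (@peirce_mulA a b b b z y x))
  (@peirce_mul1r a b) (fun x z z' => @peirce_mulDl a b b z z' x)
  (fun z x y => @peirce_mulDr a b b z x y).

(* The ideal R e R is strongly stratifying, with f = 1 - e. *)
Definition strongly_stratifying (e : idem R) : Prop :=
  let f := idemC e in
  [/\ forall n, (0 < n)%N ->
        @Tor_zero (corner e) (peirce_right (idem1 R) e) (peirce_left e (idem1 R)) n,
      @tens_trivial (corner e) (peirce_right f e) (peirce_left e f)
    & forall n, (0 < n)%N ->
        @Tor_zero (corner f) (peirce_right (idem1 R) f) (peirce_left f (idem1 R)) n].

Definition primitive (e : idem R) : Prop :=
  (e : R) <> 0 /\
  forall a b : idem R, (a : R) * (b : R) = 0 -> (b : R) * (a : R) = 0 ->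
    (e : R) = (a : R) + (b : R) ->
    (a : R) = 0 \/ (b : R) = 0.

End Corner.

(* -------------------------------------------------------------------------- *)

Section IdealQuotient.

Variables (R : pzRingType) (a : R).

(* The two-sided ideal R a R. *)
Definition in_ideal (x : R) : Prop :=
  exists s : seq (R * R), x = \sum_(p <- s) p.1 * a * p.2.

Lemma in_ideal0 : in_ideal 0.
Proof. by exists [::]; rewrite big_nil. Qed.

Lemma in_idealD x y : in_ideal x -> in_ideal y -> in_ideal (x + y).
Proof. by move=> [s ->] [t ->]; exists (s ++ t); rewrite big_cat. Qed.

Lemma in_idealMl r x : in_ideal x -> in_ideal (r * x).
Proof.
move=> [s ->]; exists [seq (r * p.1, p.2) | p <- s].
by rewrite big_map mulr_sumr; apply: eq_bigr => p _; rewrite !mulrA.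
Qed.

Lemma in_idealMr r x : in_ideal x -> in_ideal (x * r).
Proof.
move=> [s ->]; exists [seq (p.1, p.2 * r) | p <- s].
by rewrite big_map mulr_suml; apply: eq_bigr => p _; rewrite !mulrA.
Qed.

Lemma in_idealN x : in_ideal x -> in_ideal (- x).
Proof. by move=> /(in_idealMl (-1)); rewrite mulN1r. Qed.

Definition ideal_eq (x y : R) : bool := `[< in_ideal (x - y) >].

Lemma ideal_eq_refl : reflexive ideal_eq.
Proof. by move=> x; apply/asboolP; rewrite subrr; exact: in_ideal0. Qed.

Lemma ideal_eq_sym : symmetric ideal_eq.
Proof. by move=> x y; apply/asboolP/asboolP => /in_idealN; rewrite opprB. Qed.

Lemma ideal_eq_trans : transitive ideal_eq.
Proof.
move=> y x z /asboolP h /asboolP h'; apply/asboolP.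
by rewrite -(subrKA y); exact: in_idealD.
Qed.

Canonical ideal_equiv :=
  EquivRel ideal_eq ideal_eq_refl ideal_eq_sym ideal_eq_trans.

Definition quot_ring : Type := {eq_quot ideal_equiv}.

HB.instance Definition _ := Choice.on quot_ring.

Definition to_quot (x : R) : quot_ring := \pi_({eq_quot ideal_equiv}) x.
Definition of_quot (t : quot_ring) : R := repr (t : {eq_quot ideal_equiv}).

Lemma of_quotK t : to_quot (of_quot t) = t.
Proof. exact: reprK. Qed.

Lemma to_quotP x y : to_quot x = to_quot y <-> in_ideal (x - y).
Proof.
split=> [/eqmodP /asboolP //|h]; by apply/eqmodP; apply/asboolP.
Qed.

Lemma to_quot_repr x : in_ideal (of_quot (to_quot x) - x).
Proof. by apply/to_quotP; rewrite of_quotK. Qed.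

Definition quot_zero : quot_ring := to_quot 0.
Definition quot_one : quot_ring := to_quot 1.
Definition quot_add (t u : quot_ring) := to_quot (of_quot t + of_quot u).
Definition quot_opp (t : quot_ring) := to_quot (- of_quot t).
Definition quot_mul (t u : quot_ring) := to_quot (of_quot t * of_quot u).

Lemma quot_addE x y : quot_add (to_quot x) (to_quot y) = to_quot (x + y).
Proof.
apply/to_quotP; rewrite opprD addrACA.
by apply: in_idealD; exact: to_quot_repr.
Qed.

Lemma quot_oppE x : quot_opp (to_quot x) = to_quot (- x).
Proof. by apply/to_quotP; rewrite -opprD; apply: in_idealN; exact: to_quot_repr. Qed.

Lemma quot_mulE x y : quot_mul (to_quot x) (to_quot y) = to_quot (x * y).
Proof.
apply/to_quotP; rewrite -(subrKA (x * of_quot (to_quot y))) -mulrBl -mulrBr.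
by apply: in_idealD; [apply: in_idealMr|apply: in_idealMl]; exact: to_quot_repr.
Qed.

Lemma quot_ind (Q : quot_ring -> Prop) : (forall x, Q (to_quot x)) -> forall t, Q t.
Proof. by move=> h t; rewrite -(of_quotK t). Qed.

Lemma quot_addA : associative quot_add.
Proof.
by elim/quot_ind=> x; elim/quot_ind=> y; elim/quot_ind=> z; rewrite !quot_addE addrA.
Qed.
Lemma quot_addC : commutative quot_add.
Proof. by elim/quot_ind=> x; elim/quot_ind=> y; rewrite !quot_addE addrC. Qed.
Lemma quot_add0 : left_id quot_zero quot_add.
Proof. by elim/quot_ind=> x; rewrite quot_addE add0r. Qed.
Lemma quot_addN : left_inverse quot_zero quot_opp quot_add.
Proof. by elim/quot_ind=> x; rewrite quot_oppE quot_addE addNr. Qed.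

HB.instance Definition _ :=
  GRing.isZmodule.Build quot_ring quot_addA quot_addC quot_add0 quot_addN.

Lemma quot_mulA : associative quot_mul.
Proof.
by elim/quot_ind=> x; elim/quot_ind=> y; elim/quot_ind=> z; rewrite !quot_mulE mulrA.
Qed.
Lemma quot_mul1l : left_id quot_one quot_mul.
Proof. by elim/quot_ind=> x; rewrite quot_mulE mul1r. Qed.
Lemma quot_mul1r : right_id quot_one quot_mul.
Proof. by elim/quot_ind=> x; rewrite quot_mulE mulr1. Qed.
Lemma quot_mulDl : left_distributive quot_mul quot_add.
Proof.
elim/quot_ind=> x; elim/quot_ind=> y; elim/quot_ind=> z.
by rewrite quot_addE !quot_mulE quot_addE mulrDl.
Qed.
Lemma quot_mulDr : right_distributive quot_mul quot_add.
Proof.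
elim/quot_ind=> x; elim/quot_ind=> y; elim/quot_ind=> z.
by rewrite quot_addE !quot_mulE quot_addE mulrDr.
Qed.

HB.instance Definition _ := GRing.Zmodule_isPzRing.Build quot_ring
  quot_mulA quot_mul1l quot_mul1r quot_mulDl quot_mulDr.

Lemma quot_idem_subproof (e : idem R) : to_quot (e : R) * to_quot (e : R) = to_quot (e : R).
Proof. by rewrite [_ * _]quot_mulE idemP. Qed.

Definition quot_idem (e : idem R) : idem quot_ring := Idem (quot_idem_subproof e).

End IdealQuotient.

(* With i ranging over 0 <= i < n, the ring [quot_ring (\sum_(j | j < i) e j)] *)
(* is R / R (e_0 + ... + e_(i-1)) R; for i = 0 it is R / 0.                    *)
Definition strongly_stratifying_chain (R : pzRingType) (n : nat)
    (e : 'I_n -> idem R) : Prop :=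
  [/\ forall i j, i != j -> (e i : R) * (e j : R) = 0,
      \sum_(i < n) (e i : R) = 1
    & forall i : 'I_n,
        strongly_stratifying
          (quot_idem (\sum_(j < n | (j < i)%N) (e j : R)) (e i))].

Definition left_ideal (R : pzRingType) (I : R -> Prop) : Prop :=
  [/\ I 0, forall x y, I x -> I y -> I (x + y) & forall r x, I x -> I (r * x)].

Definition maximal_left_ideal (R : pzRingType) (I : R -> Prop) : Prop :=
  [/\ left_ideal I, ~ I 1
    & forall J : R -> Prop, left_ideal J -> (forall x, I x -> J x) -> ~ J 1 ->
        forall x, J x -> I x].

Definition local_ring (R : pzRingType) : Prop :=
  exists2 I : R -> Prop, maximal_left_ideal I
    & forall J : R -> Prop, maximal_left_ideal J -> forall x, J x <-> I x.

(* Main.v *)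
(** With e = e_1 and f = 1 - e, the first two conditions on L e L say that
    L e (x)_{eLe} e L -> L is injective with no higher Tor and that f L e L f = 0,
    so that L / L e L is the ring f L f.

    Hochschild homology: f L f is a retract of L, so finiteness of HH(L) passes to
    f L f.  Computing HH of f L f over L instead does not change it, so the sequence
    0 -> L e L -> L -> f L f -> 0 gives the finiteness of HH(L, L e L); as L e L is
    L e (x)_{eLe} e L, this is HH(e L e).  All of it is done by dimension shifting,
    along the kernels of R (x) Y -> Y.

    Global dimension: if Y is killed by e, it is an f L f-module and its projective
    dimension over L is bounded, since 0 -> L e (x) e F -> F -> F / L e F -> 0 is exact
    for F free and tensoring a resolution of e F with L e keeps it exact.  Any X differs
    from L e (x) e X by modules killed by e, and so does the complex obtained from a
    resolution of e X by tensoring with L e from a resolution of L e (x) e X.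

    The corner of a primitive idempotent is local by Fitting's lemma, and e_2, ..., e_n
    is a chain of f L f, which allows an induction on n. *)

Require Import Defs.
From HB Require Import structures.
From mathcomp Require Import all_boot all_order all_algebra all_field.
From mathcomp Require Import generic_quotient boolp.

Set Implicit Arguments.
Unset Strict Implicit.
Unset Printing Implicit Defensive.

Import GRing.Theory.
Local Open Scope ring_scope.
Local Open Scope quotient_scope.

(** * Tensor products over the base field and Hochschild homology *)

(** Write A = eLe and B = fLf. That HH(L, B) = HH(B) rests on Tor_i^L(B, B) = 0 for i > 0. To see
    this, the A-syzygies of eL (x) Le are given the outer L-actions; they resolve LeL by bimodules
    generated by e from the left, and B (x)_L - kills those because B e = 0. The same resolution
    yields HH(L, LeL), since its L-coinvariants are the A-syzygies of A itself.

    Homology groups are never formed. Only their vanishing occurs, in the shape: an element that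
    maps to zero is a sum of commutators. Submodules are predicates on an ambient space, so kernels
    and syzygies require no new types.

    A [falgType] is nonzero, so a corner is an algebra only if its idempotent is nonzero.
    Primitivity supplies this, and the induction starts with chains of length one.

    For the global dimension, Le (x)_A - need not be exact. This dictates the order: modules killed
    by e come first, so that the kernels created by tensoring are already under control. *)

Section KLinear.
Variable k : fieldType.

(** A predicate on bare functions: the maps below are partial applications of actions and
    compositions, which need not be packed as linear maps. *)
Definition klin (U V : lmodType k) (f : U -> V) : Prop :=
  forall a x y, f (a *: x + y) = a *: f x + f y.

Section One.
Variables (U V : lmodType k) (f : U -> V).
Hypothesis fl : klin f.

Lemma klin0 : f 0 = 0.
Proof.
have := fl 1 0 0; rewrite !scale1r addr0 => h.
by apply: (addIr (f 0)); rewrite -h add0r.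
Qed.
Lemma klinD x y : f (x + y) = f x + f y.
Proof. by have := fl 1 x y; rewrite !scale1r. Qed.
Lemma klinZ a x : f (a *: x) = a *: f x.
Proof. by have := fl a x 0; rewrite klin0 !addr0. Qed.
Lemma klinN x : f (- x) = - f x.
Proof. by rewrite -scaleN1r klinZ scaleN1r. Qed.
Lemma klinB x y : f (x - y) = f x - f y.
Proof. by rewrite klinD klinN. Qed.
Lemma klin_sum (I : Type) (s : seq I) (P : pred I) (F : I -> U) :
  f (\sum_(i <- s | P i) F i) = \sum_(i <- s | P i) f (F i).
Proof. exact: (big_morph f klinD klin0). Qed.
End One.

Lemma klin_id (U : lmodType k) : klin (fun x : U => x).
Proof. by []. Qed.
Lemma klin_comp (U V W : lmodType k) (f : V -> W) (g : U -> V) :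
  klin f -> klin g -> klin (fun x => f (g x)).
Proof. by move=> hf hg a x y; rewrite hg hf. Qed.
Lemma klin_bigsum (U V : lmodType k) (I : finType) (f : I -> U -> V) :
  (forall i, klin (f i)) -> klin (fun x => \sum_i f i x).
Proof.
move=> h a x y; rewrite scaler_sumr -big_split /=.
by apply: eq_bigr => i _; apply: h.
Qed.

(* [VT V Y] is a model of the tensor product of V and Y over k in which exactness in Y is
   evident: a family (F i) stands for the sum of the b_i (x) F i over the chosen basis of V. *)
Section VT.
Variable V : vectType k.

Definition ix : finType := 'I_(\dim {: V}).
Definition bs (i : ix) : V := (vbasis {: V})`_i.
Definition co (i : ix) (v : V) : k := coord (vbasis {: V}) i v.

Lemma co_lin i : klin (co i : V -> k^o).
Proof. by move=> a x y; rewrite /co linearP. Qed.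
Lemma co_bs i j : co j (bs i) = (j == i)%:R.
Proof. by rewrite /co /bs coord_free ?(basis_free (vbasisP _)) // eq_sym. Qed.
Lemma co_sum v : \sum_i co i v *: bs i = v.
Proof. exact/esym/(coord_vbasis (memvf v)). Qed.

Definition VT (Y : lmodType k) : lmodType k := {ffun ix -> Y}.

Definition pur (Y : lmodType k) (v : V) (y : Y) : VT Y := [ffun i => co i v *: y].

Variable Y : lmodType k.
Implicit Types (F G : VT Y) (y : Y) (v : V).

Lemma purE i v y : pur v y i = co i v *: y. Proof. by rewrite ffunE. Qed.
Lemma pur_linr v : klin (pur v : Y -> VT Y).
Proof.
by move=> a x y; apply/ffunP => i; rewrite !ffunE scalerDr !scalerA mulrC.
Qed.
Lemma pur_linl y : klin (fun v => pur v y).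
Proof.
by move=> a u v; apply/ffunP => i; rewrite !ffunE co_lin scalerDl !scalerA.
Qed.
Lemma purZ c v y : pur (c *: v) y = pur v (c *: y).
Proof. by rewrite (klinZ (pur_linl y)) -(klinZ (pur_linr v)). Qed.
Lemma VT_sum F : F = \sum_i pur (bs i) (F i).
Proof.
apply/ffunP => j; rewrite sum_ffunE (bigD1 j) //= big1.
  by rewrite purE co_bs eqxx scale1r addr0.
by move=> i ij; rewrite purE co_bs eq_sym (negPf ij) scale0r.
Qed.
Lemma VT_ext (Z : lmodType k) (f g : VT Y -> Z) : klin f -> klin g ->
  (forall v y, f (pur v y) = g (pur v y)) -> f =1 g.
Proof.
move=> hf hg h F; rewrite [F]VT_sum (klin_sum hf) (klin_sum hg).
by apply: eq_bigr => i _.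
Qed.
Lemma ev_lin i : klin (fun F : VT Y => F i).
Proof. by move=> a x y; rewrite !ffunE. Qed.

Definition vlift (Z : lmodType k) (t : V -> Y -> Z) (F : VT Y) : Z :=
  \sum_i t (bs i) (F i).
Lemma vlift_lin (Z : lmodType k) (t : V -> Y -> Z) :
  (forall v, klin (t v)) -> klin (vlift t).
Proof.
move=> h; apply: klin_bigsum => i; apply: klin_comp (h _) _; exact: ev_lin.
Qed.
Lemma vlift_pur (Z : lmodType k) (t : V -> Y -> Z) v y :
  (forall v, klin (t v)) -> (forall y, klin (t^~ y)) ->
  vlift t (pur v y) = t v y.
Proof.
move=> h1 h2; rewrite /vlift -[in RHS](co_sum v) (klin_sum (h2 y)).
by apply: eq_bigr => i _; rewrite purE (klinZ (h1 _)) (klinZ (h2 y)).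
Qed.
End VT.

(** [vmap g] is id (x) g and [opm f] is f (x) id. The first acts on each coordinate, the second
    passes through the basis of the source. *)
Definition vmap (V : vectType k) (Y Z : lmodType k) (g : Y -> Z) (F : VT V Y) : VT V Z :=
  [ffun i => g (F i)].
Definition opm (V V' : vectType k) (Y : lmodType k) (f : V -> V') (F : VT V Y) : VT V' Y :=
  vlift (fun v y => pur (f v) y) F.

Section VTops.
Variables (V V' : vectType k) (Y Z : lmodType k).

Lemma vmap_lin (g : Y -> Z) : klin g -> klin (vmap g : VT V Y -> VT V Z).
Proof. by move=> h a x y; apply/ffunP => i; rewrite !ffunE h. Qed.
Lemma vmap_pur (g : Y -> Z) (v : V) y : klin g -> vmap g (pur v y) = pur v (g y).
Proof. by move=> h; apply/ffunP => i; rewrite !ffunE (klinZ h). Qed.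
Lemma opm_lin (f : V -> V') : klin (opm f : VT V Y -> VT V' Y).
Proof. by apply: vlift_lin => v; apply: pur_linr. Qed.
Lemma opm_pur (f : V -> V') v (y : Y) : klin f -> opm f (pur v y) = pur (f v) y.
Proof.
move=> h; rewrite /opm vlift_pur // => [u|u]; first exact: pur_linr.
exact: (klin_comp (pur_linl u) h).
Qed.
End VTops.

Section VTops2.
Variables (V V' V'' : vectType k) (Y Z W : lmodType k).

Lemma vmap_comp (g : Z -> W) (h : Y -> Z) (F : VT V Y) :
  vmap g (vmap h F) = vmap (fun y => g (h y)) F.
Proof. by apply/ffunP => i; rewrite !ffunE. Qed.
Lemma vmap_ext (g h : Y -> Z) (F : VT V Y) : g =1 h -> vmap g F = vmap h F.
Proof. by move=> gh; apply/ffunP => i; rewrite !ffunE gh. Qed.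
Lemma opm_comp (f : V' -> V'') (f' : V -> V') (F : VT V Y) : klin f -> klin f' ->
  opm f (opm f' F) = opm (fun v => f (f' v)) F.
Proof.
move=> h h'; move: F; apply: VT_ext => [||v y].
- exact: klin_comp (opm_lin f) (opm_lin f').
- exact: opm_lin.
- by rewrite !opm_pur //; exact: klin_comp h h'.
Qed.
Lemma opm_ext (f f' : V -> V') (F : VT V Y) : f =1 f' -> opm f F = opm f' F.
Proof. by move=> h; apply: eq_bigr => i _; rewrite h. Qed.
Lemma opm_id (F : VT V Y) : opm (fun v => v) F = F.
Proof. by rewrite [RHS]VT_sum. Qed.
Lemma opm_vmap (f : V -> V') (g : Y -> Z) (F : VT V Y) : klin f -> klin g ->
  opm f (vmap g F) = vmap g (opm f F).
Proof.
move=> hf hg; move: F; apply: VT_ext => [||v y].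
- exact: klin_comp (opm_lin f) (vmap_lin hg).
- exact: klin_comp (vmap_lin hg) (opm_lin f).
- by rewrite vmap_pur // !opm_pur // vmap_pur.
Qed.
Lemma opm_linf (f g : V -> V') (a : k) (F : VT V Y) :
  opm (fun v => a *: f v + g v) F = a *: opm f F + opm g F.
Proof.
rewrite /opm /vlift scaler_sumr -big_split /=; apply: eq_bigr => i _.
exact: (pur_linl (F i)).
Qed.
Lemma vmap_linf (f g : Y -> Z) (a : k) (F : VT V Y) :
  vmap (fun v => a *: f v + g v) F = a *: vmap f F + vmap g F.
Proof. by apply/ffunP => i; rewrite !ffunE. Qed.
Lemma opmE (f : V -> V') (F : VT V Y) j : opm f F j = \sum_i co j (f (bs i)) *: F i.
Proof. by rewrite /opm /vlift sum_ffunE; apply: eq_bigr => i _; rewrite purE. Qed.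
End VTops2.

End KLinear.

Arguments VT {k} V Y.

(** * Bimodules, syzygies and the long exact sequence *)

Section Mult.
Variables (k : fieldType) (R : falgType k).
Lemma mul_linr (r : R) : klin (fun x : R => r * x).
Proof. by move=> a x y; rewrite mulrDr scalerAr. Qed.
Lemma mul_linl (r : R) : klin (fun x : R => x * r).
Proof. by move=> a x y; rewrite mulrDl scalerAl. Qed.
End Mult.

(** Unitality is left out: eL (x) Le will be a subset of L (x) L, on which the unit of eLe acts as
    e. [sbm] asks for it on the subset only. *)
Record bimod (k : fieldType) (R : falgType k) := Bimod {
  bsort :> lmodType k;
  bl : R -> bsort -> bsort;
  br : R -> bsort -> bsort;
  bl_lin : forall r, klin (bl r);
  br_lin : forall r, klin (br r);
  bl_linr : forall y, klin (bl^~ y);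
  br_linr : forall y, klin (br^~ y);
  blM : forall r s y, bl (r * s) y = bl r (bl s y);
  brM : forall r s y, br (r * s) y = br s (br r y);
  blr : forall r s y, bl r (br s y) = br s (bl r y)
}.
Arguments bl {k R b} r y.
Arguments br {k R b} r y.

Section Bimod.
Variables (k : fieldType) (R : falgType k).
Local Notation bimod := (bimod R).

(** Subbimodules as predicates: the syzygies below are nested kernels, and each remains a condition
    on an explicit space of families. *)
Record sbm (Y : bimod) (D : Y -> Prop) : Prop := Sbm {
  sbm0 : D 0;
  sbmD : forall x y, D x -> D y -> D (x + y);
  sbmZ : forall a x, D x -> D (a *: x);
  sbml : forall r x, D x -> D (bl r x);
  sbmr : forall r x, D x -> D (br r x);
  sbm1l : forall x, D x -> bl 1 x = x;
  sbm1r : forall x, D x -> br 1 x = x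
}.

Lemma sbmN (Y : bimod) (D : Y -> Prop) x : sbm D -> D x -> D (- x).
Proof. by move=> h /(sbmZ h (-1)); rewrite scaleN1r. Qed.
Lemma sbmB (Y : bimod) (D : Y -> Prop) x y : sbm D -> D x -> D y -> D (x - y).
Proof. by move=> h hx hy; apply: sbmD => //; apply: sbmN. Qed.
Lemma sbm_sum (Y : bimod) (D : Y -> Prop) (I : Type) (s : seq I) (F : I -> Y) :
  sbm D -> (forall i, D (F i)) -> D (\sum_(i <- s) F i).
Proof. by move=> h hF; apply: big_ind => //; [exact: sbm0|exact: sbmD]. Qed.

(** [D] modulo [comm D] is the zeroth Hochschild homology of R with coefficients in [D]. *)
Inductive comm (Y : bimod) (D : Y -> Prop) : Y -> Prop :=
| comm0 : comm D 0
| commS r y x : D y -> comm D x -> comm D (bl r y - br r y + x).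

Lemma comm1 (Y : bimod) (D : Y -> Prop) r y : D y -> comm D (bl r y - br r y).
Proof. by move=> h; rewrite -[X in comm _ X]addr0; apply: commS => //; exact: comm0. Qed.
Lemma commD (Y : bimod) (D : Y -> Prop) x y : comm D x -> comm D y -> comm D (x + y).
Proof.
move=> hx hy; elim: hx => [|r z x' hz _ IH]; first by rewrite add0r.
by rewrite -addrA; apply: commS.
Qed.
Lemma commZ (Y : bimod) (D : Y -> Prop) a x : sbm D -> comm D x -> comm D (a *: x).
Proof.
move=> hD; elim=> [|r z x' hz _ IH]; first by rewrite scaler0; exact: comm0.
rewrite scalerDr scalerBr -(klinZ (bl_lin _)) -(klinZ (br_lin _)).
by apply: commS => //; apply: sbmZ.
Qed.
Lemma commN (Y : bimod) (D : Y -> Prop) x : sbm D -> comm D x -> comm D (- x).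
Proof. by move=> hD /(commZ (-1) hD); rewrite scaleN1r. Qed.
Lemma commB (Y : bimod) (D : Y -> Prop) x y :
  sbm D -> comm D x -> comm D y -> comm D (x - y).
Proof. by move=> hD hx hy; apply: commD => //; apply: commN. Qed.
Lemma comm_sum (Y : bimod) (D : Y -> Prop) (I : Type) (s : seq I) (F : I -> Y) :
  (forall i, comm D (F i)) -> comm D (\sum_(i <- s) F i).
Proof. by move=> hF; apply: big_ind => //; [exact: comm0|exact: commD]. Qed.
Lemma commC (Y : bimod) (D : Y -> Prop) r y : sbm D -> D y -> comm D (br r y - bl r y).
Proof. by move=> hD hy; rewrite -opprB; apply: commN => //; apply: comm1. Qed.
Lemma comm_in (Y : bimod) (D : Y -> Prop) x : sbm D -> comm D x -> D x.
Proof.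
move=> hD; elim=> [|r z x' hz _ IH]; first exact: sbm0.
by apply: sbmD => //; apply: sbmB => //; [apply: sbml|apply: sbmr].
Qed.

Record bhom (Y Z : bimod) (g : Y -> Z) : Prop := Bhom {
  bh_lin : klin g;
  bh_l : forall r y, g (bl r y) = bl r (g y);
  bh_r : forall r y, g (br r y) = br r (g y)
}.

Lemma comm_img (Y Z : bimod) (g : Y -> Z) (D : Y -> Prop) (D' : Z -> Prop) x :
  bhom g -> (forall y, D y -> D' (g y)) -> comm D x -> comm D' (g x).
Proof.
move=> hg h; elim=> [|r z x' hz _ IH]; first by rewrite (klin0 (bh_lin hg)); exact: comm0.
rewrite (klinD (bh_lin hg)) (klinB (bh_lin hg)) (bh_l hg) (bh_r hg).
by apply: commS => //; apply: h.
Qed.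
Lemma comm_lift (Y Z : bimod) (g : Y -> Z) (D : Y -> Prop) (D' : Z -> Prop) z :
  bhom g -> (forall z, D' z -> exists2 y, D y & g y = z) ->
  comm D' z -> exists2 y, comm D y & g y = z.
Proof.
move=> hg h; elim=> [|r w x' hw _ [y hy <-]].
  by exists 0; [exact: comm0|exact: klin0 (bh_lin hg)].
have [u hu <-] := h _ hw; exists (bl r u - br r u + y); first exact: commS.
by rewrite (klinD (bh_lin hg)) (klinB (bh_lin hg)) (bh_l hg) (bh_r hg).
Qed.

Section Ten.
Variable Y : bimod.

Definition ten_bl (r : R) (F : VT R Y) : VT R Y := opm (fun s : R => r * s) F.
Definition ten_br (r : R) (F : VT R Y) : VT R Y := vmap (br r) F.

Lemma ten_bl_lin r : klin (ten_bl r). Proof. exact: opm_lin. Qed.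
Lemma ten_br_lin r : klin (ten_br r). Proof. by apply: vmap_lin; apply: br_lin. Qed.
Lemma ten_bl_linr F : klin (ten_bl^~ F).
Proof.
move=> a r s; rewrite /ten_bl -opm_linf; apply: opm_ext => v.
by rewrite mulrDl scalerAl.
Qed.
Lemma ten_br_linr F : klin (ten_br^~ F).
Proof.
move=> a r s; rewrite /ten_br -vmap_linf; apply: vmap_ext => v.
exact: br_linr.
Qed.
Lemma ten_blM r s F : ten_bl (r * s) F = ten_bl r (ten_bl s F).
Proof.
rewrite /ten_bl opm_comp; [|exact: mul_linr|exact: mul_linr].
by apply: opm_ext => v; rewrite mulrA.
Qed.
Lemma ten_brM r s F : ten_br (r * s) F = ten_br s (ten_br r F).
Proof. by rewrite /ten_br vmap_comp; apply: vmap_ext => v; rewrite brM. Qed.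
Lemma ten_blr r s F : ten_bl r (ten_br s F) = ten_br s (ten_bl r F).
Proof. by rewrite /ten_bl /ten_br opm_vmap //; [exact: mul_linr|exact: br_lin]. Qed.

Definition tb : bimod := Bimod ten_bl_lin ten_br_lin ten_bl_linr ten_br_linr
  ten_blM ten_brM ten_blr.

(** [eps] is the action R (x) Y -> Y. As r (x) y and 1 (x) y r differ by a commutator, [rho]
    identifies the coinvariants of R (x) Y with Y when Y is unital. *)
Definition eps (F : tb) : Y := vlift (fun r y => bl r y) F.
Definition rho (F : tb) : Y := vlift (fun r y => br r y) F.

Lemma eps_lin : klin eps. Proof. by apply: vlift_lin; apply: bl_lin. Qed.
Lemma rho_lin : klin rho. Proof. by apply: vlift_lin; apply: br_lin. Qed.
Lemma eps_pur r y : eps (pur r y) = bl r y.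
Proof. by rewrite /eps vlift_pur //; [apply: bl_lin|apply: bl_linr]. Qed.
Lemma rho_pur r y : rho (pur r y) = br r y.
Proof. by rewrite /rho vlift_pur //; [apply: br_lin|apply: br_linr]. Qed.
Lemma bl_pur r s y : bl r (pur s y : tb) = pur (r * s) y.
Proof. by rewrite [LHS]opm_pur //; apply: mul_linr. Qed.
Lemma br_pur r s y : br r (pur s y : tb) = pur s (br r y).
Proof. by rewrite [LHS]vmap_pur //; apply: br_lin. Qed.

Lemma eps_bl r F : eps (bl r F) = bl r (eps F).
Proof.
move: F; apply: VT_ext => [||s y].
- exact: klin_comp eps_lin (ten_bl_lin r).
- exact: klin_comp (bl_lin r) eps_lin.
- by rewrite bl_pur !eps_pur blM.
Qed.
Lemma eps_br r F : eps (br r F) = br r (eps F).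
Proof.
move: F; apply: VT_ext => [||s y].
- exact: klin_comp eps_lin (ten_br_lin r).
- exact: klin_comp (br_lin r) eps_lin.
- by rewrite br_pur !eps_pur blr.
Qed.
Lemma rho_bl_br r F : rho (bl r F) = rho (br r F).
Proof.
move: F; apply: VT_ext => [||s y].
- exact: klin_comp rho_lin (ten_bl_lin r).
- exact: klin_comp rho_lin (ten_br_lin r).
- by rewrite bl_pur br_pur !rho_pur brM.
Qed.
Lemma rho_comm D x : @comm tb D x -> rho x = 0.
Proof.
elim=> [|r y z _ _ IH]; first exact: klin0 rho_lin.
by rewrite (klinD rho_lin) IH addr0 (klinB rho_lin) rho_bl_br subrr.
Qed.
Lemma eps_homl : bhom eps.
Proof. by split; [exact: eps_lin|exact: eps_bl|exact: eps_br]. Qed.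

Definition KD (D : Y -> Prop) (F : tb) : Prop := (forall i, D (F i)) /\ eps F = 0.

Variable D : Y -> Prop.
Hypothesis hD : sbm D.

Lemma all_sum (F : tb) : (forall i, D (F i)) -> forall j r, D ((bl r F : tb) j).
Proof.
move=> h j r; rewrite [bl _ _]/= /ten_bl opmE.
by apply: sbm_sum => // i; apply: sbmZ.
Qed.

Lemma sbm_ten : sbm (fun F : tb => forall i, D (F i)).
Proof.
split=> [i|x y hx hy i|a x hx i|r x hx i|r x hx i|x hx|x hx]; rewrite ?ffunE.
- exact: sbm0.
- exact: sbmD.
- exact: sbmZ.
- exact: all_sum.
- by apply: sbmr.
- rewrite [bl _ _]/= /ten_bl -[RHS]opm_id; apply: opm_ext => s; exact: mul1r.
- by apply/ffunP => i; rewrite ffunE (sbm1r hD).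
Qed.

Lemma sbm_KD : sbm (KD D).
Proof.
have [h0 hA hZ hl hr h1 h2] := sbm_ten.
split=> [|x y [hx ex] [hy ey]|a x [hx ex]|r x [hx ex]|r x [hx ex]|x [hx ex]|x [hx ex]].
- by split=> //; exact: klin0 eps_lin.
- by split; [exact: hA|rewrite (klinD eps_lin) ex ey addr0].
- by split; [exact: hZ|rewrite (klinZ eps_lin) ex scaler0].
- by split; [exact: hl|rewrite eps_bl ex (klin0 (bl_lin _))].
- by split; [exact: hr|rewrite eps_br ex (klin0 (br_lin _))].
- exact: h1.
- exact: h2.
Qed.

Lemma eps_D (F : tb) : (forall i, D (F i)) -> D (eps F).
Proof. by move=> h; apply: sbm_sum => // i; apply: sbml. Qed.
Lemma rho_D (F : tb) : (forall i, D (F i)) -> D (rho F).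
Proof. by move=> h; apply: sbm_sum => // i; apply: sbmr. Qed.
Lemma pur_D r y : D y -> forall i, D ((pur r y : tb) i).
Proof. by move=> h i; rewrite purE; apply: sbmZ. Qed.
End Ten.

(** [eps - rho] sends r (x) y to r y - y r, so a single family [F] collects all terms of a sum of
    commutators. *)
Lemma comm_witness (Y : bimod) (D : Y -> Prop) x : sbm D -> comm D x ->
  exists2 F : tb Y, (forall i, D (F i)) & x = eps F - rho F.
Proof.
move=> hD; elim=> [|r y x' hy _ [F hF ->]].
  exists 0; first exact: sbm0 (sbm_ten hD).
  by rewrite (klin0 (@eps_lin _)) (klin0 (@rho_lin _)) subrr.
exists (pur r y + F).
  exact: (sbmD (sbm_ten hD) (pur_D hD r hy) hF).
rewrite (klinD (@eps_lin _)) (klinD (@rho_lin _)) eps_pur rho_pur.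
by rewrite opprD addrACA.
Qed.

Lemma eps_rho_comm (Y : bimod) (D : Y -> Prop) (F : tb Y) :
  (forall i, D (F i)) -> comm D (eps F - rho F).
Proof.
by move=> h; rewrite /eps /rho /vlift -sumrB; apply: comm_sum => i; apply: comm1.
Qed.

(** Vanishing of H_1: in 0 -> K -> R (x) D -> D -> 0 the middle term is acyclic, so H_1(D) is the
    kernel of the map induced by [rho] on the coinvariants of K. *)
Definition HV0 (Y : bimod) (D : Y -> Prop) : Prop :=
  forall F : tb Y, KD D F -> rho F = 0 -> comm (KD D) F.

Fixpoint VTn (n : nat) (Y : bimod) : bimod :=
  if n is n'.+1 then tb (VTn n' Y) else Y.
Fixpoint KDn (n : nat) (Y : bimod) (D : Y -> Prop) : VTn n Y -> Prop :=
  if n is n'.+1 then KD (@KDn n' Y D) else D.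

(* Vanishing of the Hochschild homology of R in degree n + 1 with coefficients in D, by
   dimension shifting along 0 -> KD D -> R (x) D -> D -> 0; the coinvariants of R (x) D
   are D, through [rho]. *)
Definition HV (n : nat) (Y : bimod) (D : Y -> Prop) : Prop :=
  HV0 (@KDn n Y D).

Lemma sbm_KDn n (Y : bimod) (D : Y -> Prop) : sbm D -> sbm (@KDn n Y D).
Proof. by move=> h; elim: n => //= n IH; apply: sbm_KD. Qed.

Record ses (Y : bimod) (D : Y -> Prop) (Z : bimod) (D' : Z -> Prop) (g : Y -> Z) : Prop := Ses {
  ses_s : sbm D;
  ses_s' : sbm D';
  ses_h : bhom g;
  ses_in : forall y, D y -> D' (g y);
  ses_sur : forall z, D' z -> exists2 y, D y & g y = z
}.

Definition kerD (Y : bimod) (D : Y -> Prop) (Z : bimod) (g : Y -> Z) (y : Y) : Prop :=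
  D y /\ g y = 0.

Section Ses.
Variables (Y : bimod) (D : Y -> Prop) (Z : bimod) (D' : Z -> Prop) (g : Y -> Z).
Hypothesis hs : ses D D' g.
Let hD := ses_s hs.
Let hD' := ses_s' hs.
Let gh := ses_h hs.
Let gl := bh_lin gh.

Lemma sbm_ker : sbm (kerD D g).
Proof.
split=> [|x y [hx ex] [hy ey]|a x [hx ex]|r x [hx ex]|r x [hx ex]|x [hx ex]|x [hx ex]].
- by split; [exact: sbm0|exact: klin0].
- by split; [exact: sbmD|rewrite (klinD gl) ex ey addr0].
- by split; [exact: sbmZ|rewrite (klinZ gl) ex scaler0].
- by split; [exact: sbml|rewrite (bh_l gh) ex (klin0 (bl_lin _))].
- by split; [exact: sbmr|rewrite (bh_r gh) ex (klin0 (br_lin _))].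
- exact: (sbm1l hD).
- exact: (sbm1r hD).
Qed.

Lemma vmap_bhom : bhom (vmap g : tb Y -> tb Z).
Proof.
split=> [|r F|r F]; first exact: vmap_lin.
  by rewrite [LHS]/= /ten_bl -opm_vmap //; exact: mul_linr.
by apply/ffunP => i; rewrite !ffunE (bh_r gh).
Qed.
Lemma vmap_eps F : eps (vmap g F : tb Z) = g (eps F).
Proof.
move: F; apply: VT_ext => [||r y].
- exact: klin_comp (@eps_lin _) (vmap_lin gl).
- exact: klin_comp gl (@eps_lin _).
- by rewrite vmap_pur // !eps_pur (bh_l gh).
Qed.
Lemma vmap_rho F : rho (vmap g F : tb Z) = g (rho F).
Proof.
move: F; apply: VT_ext => [||r y].
- exact: klin_comp (@rho_lin _) (vmap_lin gl).
- exact: klin_comp gl (@rho_lin _).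
- by rewrite vmap_pur // !rho_pur (bh_r gh).
Qed.

Lemma lift_fam (F : tb Z) : (forall i, D' (F i)) ->
  exists2 G : tb Y, (forall i, D (G i)) & vmap g G = F.
Proof.
move=> h; have /choice [G hG] : forall i, exists y, D y /\ g y = F i.
  by move=> i; have [y hy e] := ses_sur hs (h i); exists y.
exists [ffun i => G i] => [i|]; first by rewrite ffunE; have [] := hG i.
by apply/ffunP => i; rewrite !ffunE; have [] := hG i.
Qed.

Lemma ses_K : ses (KD D) (KD D') (vmap g : tb Y -> tb Z).
Proof.
split; [exact: sbm_KD|exact: sbm_KD|exact: vmap_bhom| |].
- move=> F [hF eF]; split; last by rewrite vmap_eps eF (klin0 gl).
  by move=> i; rewrite ffunE; apply: (ses_in hs).
- move=> F [hF eF]; have [G hG GF] := lift_fam hF.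
  have ge : g (eps G) = 0 by rewrite -vmap_eps GF.
  (* Subtracting 1 (x) [eps G] brings the lift into the kernel of [eps]; the correction dies in Z
     because g (eps G) = 0. *)
  exists (G - pur 1 (eps G)).
    split; last by rewrite (klinB (@eps_lin _)) eps_pur (sbm1l hD) ?subrr //; apply: eps_D.
    apply: (sbmB (sbm_ten hD) hG); apply: pur_D => //; exact: eps_D.
  by rewrite (klinB (vmap_lin gl)) vmap_pur // ge (klin0 (pur_linr _)) subr0.
Qed.

Lemma kerD_K F : kerD (KD D) (vmap g : tb Y -> tb Z) F <-> KD (kerD D g) F.
Proof.
split=> [[[h e] /ffunP h']|[h e]].
  by split=> // i; split=> //; have := h' i; rewrite !ffunE.
split; first by split=> // i; have [] := h i.
by apply/ffunP => i; rewrite !ffunE; have [] := h i.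
Qed.

(** In H_1(D') -> H_0(ker g) -> H_0(D) this says that the connecting map is zero. *)
Definition Tinj : Prop := forall x, kerD D g x -> comm D x -> comm (kerD D g) x.

(** Chase of the connecting map: x is minus [rho] of an element [F1] of the syzygy of D. The image
    of F1 in the syzygy of D' is a sum of commutators; subtracting a lift [G] of it moves F1 into
    the syzygy of ker g without changing [rho]. *)
Lemma les_a : HV0 D' -> Tinj.
Proof.
move=> hv x [Dx gx] /(comm_witness hD) [F hF ex].
set F1 : tb Y := F - pur 1 (eps F).
have hF1 : KD D F1.
  split; last by rewrite (klinB (@eps_lin _)) eps_pur (sbm1l hD) ?subrr //; apply: eps_D.
  apply: (sbmB (sbm_ten hD) hF); apply: pur_D => //; exact: eps_D.
have rF1 : rho F1 = - x.
  rewrite (klinB (@rho_lin _)) rho_pur (sbm1r hD) ?ex ?opprB //; exact: eps_D.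
have /(comm_lift vmap_bhom (ses_sur ses_K)) [G hG gG] : comm (KD D') (vmap g F1).
  apply: hv; first exact: (ses_in ses_K).
  by rewrite vmap_rho rF1 (klinN gl) gx oppr0.
have [hK eK] : KD (kerD D g) (F1 - G).
  apply/kerD_K; split; last by rewrite (klinB (vmap_lin gl)) gG subrr.
  exact: (sbmB (sbm_KD hD) hF1 (comm_in (sbm_KD hD) hG)).
have -> : x = eps (F1 - G) - rho (F1 - G).
  by rewrite eK (klinB (@rho_lin _)) rF1 (rho_comm hG) subr0 sub0r opprK.
exact: eps_rho_comm.
Qed.

(** For a lift G of F, [rho G] lies in ker g and in the commutators of D, hence by [Tinj] in those
    of ker g. This provides H in the syzygy of ker g with the same [rho], and G - H is a lift of F
    to which the hypothesis on D applies. *)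
Lemma les_c : Tinj -> HV0 D -> HV0 D'.
Proof.
move=> ti hv F hF rF; have [G hG gG] := ses_sur ses_K hF.
have hr : kerD D g (rho G).
  by split; [apply: rho_D => //; case: hG|rewrite -vmap_rho gG].
have hc : comm D (rho G).
  have [h e] := hG; rewrite -[rho G]opprK; apply: commN => //.
  by rewrite -[- _]add0r -e; apply: eps_rho_comm.
have [H hH eH] : exists2 H : tb Y, KD (kerD D g) H & rho H = rho G.
  have [H0 h0 e0] := comm_witness sbm_ker (ti _ hr hc).
  have hE : kerD D g (eps H0) by exact: eps_D sbm_ker _ h0.
  exists (pur 1 (eps H0) - H0).
    split; last by rewrite (klinB (@eps_lin _)) eps_pur (sbm1l sbm_ker) ?subrr.
    exact: (sbmB (sbm_ten sbm_ker) (pur_D sbm_ker 1 hE) h0).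
  by rewrite (klinB (@rho_lin _)) rho_pur (sbm1r sbm_ker) // e0.
have hGH : comm (KD D) (G - H).
  apply: hv; last by rewrite (klinB (@rho_lin _)) eH subrr.
  have /kerD_K[hH' _] := hH; exact: (sbmB (sbm_KD hD) hG hH').
have gH : vmap g H = 0 by have /kerD_K[] := hH.
rewrite -gG -[G](subrK H) (klinD (vmap_lin gl)) gH addr0.
by apply: comm_img vmap_bhom _ hGH => y; apply: (ses_in ses_K).
Qed.
End Ses.

(** Syzygies commute with kernels, so this is [les_a] one degree higher: H_2(D') = 0 and H_1(D) = 0
    give H_1(ker g) = 0. *)
Lemma les_d (Y : bimod) (D : Y -> Prop) (Z : bimod) (D' : Z -> Prop) (g : Y -> Z) :
  ses D D' g -> HV0 (KD D') -> HV0 D -> HV0 (kerD D g).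
Proof.
move=> hs hz hy F hF rF.
have /kerD_K hF' := hF.
have -> : KD (kerD D g) = kerD (KD D) (vmap g : tb Y -> tb Z).
  by apply/funext => H; apply/propext; rewrite kerD_K.
apply: (les_a (ses_K hs)) => //.
by apply: hy => //; case: hF'.
Qed.

Fixpoint Kmap (n : nat) (Y Z : bimod) (g : Y -> Z) : VTn n Y -> VTn n Z :=
  if n is n'.+1 then vmap (@Kmap n' Y Z g) else g.

Lemma ses_Kn n (Y : bimod) (D : Y -> Prop) (Z : bimod) (D' : Z -> Prop) (g : Y -> Z) :
  ses D D' g -> ses (@KDn n Y D) (@KDn n Z D') (@Kmap n Y Z g).
Proof. by move=> h; elim: n => //= n IH; apply: ses_K. Qed.

Lemma kerD_Kn n (Y : bimod) (D : Y -> Prop) (Z : bimod) (D' : Z -> Prop) (g : Y -> Z) :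
  ses D D' g -> kerD (@KDn n Y D) (@Kmap n Y Z g) = @KDn n Y (kerD D g).
Proof.
move=> h; elim: n => //= n IH; rewrite -IH.
by apply/funext => H; apply/propext; exact: kerD_K.
Qed.

Lemma HV_ker n (Y : bimod) (D : Y -> Prop) (Z : bimod) (D' : Z -> Prop) (g : Y -> Z) :
  ses D D' g -> HV n.+1 D' -> HV n D -> HV n (kerD D g).
Proof.
by move=> h hz hy; rewrite /HV -(kerD_Kn n h); apply: les_d (ses_Kn n h) _ _.
Qed.

Lemma HV_quot0 (Y : bimod) (D : Y -> Prop) (Z : bimod) (D' : Z -> Prop) (g : Y -> Z) :
  ses D D' g -> Tinj D g -> HV 0 D -> HV 0 D'.
Proof. exact: les_c. Qed.

Lemma HV_Tinj (Y : bimod) (D : Y -> Prop) (Z : bimod) (D' : Z -> Prop) (g : Y -> Z) :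
  ses D D' g -> HV 0 D' -> Tinj D g.
Proof. exact: les_a. Qed.

(** [Tinj] holds on the syzygies: a commutator has zero [rho], and vanishing for the kernel of g
    makes it a commutator there. *)
Lemma HV_quot n (Y : bimod) (D : Y -> Prop) (Z : bimod) (D' : Z -> Prop) (g : Y -> Z) :
  ses D D' g -> HV n (kerD D g) -> HV n.+1 D -> HV n.+1 D'.
Proof.
move=> h hx hy; apply: les_c (ses_Kn n.+1 h) _ hy.
move=> F hF cF; rewrite (kerD_Kn n.+1 h) in hF *.
by apply: hx hF (rho_comm cF).
Qed.

(** The kernel is zero and so are its syzygies, hence [Tinj] is trivial. Injectivity is asked on D
    only; the ambient spaces may be quite different. *)
Lemma HV_iso n (Y : bimod) (D : Y -> Prop) (Z : bimod) (D' : Z -> Prop) (g : Y -> Z) :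
  ses D D' g -> (forall y, D y -> g y = 0 -> y = 0) -> HV n D -> HV n D'.
Proof.
move=> h inj hy; apply: les_c (ses_Kn n h) _ hy => F.
suff hz : forall F, kerD (@KDn n _ D) (@Kmap n _ _ g) F -> F = 0.
  by move=> /hz -> _; exact: comm0.
elim: n {F} => [|n IH] /= F [hF eF]; first exact: inj.
apply/ffunP => i; rewrite ffunE; apply: IH; split; first by case: hF => /(_ i).
by move/ffunP: eF => /(_ i); rewrite !ffunE.
Qed.

End Bimod.

(** * Acyclic coefficients and dimension shifting *)

Section Acyclic.
Variables (k : fieldType) (R : falgType k).

(* [s i x] is the i-th coordinate of x : D is a direct factor of R (x) D as a bimodule. *)
Record lfree (Y : bimod R) (D : Y -> Prop) (s : ix R -> Y -> Y) : Prop := Lfree {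
  lf_lin : forall i, klin (s i);
  lf_D : forall i x, D x -> D (s i x);
  lf_r : forall i r x, s i (br r x) = br r (s i x);
  lf_l : forall j r x, s j (bl r x) = \sum_i co j (r * bs i) *: s i x;
  lf_rec : forall x, D x -> \sum_i bl (bs i) (s i x) = x
}.

Section Lfree.
Variables (Y : bimod R) (D : Y -> Prop) (s : ix R -> Y -> Y).
Hypotheses (hD : sbm D) (hs : lfree D s).

Let sg (x : Y) : tb Y := [ffun i => s i x].
Let sg_hom : bhom sg.
Proof.
split=> [a x y|r x|r x]; apply/ffunP => i.
- by rewrite !ffunE (lf_lin hs).
- by rewrite [bl _ _]/= /ten_bl opmE ffunE (lf_l hs); apply: eq_bigr => j _; rewrite ffunE.
- by rewrite !ffunE (lf_r hs).
Qed.
Let eps_sg x : D x -> eps (sg x) = x.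
Proof.
by move=> h; rewrite -[RHS](lf_rec hs h); apply: eq_bigr => i _; rewrite ffunE.
Qed.
Let p (F : tb Y) : tb Y := F - sg (eps F).
Let p_hom : bhom p.
Proof.
have hl := bh_lin sg_hom.
split=> [a x y|r x|r x]; rewrite /p.
- by rewrite (@eps_lin _ _ Y) hl scalerBr opprD addrACA.
- by rewrite eps_bl (bh_l sg_hom) (klinB (bl_lin r)).
- by rewrite eps_br (bh_r sg_hom) (klinB (br_lin r)).
Qed.
Let p_K (F : tb Y) : (forall i, D (F i)) -> KD D (p F).
Proof.
move=> h; have he := eps_D hD h; split; last first.
  by rewrite (klinB (@eps_lin _ _ _)) eps_sg ?subrr.
by apply: (sbmB (sbm_ten hD) h) => i; rewrite ffunE; apply: (lf_D hs).
Qed.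
Let p_id F : eps F = 0 -> p F = F.
Proof. by move=> e; rewrite /p e (klin0 (bh_lin sg_hom)) subr0. Qed.

(** F = sum_i b_i (1 (x) F_i), whereas sum_i (1 (x) F_i) b_i = 1 (x) [rho F] = 0. The bimodule
    projection [p] of R (x) D onto the syzygy fixes F and turns the difference of the two sums into
    commutators of the syzygy. *)
Lemma lfree_HV0 : HV0 D.
Proof.
move=> F hF rF; have [h e] := hF.
have e1 : F = \sum_i bl (bs i) (pur 1 (F i) : tb Y).
  rewrite [LHS]VT_sum; apply: eq_bigr => i _; by rewrite bl_pur mulr1.
have e2 : \sum_i br (bs i) (pur 1 (F i) : tb Y) = 0.
  transitivity (pur 1 (rho F) : tb Y); last by rewrite rF (klin0 (pur_linr _)).
  rewrite /rho /vlift (klin_sum (pur_linr _)); apply: eq_bigr => i _; exact: br_pur.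
have -> : F = \sum_i (bl (bs i) (p (pur 1 (F i))) - br (bs i) (p (pur 1 (F i)))).
  transitivity (p (\sum_i bl (bs i) (pur 1 (F i) : tb Y) - \sum_i br (bs i) (pur 1 (F i) : tb Y))).
    by rewrite e2 subr0 -e1 p_id.
  rewrite -sumrB (klin_sum (bh_lin p_hom)).
  apply: eq_bigr => i _.
  by rewrite (klinB (bh_lin p_hom)) (bh_l p_hom) (bh_r p_hom).
by apply: comm_sum => i; apply: comm1; apply: p_K; apply: pur_D.
Qed.

(** The syzygy is the image of R (x) D under [p] and inherits coordinates from the factor R, so
    acyclicity propagates to all degrees. *)
Lemma lfree_K : lfree (KD D) (fun i F => p (pur 1 (F i))).
Proof.
split=> [i|i F [h e]|i r F|j r F|F [h e]].
- exact: klin_comp (bh_lin p_hom) (klin_comp (pur_linr _) (@ev_lin _ _ _ i)).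
- by apply: p_K; apply: pur_D.
- by rewrite -(bh_r p_hom) br_pur ffunE.
- rewrite [bl _ _]/= /ten_bl opmE (klin_sum (pur_linr _)) (klin_sum (bh_lin p_hom)).
  by apply: eq_bigr => i _; rewrite (klinZ (pur_linr _)) (klinZ (bh_lin p_hom)).
- rewrite -[RHS](p_id e) [in RHS](VT_sum F) (klin_sum (bh_lin p_hom)).
  by apply: eq_bigr => i _; rewrite -(bh_l p_hom) bl_pur mulr1.
Qed.
End Lfree.

Lemma lfree_HV (Y : bimod R) (D : Y -> Prop) s n : sbm D -> lfree D s -> HV n D.
Proof.
move=> hD hs; suff [t ht] : exists t, lfree (@KDn _ _ n Y D) t.
  by apply: lfree_HV0 ht; apply: sbm_KDn.
elim: n => [|n [t ht]]; first by exists s.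
by eexists; apply: lfree_K ht; apply: sbm_KDn.
Qed.

(** The mirror image of [lfree]: D is a direct factor of D (x) R. It serves eL (x) X for a
    projective right module X. *)
Record rfree (Y : bimod R) (D : Y -> Prop) (s : ix R -> Y -> Y) : Prop := Rfree {
  rf_lin : forall i, klin (s i);
  rf_D : forall i x, D x -> D (s i x);
  rf_l : forall i r x, s i (bl r x) = bl r (s i x);
  rf_r : forall j r x, s j (br r x) = \sum_i co j (bs i * r) *: s i x;
  rf_rec : forall x, D x -> \sum_i br (bs i) (s i x) = x
}.

Section Rfree.
Variables (Y : bimod R) (D : Y -> Prop) (s : ix R -> Y -> Y).
Hypotheses (hD : sbm D) (hs : rfree D s).

Let S i (F : tb Y) : tb Y := vmap (s i) F.
Let S_eps i F : eps (S i F) = s i (eps F).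
Proof.
move: F; apply: VT_ext => [||r y].
- exact: klin_comp (@eps_lin _ _ _) (vmap_lin (rf_lin hs i)).
- exact: klin_comp (rf_lin hs i) (@eps_lin _ _ _).
- by rewrite /S vmap_pur ?eps_pur ?(rf_l hs) //; exact: rf_lin hs i.
Qed.
Let S_K i F : KD D F -> KD D (S i F).
Proof.
case=> h e; split; last by rewrite S_eps e (klin0 (rf_lin hs i)).
by move=> j; rewrite ffunE; apply: (rf_D hs).
Qed.

Lemma rfree_K : rfree (KD D) S.
Proof.
split=> [i|i F|i r F|j r F|F [h e]].
- exact: vmap_lin (rf_lin hs i).
- exact: S_K.
- rewrite [RHS]opm_vmap //; [exact: mul_linr|exact: rf_lin hs i].
- apply/ffunP => l; rewrite !ffunE (rf_r hs) sum_ffunE.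
  by apply: eq_bigr => i _; rewrite !ffunE.
- apply/ffunP => l; rewrite sum_ffunE -[RHS](rf_rec hs (h l)).
  by apply: eq_bigr => i _; rewrite !ffunE.
Qed.

(** F = sum_i (S_i F) b_i, while sum_i b_i (S_i F) depends on F only through [rho F] and so
    vanishes. *)
Lemma rfree_HV0 : HV0 D.
Proof.
move=> F hF rF.
have h1 : \sum_i bl (bs i) (S i F) = \sum_j pur (bs j) (s j (rho F)) :> tb Y.
  move: F {hF rF}; apply: VT_ext => [||r y].
  - by apply: klin_bigsum => i; exact: (@klin_comp _ (tb Y) (tb Y) (tb Y) _ _ (bl_lin (bs i)) (vmap_lin (rf_lin hs i))).
  - apply: klin_bigsum => i.
    exact: klin_comp (pur_linr _) (klin_comp (rf_lin hs i) (@rho_lin _ _ _)).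
  rewrite rho_pur.
  transitivity (\sum_i pur (bs i * r) (s i y) : tb Y).
    by apply: eq_bigr => i _; rewrite /S vmap_pur ?bl_pur //; exact: rf_lin hs i.
  transitivity (\sum_i \sum_j co j (bs i * r) *: pur (bs j) (s i y) : tb Y).
    apply: eq_bigr => i _; rewrite -{1}(co_sum (bs i * r)) (klin_sum (pur_linl _)).
    by apply: eq_bigr => j _; rewrite (klinZ (pur_linl _)).
  rewrite exchange_big /=; apply: eq_bigr => j _.
  rewrite (rf_r hs) (klin_sum (pur_linr _)).
  by apply: eq_bigr => i _; rewrite (klinZ (pur_linr _)).
have h2 : F = \sum_i br (bs i) (S i F) - \sum_i bl (bs i) (S i F).
  rewrite (rf_rec rfree_K hF) h1 [X in _ - X]big1 ?subr0 // => j _.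
  by rewrite rF (klin0 (rf_lin hs j)) (klin0 (pur_linr _)).
rewrite h2 -sumrB; apply: comm_sum => i; apply: commC; first exact: sbm_KD.
exact: S_K.
Qed.
End Rfree.

Lemma rfree_HV (Y : bimod R) (D : Y -> Prop) s n : sbm D -> rfree D s -> HV n D.
Proof.
move=> hD hs; suff [t ht] : exists t, rfree (@KDn _ _ n Y D) t.
  by apply: rfree_HV0 ht; apply: sbm_KDn.
elim: n => [|n [t ht]]; first by exists s.
by eexists; apply: rfree_K ht.
Qed.

(** D is a retract of a direct sum of copies of DE, every element having finite support. The sum
    itself is not built, only the maps to and from its components. *)
Record dsum (J : eqType) (Y : bimod R) (D : Y -> Prop) (E : bimod R) (DE : E -> Prop)
    (p : J -> Y -> E) (q : J -> E -> Y) : Prop := Dsum {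
  ds_p : forall j, bhom (p j);
  ds_q : forall j, bhom (q j);
  ds_pD : forall j y, D y -> DE (p j y);
  ds_qD : forall j y, DE y -> D (q j y);
  ds_fin : forall y, D y -> exists s : seq J, forall j, j \notin s -> p j y = 0;
  ds_rec : forall y (s : seq J), D y -> uniq s -> (forall j, j \notin s -> p j y = 0) ->
    y = \sum_(j <- s) q j (p j y)
}.

Lemma bhom_K (Y Z : bimod R) (g : Y -> Z) : bhom g -> bhom (vmap g : tb Y -> tb Z).
Proof.
move=> gh; have gl := bh_lin gh; split=> [|r F|r F]; first exact: vmap_lin.
  by rewrite [LHS]/= /ten_bl -opm_vmap //; exact: mul_linr.
by apply/ffunP => i; rewrite !ffunE (bh_r gh).
Qed.
Lemma bhom_eps (Y Z : bimod R) (g : Y -> Z) (F : tb Y) : bhom g ->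
  eps (vmap g F : tb Z) = g (eps F).
Proof.
move=> gh; have gl := bh_lin gh; move: F; apply: VT_ext => [||r y].
- exact: klin_comp (@eps_lin _ _ _) (vmap_lin gl).
- exact: klin_comp gl (@eps_lin _ _ _).
- by rewrite vmap_pur // !eps_pur (bh_l gh).
Qed.
Lemma bhom_rho (Y Z : bimod R) (g : Y -> Z) (F : tb Y) : bhom g ->
  rho (vmap g F : tb Z) = g (rho F).
Proof.
move=> gh; have gl := bh_lin gh; move: F; apply: VT_ext => [||r y].
- exact: klin_comp (@rho_lin _ _ _) (vmap_lin gl).
- exact: klin_comp gl (@rho_lin _ _ _).
- by rewrite vmap_pur // !rho_pur (bh_r gh).
Qed.
Lemma bhom_KD (Y Z : bimod R) (g : Y -> Z) (D : Y -> Prop) (D' : Z -> Prop) (F : tb Y) :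
  bhom g -> (forall y, D y -> D' (g y)) -> KD D F -> KD D' (vmap g F : tb Z).
Proof.
move=> gh h [hF eF]; split; last by rewrite bhom_eps // eF (klin0 (bh_lin gh)).
by move=> i; rewrite ffunE; apply: h.
Qed.

Lemma dsum_K (J : eqType) (Y : bimod R) (D : Y -> Prop) (E : bimod R) (DE : E -> Prop)
    (p : J -> Y -> E) (q : J -> E -> Y) : dsum D DE p q ->
  dsum (KD D) (KD DE) (fun j => vmap (p j) : tb Y -> tb E) (fun j => vmap (q j)).
Proof.
move=> h; split=> [j|j|j F|j F|F [hF eF]|F s [hF eF] us hs].
- by apply: bhom_K; apply: ds_p h j.
- by apply: bhom_K; apply: ds_q h j.
- by apply: bhom_KD; [apply: ds_p h j|apply: ds_pD h j].
- by apply: bhom_KD; [apply: ds_q h j|apply: ds_qD h j].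
- have /choice [s hs] := fun i => ds_fin h (hF i).
  exists (flatten [seq s i | i : ix R]) => j jn; apply/ffunP => i; rewrite !ffunE.
  apply: hs; apply: contra jn => ji; apply/flattenP; exists (s i) => //.
  by apply: map_f; rewrite mem_enum.
- apply/ffunP => i; rewrite sum_ffunE [LHS](ds_rec h (hF i) us) => [|j js].
    by apply: eq_bigr => j _; rewrite !ffunE.
  by have /ffunP /(_ i) := hs _ js; rewrite !ffunE.
Qed.

Lemma dsum_HV0 (J : eqType) (Y : bimod R) (D : Y -> Prop) (E : bimod R) (DE : E -> Prop)
    (p : J -> Y -> E) (q : J -> E -> Y) : dsum D DE p q -> HV0 DE -> HV0 D.
Proof.
move=> h hv F hF rF; have hK := dsum_K h.
have [s hs] := ds_fin hK hF.
rewrite (ds_rec hK hF (undup_uniq s)) => [|j]; last by rewrite mem_undup; apply: hs.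
apply: comm_sum => j.
have hc : comm (KD DE) (vmap (p j) F : tb E).
  apply: hv; first exact: (ds_pD hK).
  by rewrite bhom_rho ?rF ?(klin0 (bh_lin (ds_p h j))) //; apply: ds_p h j.
by apply: comm_img hc => [|y]; [exact: ds_q hK j|exact: (ds_qD hK)].
Qed.

Lemma dsum_HV n (J : eqType) (Y : bimod R) (D : Y -> Prop) (E : bimod R) (DE : E -> Prop)
    (p : J -> Y -> E) (q : J -> E -> Y) : dsum D DE p q -> HV n DE -> HV n D.
Proof.
move=> h; suff [p' [q' hn]] : exists (p' : J -> VTn n Y -> VTn n E)
  (q' : J -> VTn n E -> VTn n Y), dsum (@KDn _ _ n Y D) (@KDn _ _ n E DE) p' q'.
  exact: dsum_HV0 hn.
elim: n => [|n [p' [q' IH]]]; first by exists p, q.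
by do 2 eexists; apply: dsum_K IH.
Qed.

(* J n is the n-th syzygy in an exact sequence ... -> D 2 -> D 1 -> J 0 -> 0. *)
Record resol (Y : nat -> bimod R) (D J : forall n, Y n -> Prop)
    (g : forall n, Y n.+1 -> Y n) : Prop := Resol {
  rs_ses : forall n, ses (D n.+1) (J n) (g n);
  rs_ker : forall n x, kerD (D n.+1) (g n) x <-> J n.+1 x;
  rs_HV : forall n m, HV m (D n.+1)
}.

Arguments rs_HV {Y D J g} r n m : rename.
Arguments rs_ses {Y D J g} r n : rename.
Arguments rs_ker {Y D J g} r n x : rename.

(** As every [D n.+1] is acyclic, H_{m+1}(J 0) is H_1(J m), which is the kernel of the map from the
    coinvariants of [J m.+1] to those of [D m.+1]. *)
Lemma dim_shift m Y D J g : @resol Y D J g -> HV m (J 0) <-> Tinj (D m.+1) (g m).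
Proof.
elim: m Y D J g => [|m IH] Y D J g h.
  split; first exact: HV_Tinj (rs_ses h 0).
  by move=> t; exact (HV_quot0 (rs_ses h 0%N) t (rs_HV h 0%N 0%N)).
have e : kerD (D 1) (g 0) = J 1 by apply/funext => x; apply/propext; apply: rs_ker h 0 x.
have h' : @resol (fun n => Y n.+1) (fun n => D n.+1) (fun n => J n.+1) (fun n => g n.+1).
  by split=> n; [apply: rs_ses h _|apply: rs_ker h _|apply: rs_HV h _].
rewrite -(IH _ _ _ _ h') -e; split=> [hv|hv].
  by apply: HV_ker (rs_ses h 0) hv (rs_HV h 0 m).
by apply: HV_quot (rs_ses h 0) hv (rs_HV h 0 m.+1).
Qed.
End Acyclic.
Arguments rs_HV {k R Y D J g} r n m : rename.
Arguments rs_ses {k R Y D J g} r n : rename.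
Arguments rs_ker {k R Y D J g} r n x : rename.

(** * Free modules and free resolutions *)

Section QuotientGroup.
Variables (V : zmodType) (S : V -> Prop).
Hypotheses (S0 : S 0) (SB : forall x y, S x -> S y -> S (x - y)).

Let SN x : S x -> S (- x).
Proof. by move=> h; rewrite -sub0r; apply: SB. Qed.
Let SD x y : S x -> S y -> S (x + y).
Proof. by move=> h h'; rewrite -[y]opprK; apply: SB => //; apply: SN. Qed.

Let req (x y : V) : bool := `[< S (x - y) >].
Let req_refl : reflexive req.
Proof. by move=> x; apply/asboolP; rewrite subrr. Qed.
Let req_sym : symmetric req.
Proof. by move=> x y; apply/asboolP/asboolP => /SN; rewrite opprB. Qed.
Let req_trans : transitive req.
Proof.
move=> y x z /asboolP h /asboolP h'; apply/asboolP.
by rewrite -(subrKA y); apply: SD.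
Qed.

(** Tensors are equal when no balanced map separates them, so a conclusion from a vanishing tensor
    requires a suitable target group. This quotient provides it. *)
Lemma quotient_group : exists (Q : zmodType) (p : V -> Q),
  [/\ forall x y, p (x + y) = p x + p y, forall x, p x = 0 <-> S x
    & forall q, exists x, p x = q].
Proof.
pose E := EquivRel req req_refl req_sym req_trans.
pose T : choiceType := {eq_quot E}.
pose p (x : V) : T := \pi_({eq_quot E}) x.
pose o (t : T) : V := repr (t : {eq_quot E}).
have oK t : p (o t) = t by exact: reprK.
have pP x y : p x = p y <-> S (x - y).
  split=> [/eqmodP /asboolP //|h]; by apply/eqmodP; apply/asboolP.
have po x : S (o (p x) - x) by apply/pP; rewrite oK.
pose add (t u : T) := p (o t + o u).
pose opp (t : T) := p (- o t).
have addE x y : add (p x) (p y) = p (x + y).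
  by apply/pP; rewrite opprD addrACA; apply: SD.
have oppE x : opp (p x) = p (- x) by apply/pP; rewrite -opprD; apply: SN.
have pind (P : T -> Prop) : (forall x, P (p x)) -> forall t, P t.
  by move=> h t; rewrite -(oK t).
have addA : associative add.
  by elim/pind=> x; elim/pind=> y; elim/pind=> z; rewrite !addE addrA.
have addC : commutative add.
  by elim/pind=> x; elim/pind=> y; rewrite !addE addrC.
have add0 : left_id (p 0) add by elim/pind=> x; rewrite addE add0r.
have addN : left_inverse (p 0) opp add.
  by elim/pind=> x; rewrite oppE addE addNr.
pose Q : zmodType := HB.pack (Choice.sort T) (Choice.class T) (GRing.isZmodule.Build T addA addC add0 addN).
exists Q, p; split=> [x y|x|q]; first exact/esym/addE.
  by rewrite -[0]/(p 0) pP subr0.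
by exists (o q).
Qed.
End QuotientGroup.

(** Modulo S the map t becomes balanced, so it factors through the tensor product and sends a zero
    tensor into S. *)
Lemma tens_zeroP (A : pzRingType) (M : lmodType A^c) (N : lmodType A)
    (V : zmodType) (S : V -> Prop) (t : M -> N -> V) (s : seq (M * N)) :
  S 0 -> (forall x y, S x -> S y -> S (x - y)) ->
  (forall x x' y, t (x + x') y = t x y + t x' y) ->
  (forall x y y', t x (y + y') = t x y + t x y') ->
  (forall (a : A) x y, S (t ((a : A^c) *: x) y - t x (a *: y))) ->
  \sum_(p <- s) (pure _ _ p.1 p.2 : tens M N) = 0 ->
  S (\sum_(p <- s) t p.1 p.2).
Proof.
move=> S0 SB tl tr tb hz; have [Q [p [pD pS _]]] := quotient_group S0 SB.
have p0 : p 0 = 0 by apply/pS.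
have pB x y : p (x - y) = p x - p y.
  by apply: (addIr (p y)); rewrite -pD !subrK.
pose f x y := p (t x y).
have fb : balanced (fun (a : A) (x : M) => (a : A^c) *: x) (fun (a : A) (y : N) => a *: y) f.
  split=> [x x' y|x y y'|a x y]; rewrite /f ?tl ?tr ?pD //.
  by apply/eqP; rewrite -subr_eq0 -pB; apply/eqP/pS.
apply/pS; have l0 : tens_lift f (0 : tens M N) = 0.
  by apply: (addIr (tens_lift f (0 : tens M N))); rewrite -(tens_liftD fb) !add0r.
rewrite (big_morph p pD p0) -[RHS]l0 -hz (big_morph _ (tens_liftD fb) l0).
by apply: eq_bigr => q _; rewrite tens_liftE.
Qed.

Definition mklin (R : pzRingType) (X Y : lmodType R) (f : X -> Y)
    (h : GRing.linear_for *:%R f) : {linear X -> Y} :=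
  HB.pack f (GRing.isLinear.Build R X Y *:%R f h).

Section FreeModule.
Variables (S : pzRingType) (J : choiceType).

Definition fsum (V : lmodType S) (f : J -> V) (s : seq (S * J)) : V :=
  \sum_(p <- s) p.1 *: f p.2.

(* Two formal sums of pairs (a, j) are equal when no map J -> V separates them. *)
Definition fm_eq (s t : seq (S * J)) : bool :=
  `[< forall (V : lmodType S) (f : J -> V), fsum f s = fsum f t >].
Lemma fm_eq_refl : reflexive fm_eq. Proof. by move=> s; apply/asboolP. Qed.
Lemma fm_eq_sym : symmetric fm_eq.
Proof. by move=> s t; apply/asboolP/asboolP => h V f; rewrite h. Qed.
Lemma fm_eq_trans : transitive fm_eq.
Proof. by move=> t s u /asboolP h /asboolP h'; apply/asboolP => V f; rewrite h h'. Qed.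
Canonical fm_equiv := EquivRel fm_eq fm_eq_refl fm_eq_sym fm_eq_trans.

Definition FM : Type := {eq_quot fm_equiv}.
HB.instance Definition _ := Choice.on FM.

Definition fm_cl (s : seq (S * J)) : FM := \pi_({eq_quot fm_equiv}) s.
Definition fm_rep (x : FM) : seq (S * J) := repr (x : {eq_quot fm_equiv}).
Definition fm_lift (V : lmodType S) (f : J -> V) (x : FM) : V := fsum f (fm_rep x).

Lemma fm_repK x : fm_cl (fm_rep x) = x. Proof. exact: reprK. Qed.
Lemma fm_liftE (V : lmodType S) (f : J -> V) s : fm_lift f (fm_cl s) = fsum f s.
Proof.
suff /asboolP h : fm_eq (fm_rep (fm_cl s)) s by exact: h.
by apply/eqmodP; exact: reprK.
Qed.
Lemma fm_ext x y : (forall (V : lmodType S) (f : J -> V), fm_lift f x = fm_lift f y) -> x = y.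
Proof.
move=> h; rewrite -(fm_repK x) -(fm_repK y); apply/eqmodP; apply/asboolP.
by move=> V f; apply: h.
Qed.

Definition fm_zero := fm_cl [::].
Definition fm_add x y := fm_cl (fm_rep x ++ fm_rep y).
Definition fm_scale (a : S) x := fm_cl [seq (a * p.1, p.2) | p <- fm_rep x].
Definition fm_opp x := fm_scale (-1) x.

Lemma fm_lift0 (V : lmodType S) (f : J -> V) : fm_lift f fm_zero = 0.
Proof. by rewrite fm_liftE /fsum big_nil. Qed.
Lemma fm_liftD (V : lmodType S) (f : J -> V) x y :
  fm_lift f (fm_add x y) = fm_lift f x + fm_lift f y.
Proof. by rewrite fm_liftE /fsum big_cat. Qed.
Lemma fm_liftZ (V : lmodType S) (f : J -> V) a x :
  fm_lift f (fm_scale a x) = a *: fm_lift f x.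
Proof.
rewrite fm_liftE /fsum big_map scaler_sumr.
by apply: eq_bigr => p _; rewrite scalerA.
Qed.
Let E := (fm_lift0, fm_liftD, fm_liftZ).

Lemma fm_addA : associative fm_add.
Proof. by move=> x y z; apply: fm_ext => V f; rewrite !E addrA. Qed.
Lemma fm_addC : commutative fm_add.
Proof. by move=> x y; apply: fm_ext => V f; rewrite !E addrC. Qed.
Lemma fm_add0 : left_id fm_zero fm_add.
Proof. by move=> x; apply: fm_ext => V f; rewrite !E add0r. Qed.
Lemma fm_addN : left_inverse fm_zero fm_opp fm_add.
Proof. by move=> x; apply: fm_ext => V f; rewrite !E scaleN1r addNr. Qed.
HB.instance Definition _ := GRing.isZmodule.Build FM fm_addA fm_addC fm_add0 fm_addN.

Lemma fm_scaleA a b x : fm_scale a (fm_scale b x) = fm_scale (a * b) x.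
Proof. by apply: fm_ext => V f; rewrite !E scalerA. Qed.
Lemma fm_scale1 : left_id 1 fm_scale.
Proof. by move=> x; apply: fm_ext => V f; rewrite !E scale1r. Qed.
Lemma fm_scaleDr : right_distributive fm_scale +%R.
Proof. by move=> a x y; apply: fm_ext => V f; rewrite !E scalerDr. Qed.
Lemma fm_scaleDl x : {morph fm_scale^~ x : a b / a + b}.
Proof. by move=> a b; apply: fm_ext => V f; rewrite !E scalerDl. Qed.
HB.instance Definition _ :=
  GRing.Zmodule_isLmodule.Build S FM fm_scaleA fm_scale1 fm_scaleDr fm_scaleDl.

Definition fm_gen (j : J) : FM := fm_cl [:: (1, j)].

Lemma fm_lift_gen (V : lmodType S) (f : J -> V) j : fm_lift f (fm_gen j) = f j.
Proof. by rewrite fm_liftE /fsum big_seq1 scale1r. Qed.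
Lemma fm_lift_linear (V : lmodType S) (f : J -> V) : GRing.linear_for *:%R (fm_lift f).
Proof. by move=> a x y; rewrite fm_liftD fm_liftZ. Qed.
Definition fm_lin (V : lmodType S) (f : J -> V) : {linear FM -> V} :=
  mklin (fm_lift_linear f).
Lemma fm_clE s : fm_cl s = \sum_(p <- s) p.1 *: fm_gen p.2.
Proof.
apply: fm_ext => V f; rewrite fm_liftE -[fm_lift f]/(fm_lin f : FM -> V) linear_sum.
by apply: eq_bigr => p _; rewrite linearZ /= fm_lift_gen.
Qed.
Lemma fm_sum (x : FM) : x = \sum_(p <- fm_rep x) p.1 *: fm_gen p.2.
Proof. by rewrite -fm_clE fm_repK. Qed.

Definition fm_co (j : J) : {linear FM -> S^o} := fm_lin (fun i => (i == j)%:R : S^o).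

Lemma fm_co_gen j i : fm_co j (fm_gen i) = (i == j)%:R.
Proof. exact: fm_lift_gen. Qed.
Lemma fm_co_fin x j : j \notin [seq p.2 | p <- fm_rep x] -> fm_co j x = 0.
Proof.
move=> h; rewrite {1}(fm_sum x) linear_sum big_seq big1 // => p hp.
rewrite linearZ fm_co_gen; case: eqP => [e|_]; last by rewrite /= scaler0.
by case/negP: h; apply/mapP; exists p.
Qed.
Lemma fm_co_sum x (s : seq J) : uniq s -> (forall j, j \notin s -> fm_co j x = 0) ->
  x = \sum_(j <- s) (fm_co j x : S) *: fm_gen j.
Proof.
move=> us hs.
have aux : forall t : seq J, uniq t -> {subset [seq p.2 | p <- fm_rep x] <= t} ->
    x = \sum_(j <- t) (fm_co j x : S) *: fm_gen j.
  move=> t ut ht; rewrite [LHS]fm_sum.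
  have e : forall p, p \in fm_rep x -> p.1 *: fm_gen p.2 =
      \sum_(j <- t) (p.1 *: fm_co j (fm_gen p.2) : S) *: fm_gen j.
    move=> p hp; have pt : p.2 \in t by apply: ht; apply: map_f.
    rewrite (bigD1_seq _ pt ut) fm_co_gen eqxx big1 ?addr0 => [|j /negPf jp].
      by rewrite [RHS]addr0; congr (_ *: _); exact/esym/mulr1.
    by rewrite fm_co_gen eq_sym jp /= scaler0 scale0r.
  rewrite (eq_big_seq _ e) exchange_big /=; apply: eq_bigr => j _.
  rewrite -scaler_suml; congr (_ *: _).
  transitivity (fm_co j (\sum_(p <- fm_rep x) p.1 *: fm_gen p.2)); last by rewrite -fm_sum.
  rewrite linear_sum; by apply: eq_bigr => p _; rewrite linearZ.
pose t := undup (s ++ [seq p.2 | p <- fm_rep x]).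
rewrite [LHS](aux t (undup_uniq _)) => [|j hj]; last by rewrite mem_undup mem_cat hj orbT.
rewrite (bigID (mem s)) /= [X in _ + X]big1 ?addr0; last first.
  move=> j /hs h; transitivity ((0 : S) *: fm_gen j); last exact: scale0r.
  by congr (_ *: _).
rewrite -big_filter; apply: perm_big; apply: uniq_perm => //.
  by rewrite filter_uniq // undup_uniq.
by move=> j; rewrite mem_filter mem_undup mem_cat /=; case: (j \in s).
Qed.

Lemma FM_projective : projective (FM : lmodType S).
Proof.
move=> X Y g f hg.
have /choice [x hx] : forall j, exists x, g x = f (fm_gen j) by move=> j; apply: hg.
have [h hh] : exists h : {linear FM -> X}, forall j, h (fm_gen j) = x j.
  by exists (fm_lin x) => j; exact: fm_lift_gen.
exists h => p; rewrite (fm_sum p); elim: (fm_rep p) => [|q s IH].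
  by rewrite big_nil !linear0.
by rewrite big_cons !linearD IH !linearZ /= hh hx.
Qed.
End FreeModule.

Section Kernel.
Variables (R : pzRingType) (X Y : lmodType R) (g : {linear X -> Y}).

Definition ker_pred : {pred X} := fun x => g x == 0.
Record kmod := Kmod { kval :> X; kvalP : kval \in ker_pred }.
Lemma ker_submod_closed : submod_closed ker_pred.
Proof.
split=> [|a x y]; rewrite !unfold_in ?linear0 //.
by move=> /eqP hx /eqP hy; rewrite linearP hx hy scaler0 addr0.
Qed.
HB.instance Definition _ := GRing.isSubmodClosed.Build R X ker_pred ker_submod_closed.
HB.instance Definition _ := [isSub for kval].
HB.instance Definition _ := [Choice of kmod by <:].
HB.instance Definition _ := [SubChoice_isSubLmodule of kmod by <:].

Lemma kval_linear : GRing.linear_for *:%R kval.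
Proof. by []. Qed.
Definition kincl : {linear kmod -> X} := mklin kval_linear.
Lemma kvalE (x : kmod) : g (kval x) = 0. Proof. exact/eqP/(kvalP x). Qed.
Lemma ker_mem x : g x = 0 -> exists y : kmod, kval y = x.
Proof. by move=> /eqP h; exists (Kmod h). Qed.
End Kernel.

Section FreeRes.
Variables (S : pzRingType) (M : lmodType S).

Definition fcov (N : lmodType S) : {linear FM S N -> N} := fm_lin (fun x : N => x).
Lemma fcov_surj N x : exists y, fcov N y = x.
Proof. by exists (fm_gen _ x); exact: fm_lift_gen. Qed.

(** Each syzygy is covered by the free module on its own underlying set, so no generators have to be
    chosen. *)
Fixpoint syz (n : nat) : lmodType S :=
  if n is n'.+1 then kmod (fcov (syz n')) else M.

Definition fr_obj (n : nat) : lmodType S := FM S (syz n).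
Lemma fr_d_linear n : GRing.linear_for *:%R
  (fun x : fr_obj n.+1 => kval (fcov (syz n.+1) x) : fr_obj n).
Proof. by move=> a x y; rewrite linearP. Qed.
Definition fr_d n : {linear fr_obj n.+1 -> fr_obj n} := mklin (@fr_d_linear n).

Lemma fr_exact n (x : fr_obj n) : fcov (syz n) x = 0 <-> exists y, fr_d n y = x.
Proof.
split=> [/ker_mem [y <-]|[y <-]]; last exact: kvalE.
by have [z hz] := @fcov_surj (syz n.+1) y; exists z; rewrite /= -hz.
Qed.
Lemma fr_exactS n (x : fr_obj n.+1) : fr_d n x = 0 <-> exists y, fr_d n.+1 y = x.
Proof.
rewrite -fr_exact; split=> [h|h]; first exact: val_inj.
by rewrite /= [fm_lift _ x]h.
Qed.
Definition free_res : proj_resolution M :=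
  @ProjResolution S M fr_obj fr_d (fcov M) (fun n => @FM_projective S (syz n))
    (@fcov_surj M) (@fr_exact 0) fr_exactS.
End FreeRes.

Lemma res_aug_d (S : pzRingType) (M : lmodType S) (P : proj_resolution M) (y : P 1%N) :
  res_aug P (res_diff P 0 y) = 0.
Proof. by have [_ h] := res_exact0 (res_diff P 0 y); apply: h; exists y. Qed.
Lemma res_d_d (S : pzRingType) (M : lmodType S) (P : proj_resolution M) n (y : P n.+2) :
  res_diff P n (res_diff P n.+1 y) = 0.
Proof. by have [_ h] := res_exact (res_diff P n.+1 y); apply: h; exists y. Qed.

(** * Comparison with Tor over the enveloping algebra *)

Section BimodModule.
Variables (k : fieldType) (R : falgType k).
Local Notation Re := (envelop R).

Section OfModule.
Variable M : lmodType Re^c.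

Definition ofM : Type := M.
HB.instance Definition _ := GRing.Zmodule.on ofM.

Definition ofM_scale (c : k) (x : ofM) : ofM := (epure (c%:A : R) 1 : Re^c) *: (x : M).

Let eD (a a' b : R) : epure (a + a') b = epure a b + epure a' b.
Proof. exact: epureDl. Qed.
Lemma ofM_scaleA a b x : ofM_scale a (ofM_scale b x) = ofM_scale (a * b) x.
Proof.
rewrite /ofM_scale scalerA; congr (_ *: _).
by rewrite [LHS]env_mulE mulr1 -scalerAl mul1r scalerA mulrC.
Qed.
Lemma ofM_scale1 : left_id 1 ofM_scale.
Proof. by move=> x; rewrite /ofM_scale scale1r; exact: scale1r. Qed.
Lemma ofM_scaleDr : right_distributive ofM_scale +%R.
Proof. by move=> a x y; exact: scalerDr. Qed.
Lemma ofM_scaleDl x : {morph ofM_scale^~ x : a b / a + b}.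
Proof. by move=> a b; rewrite /ofM_scale scalerDl eD; exact: scalerDl. Qed.
HB.instance Definition _ :=
  GRing.Zmodule_isLmodule.Build k ofM ofM_scaleA ofM_scale1 ofM_scaleDr ofM_scaleDl.

(** On right modules a (x) b acts by x -> b x a, so the second factor carries the left action. *)
Definition of_bl (r : R) (x : ofM) : ofM := (epure 1 r : Re^c) *: (x : M).
Definition of_br (r : R) (x : ofM) : ofM := (epure r 1 : Re^c) *: (x : M).

Let mulE (a b c d : R) : (epure a b : Re^c) * (epure c d : Re^c) = (epure (c * a) (b * d) : Re^c).
Proof. by rewrite [LHS]env_mulE. Qed.
Let actA (t u : Re^c) (x : M) : t *: (u *: x) = (t * u) *: x.
Proof. exact: scalerA. Qed.
Let E (a : k) : Re^c := epure (a%:A : R) 1.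

Lemma of_bl_lin r : klin (of_bl r).
Proof.
move=> a x y; rewrite /of_bl [LHS]scalerDr; congr (_ + _).
apply: (etrans (actA _ (E a) x)); apply: (etrans _ (esym (actA (E a) _ x))).
by congr (_ *: _); rewrite !mulE mulr1 mul1r mulr1 mul1r.
Qed.
Lemma of_br_lin r : klin (of_br r).
Proof.
move=> a x y; rewrite /of_br [LHS]scalerDr; congr (_ + _).
apply: (etrans (actA _ (E a) x)); apply: (etrans _ (esym (actA (E a) _ x))).
by congr (_ *: _); rewrite !mulE !mulr1 -scalerAl mul1r -scalerAr mulr1.
Qed.
Lemma of_bl_linr x : klin (of_bl^~ x).
Proof.
move=> a r s; rewrite /of_bl epureDr [LHS]scalerDl; congr (_ + _).
apply: (etrans _ (esym (actA (E a) _ x))).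
by congr (_ *: _); rewrite mulE mul1r mul1r epureZ.
Qed.
Lemma of_br_linr x : klin (of_br^~ x).
Proof.
move=> a r s; rewrite /of_br epureDl [LHS]scalerDl; congr (_ + _).
apply: (etrans _ (esym (actA (E a) _ x))).
by congr (_ *: _); rewrite mulE -scalerAr !mulr1.
Qed.
Lemma of_blM r s x : of_bl (r * s) x = of_bl r (of_bl s x).
Proof. by rewrite /of_bl [RHS]scalerA mulE mulr1. Qed.
Lemma of_brM r s x : of_br (r * s) x = of_br s (of_br r x).
Proof. by rewrite /of_br [RHS]scalerA mulE mulr1. Qed.
Lemma of_blr r s x : of_bl r (of_br s x) = of_br s (of_bl r x).
Proof. by rewrite /of_br /of_bl [RHS]scalerA [LHS]scalerA !mulE mulr1 mul1r mulr1 mul1r. Qed.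

Definition ofE : bimod R := Bimod of_bl_lin of_br_lin of_bl_linr of_br_linr
  of_blM of_brM of_blr.

Lemma ofE_unital : sbm (fun _ : ofE => True).
Proof. by split=> // x _; exact: (@scale1r _ M x). Qed.
End OfModule.

Lemma ofE_hom (M M' : lmodType Re^c) (g : {linear M -> M'}) : bhom (g : ofE M -> ofE M').
Proof.
split=> [a x y|r x|r x]; last 2 first.
- exact: linearZ.
- exact: linearZ.
by rewrite [LHS]linearD [X in X + _]linearZ.
Qed.

Section ToModule.
Variable Y : bimod R.
Hypothesis Yu : sbm (fun _ : Y => True).

(** The unitality proof is part of the type, so that the module structure declared on it can refer
    to that proof. *)
Definition toM of (sbm (fun _ : Y => True)) : Type := Y.
Local Notation T := (toM Yu).
HB.instance Definition _ := GRing.Zmodule.on T.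

Definition to_act (t : Re^c) (y : T) : T := env_lift (fun a b => bl b (br a (y : Y)) : Y) t.

Lemma to_act_bal (y : T) : balanced (fun (c : k) (x : R) => c *: x) (fun (c : k) (x : R) => c *: x)
  (fun a b => bl b (br a (y : Y)) : Y).
Proof.
split=> [a a' b|a b b'|c a b].
- by rewrite (klinD (br_linr _)) (klinD (bl_lin _)).
- by rewrite (klinD (bl_linr _)).
- by rewrite (klinZ (br_linr _)) (klinZ (bl_lin _)) (klinZ (bl_linr _)).
Qed.
Lemma to_actE a b y : to_act (epure a b) y = bl b (br a (y : Y)).
Proof. exact: (env_liftE _ _ (to_act_bal y)). Qed.
Lemma to_actDl y : {morph to_act^~ y : t u / t + u}.
Proof. exact: (env_liftD (to_act_bal y)). Qed.
Lemma to_actDr : right_distributive to_act +%R.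
Proof.
move=> t x y; rewrite /to_act /env_lift /tens_lift /formal_sum -big_split /=.
by apply: eq_bigr => p _; rewrite (klinD (br_lin _)) (klinD (bl_lin _)).
Qed.
Lemma to_actA t u y : to_act t (to_act u y) = to_act (t * u) y.
Proof.
elim/env_ind: t => [t t' h h'|a b]; first by rewrite mulrDl !to_actDl h h'.
elim/env_ind: u => [u u' h h'|c d]; first by rewrite mulrDr !to_actDl to_actDr h h'.
have -> : (epure a b : Re^c) * (epure c d : Re^c) = epure (c * a) (b * d).
  by rewrite [LHS]env_mulE.
by rewrite !to_actE blM brM; congr (bl b _); exact/esym/blr.
Qed.
Lemma to_act1 : left_id 1 to_act.
Proof.
move=> y; rewrite [LHS](to_actE 1 1) (sbm1r Yu) // (sbm1l Yu) //.
Qed.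
HB.instance Definition _ := GRing.Zmodule_isLmodule.Build Re^c T
  to_actA to_act1 to_actDr to_actDl.
Definition toE : lmodType Re^c := T.
End ToModule.

Lemma to_linear (P : lmodType Re^c) (Y : bimod R) (Yu : sbm (fun _ : Y => True))
    (h : {linear P -> toE Yu}) : bhom (h : ofE P -> Y).
Proof.
have e a b x : h ((epure a b : Re^c) *: x) = bl b (br a (h x : Y)).
  by rewrite linearZ; exact: to_actE.
split=> [c x y|r x|r x].
- rewrite [LHS]linearD; congr (_ + _); rewrite e.
  by rewrite (sbm1l Yu) // (klinZ (br_linr _)) (sbm1r Yu).
- by rewrite [LHS]e (sbm1r Yu).
- by rewrite [LHS]e (sbm1l Yu).
Qed.

Lemma hom_linear (Y : bimod R) (Yu : sbm (fun _ : Y => True)) (P : lmodType Re^c) (h : Y -> ofE P) :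
  bhom h -> GRing.linear_for *:%R (h : toE Yu -> P).
Proof.
move=> hh t x y; rewrite [LHS](klinD (bh_lin hh)); congr (_ + _).
elim/env_ind: t => [t t' IH IH'|a b].
  by rewrite [RHS]scalerDl -IH -IH' -(klinD (bh_lin hh)); congr h; exact: to_actDl.
rewrite [X in h X]to_actE (bh_l hh) (bh_r hh) [LHS]scalerA; congr (_ *: _).
by rewrite [LHS]env_mulE !mulr1.
Qed.

(** Projectivity splits the surjection [eps] from R (x) P to P; the coordinates of the section are
    the required maps. *)
Lemma proj_lfree (P : lmodType Re^c) : projective P ->
  exists s, lfree (fun _ : ofE P => True) s.
Proof.
move=> hP; have u := ofE_unital P.
have tu : sbm (fun _ : tb (ofE P) => True).
  have [_ _ _ _ _ h1 h2] := sbm_ten u.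
  by split=> // F _; [apply: h1|apply: h2].
have el : GRing.linear_for *:%R (fun F : toE tu => eps (F : tb (ofE P)) : P).
  exact: hom_linear (eps_homl (ofE P)).
have [|h hh] := hP (toE tu) P (mklin el) (mklin (fun a (x y : P) => erefl (a *: x + y))).
  move=> y; exists (pur 1 (y : ofE P)); rewrite [LHS]eps_pur; exact: scale1r.
have hb := to_linear h.
exists (fun i x => (h x : tb (ofE P)) i); split=> //.
- by move=> i a x y; rewrite (bh_lin hb) !ffunE.
- by move=> i r x; rewrite (bh_r hb) ffunE.
- by move=> j r x; rewrite (bh_l hb) [bl _ _]/= /ten_bl opmE.
- by move=> x _; exact: (hh x).
Qed.
Lemma proj_HV (P : lmodType Re^c) n : projective P -> HV n (fun _ : ofE P => True).
Proof. by move=> /proj_lfree [s hs]; apply: lfree_HV hs; apply: ofE_unital. Qed.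

Local Notation RR := (regular_right R).
Local Notation RL := (regular_left R).

Lemma HH_resol (M : lmodType Re^c) (P : proj_resolution M) :
  exists J, @resol _ _
    (fun n => if n is m.+1 then ofE (P m) else ofE M) (fun n _ => True) J
    (fun n => match n return
        (ofE (P n) -> (if n is m.+1 then ofE (P m) else ofE M : bimod R)) with
      | 0 => res_aug P | m.+1 => res_diff P m end).
Proof.
pose J n : (if n is m.+1 then ofE (P m) else ofE M : bimod R) -> Prop :=
  match n with
  | 0 => fun _ => True
  | 1 => fun x : P 0%N => res_aug P x = 0
  | m.+2 => fun x : P m.+1 => res_diff P m x = 0
  end.
exists J; split.
- case=> [|[|n]]; split=> //=.
  + exact: ofE_unital.
  + exact: ofE_unital.
  + exact: ofE_hom.
  + by move=> z _; have [y <-] := res_aug_surj P z; exists y.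
  + exact: ofE_unital.
  + have hs : @ses _ _ (ofE (P 0%N)) (fun _ => True) (ofE M) (fun _ => True) (res_aug P).
      split=> //; try exact: ofE_unital; first exact: ofE_hom.
      by move=> z _; have [y <-] := res_aug_surj P z; exists y.
    have := sbm_ker hs; congr sbm; apply/funext => x; apply/propext.
    by split=> [[]|].
  + exact: ofE_hom.
  + by move=> y _; exact: res_aug_d.
  + by move=> z hz; have [h _] := res_exact0 z; have [y hy] := h hz; exists y.
  + exact: ofE_unital.
  + have hs : @ses _ _ (ofE (P n.+1)) (fun _ => True) (ofE (P n)) (fun z => exists y, res_diff P n y = z) (res_diff P n).
      split=> //.
      * exact: ofE_unital.
      * have hl := bh_lin (ofE_hom (res_diff P n)); have hb := ofE_hom (res_diff P n).
        split.
        -- by exists 0; exact: linear0.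
        -- by move=> _ _ [x <-] [y <-]; exists (x + y); exact: linearD.
        -- by move=> a _ [x <-]; exists (a *: (x : ofE (P n.+1))); exact: (klinZ hl).
        -- by move=> r _ [x <-]; exists (bl r (x : ofE (P n.+1))); exact: (bh_l hb).
        -- by move=> r _ [x <-]; exists (br r (x : ofE (P n.+1))); exact: (bh_r hb).
        -- by move=> x _; exact: (sbm1l (ofE_unital _)).
        -- by move=> x _; exact: (sbm1r (ofE_unital _)).
      * exact: ofE_hom.
      * by move=> y _; exists y.
      * by move=> z [y <-]; exists y.
    have := sbm_ker hs; congr sbm; apply/funext => x; apply/propext.
    by split=> [[]|].
  + exact: ofE_hom.
  + by move=> y _; exact: res_d_d.
  + by move=> z hz; have [h _] := res_exact z; have [y hy] := h hz; exists y.
- by case=> [|n] x; split=> [[]|].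
- by move=> n m; apply: proj_HV; apply: res_proj.
Qed.

(** R is generated by 1 over its enveloping algebra. Together with [pure_comm] this identifies X
    (x)_{Re} R with the coinvariants of X. *)
Lemma pure_one (X : lmodType Re^c) (t : tens X RL) : exists x : X, t = pure _ _ x (1 : R).
Proof.
have [s ->] := tens_sumP t.
exists (\sum_(p <- s) of_br (p.2 : R) (p.1 : ofM X)).
have pb := pure_balanced (fun (a : Re) (x : X) => (a : Re^c) *: x) (fun (a : Re) (y : RL) => a *: y).
elim: s => [|p s IH]; first by rewrite !big_nil [RHS](bal0l _ pb).
rewrite !big_cons IH [RHS](balDl pb); congr (_ + _).
rewrite [RHS](balZ pb); congr pure.
by rewrite [RHS](env_actlE p.2 1 (1 : R)) !mulr1.
Qed.

Lemma pure_oneB (X : lmodType Re^c) (x y : X) :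
  pure _ _ (x - y) (1 : R) = pure _ _ x (1 : R) - pure _ _ y (1 : R) :> tens X RL.
Proof.
have pb := pure_balanced (fun (a : Re) (x : X) => (a : Re^c) *: x) (fun (a : Re) (y : RL) => a *: y).
by rewrite (balDl pb) (balNl _ _ pb).
Qed.

(** For the direct implication the test map is x (x) a -> x a, which is balanced modulo commutators
    because d x c a and x c a d differ by one. *)
Lemma pure_comm (X : lmodType Re^c) (x : ofE X) :
  (pure _ _ (x : X) (1 : R) : tens X RL) = 0 <-> comm (fun _ : ofE X => True) x.
Proof.
have pb := pure_balanced (fun (a : Re) (x : X) => (a : Re^c) *: x) (fun (a : Re) (y : RL) => a *: y).
have u := ofE_unital X.
split=> [h|].
  have := @tens_zeroP Re X RL X (comm (fun _ : ofE X => True)) (fun x (a : R) => of_br a (x : ofM X)) [:: (x, 1 : R)].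
  rewrite !big_seq1 /= [of_br _ _](sbm1r u) //; apply=> //.
  - exact: comm0.
  - by move=> y z; apply: commB.
  - by move=> y y' a; exact: (klinD (of_br_lin (M := X) a) y y').
  - by move=> y a a'; exact: (klinD (of_br_linr (M := X) y) a a').
  - move=> t y a; elim/env_ind: t => [t t' ht ht'|c d].
      have -> : of_br a (((t + t') : Re^c) *: y) = of_br a ((t : Re^c) *: y) + of_br a ((t' : Re^c) *: y).
        by rewrite scalerDl; exact: (klinD (of_br_lin (M := X) a)).
      have -> : of_br ((t + t') *: (a : RL)) y = of_br (t *: (a : RL)) y + of_br (t' *: (a : RL)) y.
        by rewrite scalerDl; exact: (klinD (of_br_linr (M := X) y)).
      rewrite opprD addrACA; exact: commD.
    have -> : (epure c d : Re^c) *: y = bl d (br c (y : ofE X)).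
      rewrite [RHS]scalerA; congr (_ *: _).
      by rewrite [RHS]env_mulE !mulr1.
    have -> : epure c d *: (a : RL) = c * a * d by exact: env_actlE.
    rewrite -[of_br a _]/(br a (bl d (br c (y : ofE X)))) -[of_br _ y]/(br (c * a * d) (y : ofE X)).
    by rewrite -blr -brM (brM (c * a) d); apply: comm1.
elim=> [|r y z _ _ IH]; first exact: (bal0l _ pb).
rewrite (balDl pb) IH addr0 (balDl pb) (balNl _ _ pb).
rewrite [X in X - _](balZ pb) [X in _ - X](balZ pb).
by rewrite [epure _ _ *: _](env_actlE 1 r 1) [epure r _ *: _](env_actlE r 1 1) !mulr1 mul1r subrr.
Qed.

Lemma pure_map (X X' : lmodType Re^c) (g : {linear X -> X'}) (x : X) :
  tens_map g (pure _ _ x (1 : R) : tens X RL) = pure _ _ (g x) (1 : R).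
Proof.
have pb := pure_balanced (fun (a : Re) (x : X') => (a : Re^c) *: x) (fun (a : Re) (y : RL) => a *: y).
rewrite [LHS]tens_liftE //; split=> [a a' y|a y y'|s a y].
- by rewrite linearD (balDl pb).
- by rewrite (balDr pb).
- by rewrite linearZ (balZ pb).
Qed.

(** Homology of P (x) R in degree n + 1 vanishes exactly when the coinvariants of the image of
    [res_diff P n] inject into those of [P n], which is the criterion of [dim_shift]. As the
    right-hand side does not mention P, the choice of resolution does not matter. *)
Lemma HH_acyclicP (M : lmodType Re^c) (P : proj_resolution M) n :
  tens_acyclic_at P RL n.+1 <-> HV n (fun _ : ofE M => True).
Proof.
have [J hJ] := HH_resol P; have hdim := dim_shift n hJ.
have hJ0 : J 0 = (fun _ => True).
  apply/funext => x; apply/propext; split=> // _.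
  have [y <-] := res_aug_surj P x; exact: (ses_in (rs_ses hJ 0)).
rewrite hJ0 in hdim; rewrite hdim.
pose g := (match n return
        (ofE (P n) -> (if n is m.+1 then ofE (P m) else ofE M : bimod R)) with
      | 0 => res_aug P | m.+1 => res_diff P m end).
have kerE (x : P n) : kerD (fun _ => True) g x <-> exists y, res_diff P n y = x.
  rewrite /kerD /g; case: (n) x => [|m] x; split.
  - by case=> _ h; exact: (proj1 (res_exact0 x) h).
  - by move=> h; split=> //; exact: (proj2 (res_exact0 x) h).
  - by case=> _ h; exact: (proj1 (res_exact x) h).
  - by move=> h; split=> //; exact: (proj2 (res_exact x) h).
have hd := ofE_hom (res_diff P n).
split=> [hac x /kerE [y hy] cx|ti z].
  have [|w hw] := hac (pure _ _ y (1 : R)).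
    by rewrite /= pure_map hy; apply/pure_comm.
  have [w' ew] := pure_one w.
  rewrite {}ew pure_map in hw.
  have : comm (fun _ : ofE (P n.+1) => True) ((y : ofE _) - res_diff P n.+1 w').
    by apply/pure_comm; apply: (etrans (pure_oneB _ _)); rewrite hw subrr.
  have hx : x = res_diff P n ((y : ofE _) - res_diff P n.+1 w').
    rewrite linearB hy; by rewrite res_d_d subr0.
  by rewrite hx; apply: comm_img hd _ => t _; apply/kerE; exists t.
have [x ->] := pure_one z; rewrite /= pure_map => /pure_comm cx.
have hcm : comm (kerD (fun _ => True) g) (res_diff P n x : ofE (P n)).
  by apply: ti => //; apply/kerE; exists x.
have hsur z' : kerD (fun _ => True) g z' -> exists2 y : ofE (P n.+1), True & res_diff P n y = z'.
  by move=> /kerE [s <-]; exists s; first exact: I.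
have [c hc ec] := comm_lift hd hsur hcm.
have [w hw] : exists w, res_diff P n.+1 w = x - c.
  apply: (proj1 (res_exact _)); rewrite linearB; apply/eqP; rewrite subr_eq0 ec; exact: eqxx.
exists (pure _ _ w (1 : R)); rewrite pure_map hw.
have ec0 : pure _ _ (c : P n.+1) (1 : R) = 0 :> tens (P n.+1) RL by apply/pure_comm.
by apply: (etrans (pure_oneB _ _)); rewrite ec0 subr0.
Qed.

Lemma HH_HV n : HH_zero R n.+1 <-> HV n (fun _ : ofE RR => True).
Proof.
split=> [[P /HH_acyclicP //]|h].
by exists (free_res (RR : lmodType Re^c)); apply: (proj2 (HH_acyclicP _ n)).
Qed.
End BimodModule.

Section Regular.
Variables (k : fieldType) (R : falgType k).

Definition regb : bimod R :=
  @Bimod k R R (fun r x => r * x) (fun r x => x * r) (@mul_linr k R) (@mul_linl k R)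
    (@mul_linl k R) (@mul_linr k R) (fun r s y => esym (mulrA r s y))
    (fun r s y => mulrA y r s) (fun r s y => mulrA r y s).

Lemma regb_unital : sbm (fun _ : regb => True).
Proof. by split=> // x _; [exact: mul1r|exact: mulr1]. Qed.

Lemma regular_right_hom :
  bhom (fun x : ofE (regular_right R : lmodType (envelop R)^c) => (x : regb)).
Proof.
split=> [c x y|r x|r x].
- rewrite -[LHS]/(env_actr (epure (c%:A : R) 1) (x : R) + y) env_actrE mul1r.
  by rewrite -scalerAr mulr1.
- by rewrite [LHS](env_actrE 1 r) mulr1.
- by rewrite [LHS](env_actrE r 1) mul1r.
Qed.

Lemma regular_right_HV n :
  HV n (fun _ : ofE (regular_right R : lmodType (envelop R)^c) => True) <->
  HV n (fun _ : regb => True).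
Proof.
have h := regular_right_hom.
split; apply: HV_iso.
- split=> //; [exact: ofE_unital|exact: regb_unital|exact: h|by move=> z _; exists z].
- by [].
- split=> //; [exact: regb_unital|exact: ofE_unital| |by move=> z _; exists z].
  split=> [c x y|r x|r x]; [exact/esym/(bh_lin h)|exact/esym/(bh_l h)|exact/esym/(bh_r h)].
- by [].
Qed.

Lemma HH_regb n : HH_zero R n.+1 <-> HV n (fun _ : regb => True).
Proof. by rewrite HH_HV regular_right_HV. Qed.
End Regular.

(** * Functoriality of Hochschild homology in the algebra *)

Section Semilinear.
Variables (k : fieldType) (R S : falgType k) (t : R -> S).
Hypotheses (tl : klin t) (tM : forall x y, t (x * y) = t x * t y).

(** [t] will be the inclusion of a corner, which sends 1 to an idempotent: it is linear and
    multiplicative but does not preserve units. *)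
Record shom (X : bimod R) (Y : bimod S) (g : X -> Y) : Prop := Shom {
  sh_lin : klin g;
  sh_l : forall r x, g (bl r x) = bl (t r) (g x);
  sh_r : forall r x, g (br r x) = br (t r) (g x)
}.

Definition smap (X : bimod R) (Y : bimod S) (g : X -> Y) (F : tb X) : tb Y :=
  opm t (vmap g F).

Section One.
Variables (X : bimod R) (Y : bimod S) (g : X -> Y) (D : X -> Prop) (D' : Y -> Prop).
Hypothesis gh : shom g.
Let gl := sh_lin gh.

Lemma smap_pur r x : smap g (pur r x) = pur (t r) (g x).
Proof. by rewrite /smap vmap_pur // opm_pur. Qed.
Lemma smap_lin : klin (smap g).
Proof. exact: klin_comp (opm_lin t) (vmap_lin gl). Qed.
Lemma smap_shom : shom (smap g).
Proof.
split; first exact: smap_lin.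
- move=> r; apply: VT_ext => [||s x].
  + exact: klin_comp smap_lin (@bl_lin _ _ (tb X) r).
  + exact: klin_comp (@bl_lin _ _ (tb Y) (t r)) smap_lin.
  + by rewrite bl_pur !smap_pur bl_pur tM.
- move=> r; apply: VT_ext => [||s x].
  + exact: klin_comp smap_lin (@br_lin _ _ (tb X) r).
  + exact: klin_comp (@br_lin _ _ (tb Y) (t r)) smap_lin.
  + by rewrite br_pur !smap_pur br_pur (sh_r gh).
Qed.
Lemma smap_eps F : eps (smap g F) = g (eps F).
Proof.
move: F; apply: VT_ext => [||r x].
- exact: klin_comp (@eps_lin _ _ _) smap_lin.
- exact: klin_comp gl (@eps_lin _ _ _).
- by rewrite smap_pur !eps_pur (sh_l gh).
Qed.
Lemma smap_rho F : rho (smap g F) = g (rho F).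
Proof.
move: F; apply: VT_ext => [||r x].
- exact: klin_comp (@rho_lin _ _ _) smap_lin.
- exact: klin_comp gl (@rho_lin _ _ _).
- by rewrite smap_pur !rho_pur (sh_r gh).
Qed.
Hypotheses (hD' : sbm D') (gD : forall x, D x -> D' (g x)).
Lemma smap_KD F : KD D F -> KD D' (smap g F).
Proof.
move=> [h e]; split; last by rewrite smap_eps e (klin0 gl).
move=> j; rewrite /smap opmE; apply: sbm_sum => // i.
by apply: sbmZ => //; rewrite ffunE; apply: gD.
Qed.
Lemma shom_comm x : comm D x -> comm D' (g x).
Proof.
elim=> [|r y z hy _ IH]; first by rewrite (klin0 gl); exact: comm0.
rewrite (klinD gl) (klinB gl) (sh_l gh) (sh_r gh).
by apply: commS => //; apply: gD.
Qed.
End One.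

Fixpoint smapn n (X : bimod R) (Y : bimod S) (g : X -> Y) : VTn n X -> VTn n Y :=
  if n is n'.+1 then smap (@smapn n' X Y g) else g.

Lemma smapn_shom n (X : bimod R) (Y : bimod S) (g : X -> Y) :
  shom g -> shom (@smapn n _ _ g).
Proof. by move=> h; elim: n => //= n IH; apply: smap_shom. Qed.
Lemma smapn_KD n (X : bimod R) (Y : bimod S) (g : X -> Y) D D' F :
  shom g -> sbm D' -> (forall x, D x -> D' (g x)) ->
  @KDn _ _ n X D F -> @KDn _ _ n Y D' (@smapn n _ _ g F).
Proof.
move=> h hD' gD; elim: n F => [|n IH] F; first exact: gD.
apply: smap_KD => //; first exact: smapn_shom.
exact: sbm_KDn.
Qed.
End Semilinear.

Section Retract.
Variables (k : fieldType) (R S : falgType k) (t : R -> S) (p : S -> R).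
Hypotheses (tl : klin t) (tM : forall x y, t (x * y) = t x * t y).
Hypotheses (pl : klin p) (pM : forall x y, p (x * y) = p x * p y) (ptK : forall x, p (t x) = x).

Let up n := @smapn k R S t n (regb R) (regb S) t.
Let dn n := @smapn k S R p n (regb S) (regb R) p.
Let ht : shom t (t : regb R -> regb S). Proof. split=> // r x; exact: tM. Qed.
Let hp : shom p (p : regb S -> regb R). Proof. split=> // r x; exact: pM. Qed.
Let hup n : shom t (@up n). Proof. exact: (smapn_shom tl tM n ht). Qed.
Let hdn n : shom p (@dn n). Proof. exact: (smapn_shom pl pM n hp). Qed.

Let smapnK n (F : VTn n (regb R)) : @dn n (@up n F) = F.
Proof.
elim: n F => [|n IH] /=; first exact: ptK.
apply: VT_ext => [||r x].
- exact: klin_comp (sh_lin (hdn n.+1)) (sh_lin (hup n.+1)).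
- exact: klin_id.
- have e : @up n.+1 (pur r x) = pur (t r) (@up n x) by exact: smap_pur.
  by rewrite e [LHS](smap_pur pl (hdn n)) ptK IH.
Qed.

(** By functoriality HH(R) is a direct factor of HH(S): a cycle is carried to S, written there as a
    sum of commutators, and brought back by [p]. *)
Lemma HV_retract n : HV n (fun _ : regb S => True) -> HV n (fun _ : regb R => True).
Proof.
move=> hv F hF rF; rewrite -[F](@smapnK n.+1).
have c : comm (@KDn _ _ n.+1 (regb S) (fun _ => True)) (@up n.+1 F).
  apply: hv; first exact: (smapn_KD tl tM ht (regb_unital S) (n := n.+1) _ hF).
  by rewrite [LHS](smap_rho tl (hup n)) rF (klin0 (sh_lin (hup n))).
apply: (shom_comm (hdn n.+1) _ c) => x.
exact: (smapn_KD pl pM hp (regb_unital R) (n := n.+1)).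
Qed.
End Retract.

Section Kmaps.
Variables (k : fieldType) (R : falgType k).

(** [KD] is defined through [eps], which sees the left action only, so left linear maps already act
    on syzygies. *)
Record lhom (Y Z : bimod R) (g : Y -> Z) : Prop := Lhom {
  lh_lin : klin g;
  lh_l : forall r y, g (bl r y) = bl r (g y)
}.
Lemma bhom_lhom (Y Z : bimod R) (g : Y -> Z) : bhom g -> lhom g.
Proof. by case. Qed.
Lemma lhom_K (Y Z : bimod R) (g : Y -> Z) : lhom g -> lhom (vmap g : tb Y -> tb Z).
Proof.
move=> [gl gb]; split=> [|r F]; first exact: vmap_lin.
by rewrite [LHS]/= /ten_bl -opm_vmap //; exact: mul_linr.
Qed.
Lemma lhom_KD (Y Z : bimod R) (g : Y -> Z) (D : Y -> Prop) (D' : Z -> Prop) (F : tb Y) :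
  lhom g -> (forall y, D y -> D' (g y)) -> KD D F -> KD D' (vmap g F : tb Z).
Proof.
move=> [gl gb] h [hF eF]; split; first by move=> i; rewrite ffunE; apply: h.
suff -> : eps (vmap g F : tb Z) = g (eps F) by rewrite eF klin0.
move: F {hF eF}; apply: VT_ext => [||r y].
- exact: klin_comp (@eps_lin _ _ _) (vmap_lin gl).
- exact: klin_comp gl (@eps_lin _ _ _).
- by rewrite vmap_pur // !eps_pur gb.
Qed.

Variables (Y Z : bimod R).
Implicit Types g h : Y -> Z.

Lemma Kmap_lin n g : klin g -> klin (@Kmap _ _ n Y Z g).
Proof. by move=> gl; elim: n => //= n IH; apply: vmap_lin. Qed.
Lemma Kmap_lhom n g : lhom g -> lhom (@Kmap _ _ n Y Z g).
Proof. by move=> gl; elim: n => //= n IH; apply: lhom_K. Qed.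
Lemma Kmap_bhom n g : bhom g -> bhom (@Kmap _ _ n Y Z g).
Proof. by move=> gl; elim: n => //= n IH; apply: bhom_K. Qed.
Lemma Kmap_KDn n g D D' F : lhom g -> (forall y, D y -> D' (g y)) ->
  @KDn _ _ n Y D F -> @KDn _ _ n Z D' (@Kmap _ _ n Y Z g F).
Proof.
move=> gl gD; elim: n F => [|n IH] F /=; first exact: gD.
by apply: lhom_KD; [exact: Kmap_lhom|exact: IH].
Qed.
Lemma Kmap_linf n a g h F : @Kmap _ _ n Y Z (fun y => a *: g y + h y) F =
  a *: @Kmap _ _ n Y Z g F + @Kmap _ _ n Y Z h F.
Proof.
elim: n F => [|n IH] F //=; rewrite -vmap_linf; apply: vmap_ext; exact: IH.
Qed.
Lemma Kmap0 n (F : VTn n Y) : @Kmap _ _ n Y Z (fun=> 0) F = 0.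
Proof.
elim: n F => [|n IH] F //=; apply/ffunP => i; rewrite !ffunE; exact: IH.
Qed.
Lemma Kmap_eqD n g h D F : (forall y, D y -> g y = h y) ->
  @KDn _ _ n Y D F -> @Kmap _ _ n Y Z g F = @Kmap _ _ n Y Z h F.
Proof.
move=> e; elim: n F => [|n IH] F /=; first exact: e.
by case=> hF _; apply/ffunP => i; rewrite !ffunE; apply: IH.
Qed.
Lemma Kmap_eq n g h F : g =1 h -> @Kmap _ _ n Y Z g F = @Kmap _ _ n Y Z h F.
Proof.
move=> e; elim: n F => [|n IH] F /=; first exact: e.
by apply/ffunP => i; rewrite !ffunE.
Qed.
End Kmaps.
Arguments Kmap_lin {k R Y Z} n {g}.
Arguments Kmap_lhom {k R Y Z} n {g}.
Arguments Kmap_bhom {k R Y Z} n {g}.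
Arguments Kmap_KDn {k R Y Z} n {g D D' F}.

Section Kmaps2.
Variables (k : fieldType) (R : falgType k).

Lemma Kmap_comp n (X Y Z : bimod R) (g : Y -> Z) (h : X -> Y) F :
  @Kmap _ _ n Y Z g (@Kmap _ _ n X Y h F) = @Kmap _ _ n X Z (fun x => g (h x)) F.
Proof.
elim: n F => [|n IH] F //=; rewrite vmap_comp; apply: vmap_ext; exact: IH.
Qed.
Lemma Kmap_id n (Y : bimod R) F : @Kmap _ _ n Y Y (fun y => y) F = F.
Proof.
by elim: n F => [|n IH] F //=; apply/ffunP => i; rewrite ffunE.
Qed.
Lemma Kmap_sum n (Y Z : bimod R) (I : finType) (g : I -> Y -> Z) F :
  @Kmap _ _ n Y Z (fun y => \sum_i g i y) F = \sum_i @Kmap _ _ n Y Z (g i) F.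
Proof.
have aux (s : seq I) : @Kmap _ _ n Y Z (fun y => \sum_(i <- s) g i y) F =
    \sum_(i <- s) @Kmap _ _ n Y Z (g i) F.
  elim: s => [|i s IH].
    by rewrite big_nil -[RHS](@Kmap0 _ _ Y Z n F); apply: Kmap_eq => y; rewrite big_nil.
  rewrite big_cons -IH -[X in X + _]scale1r -Kmap_linf; apply: Kmap_eq => y.
  by rewrite big_cons scale1r.
exact: aux.
Qed.
Lemma Kmap_scale n (Y Z : bimod R) a (g : Y -> Z) F :
  @Kmap _ _ n Y Z (fun y => a *: g y) F = a *: @Kmap _ _ n Y Z g F.
Proof.
rewrite -[RHS]addr0 -(@Kmap0 _ _ Y Z n F) -Kmap_linf; apply: Kmap_eq => y.
by rewrite addr0.
Qed.
End Kmaps2.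

(** * Change of coefficients along an algebra map *)

Section Infl.
Variables (k : fieldType) (L B : falgType k) (ps : L -> B).
Hypotheses (psl : klin ps) (psM : forall x y, ps (x * y) = ps x * ps y) (ps1 : ps 1 = 1).

Section Obj.
Variable Y : bimod B.
Lemma infl_bl_linr (y : Y) : klin (fun r => bl (ps r) y).
Proof. exact: klin_comp (bl_linr y) psl. Qed.
Lemma infl_br_linr (y : Y) : klin (fun r => br (ps r) y).
Proof. exact: klin_comp (br_linr y) psl. Qed.
Lemma infl_blM r s (y : Y) : bl (ps (r * s)) y = bl (ps r) (bl (ps s) y).
Proof. by rewrite psM blM. Qed.
Lemma infl_brM r s (y : Y) : br (ps (r * s)) y = br (ps s) (br (ps r) y).
Proof. by rewrite psM brM. Qed.
Definition infl : bimod L :=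
  @Bimod k L Y (fun r y => bl (ps r) y) (fun r y => br (ps r) y)
    (fun r => bl_lin (ps r)) (fun r => br_lin (ps r)) infl_bl_linr infl_br_linr
    infl_blM infl_brM (fun r s y => blr (ps r) (ps s) y).
Lemma infl_sbm (D : Y -> Prop) : sbm D -> sbm (D : infl -> Prop).
Proof.
case=> h0 hA hZ hl hr h1 h2; split=> //.
- by move=> r x; apply: hl.
- by move=> r x; apply: hr.
- by move=> x hx; rewrite /= ps1 h1.
- by move=> x hx; rewrite /= ps1 h2.
Qed.
Hypothesis sur : forall b, exists r, ps r = b.
(** By surjectivity L and B produce the same commutators, so inflation does not change
    coinvariants. *)
Lemma infl_comm (D : Y -> Prop) y : comm (D : infl -> Prop) y <-> comm D y.
Proof.
split; elim=> [|r x z hx _ IH]; try exact: comm0; first exact: commS.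
by have [s <-] := sur r; apply: (@commS _ _ infl).
Qed.
End Obj.

Lemma infl_ses (Y Z : bimod B) (D : Y -> Prop) (D' : Z -> Prop) (g : Y -> Z) :
  ses D D' g -> ses (D : infl Y -> Prop) (D' : infl Z -> Prop) g.
Proof.
case=> h h' [gl gb gr] hi hs; split=> //; try exact: infl_sbm.
by split=> // r y; [exact: gb|exact: gr].
Qed.
End Infl.

(* [pw ps Y] is the bimodule Y (x) B : L acts on Y on the left and through ps on B on the right. *)
Section Pw.
Variables (k : fieldType) (L B : falgType k) (ps : L -> B).
Hypotheses (psl : klin ps) (psM : forall x y, ps (x * y) = ps x * ps y) (ps1 : ps 1 = 1).

Section Obj.
Variable Y : bimod L.
Definition pw_bl (r : L) (F : VT B Y) : VT B Y := vmap (bl r) F.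
Definition pw_br (r : L) (F : VT B Y) : VT B Y := opm (fun b => b * ps r) F.
Lemma pw_bl_lin r : klin (pw_bl r). Proof. exact: vmap_lin (bl_lin r). Qed.
Lemma pw_br_lin r : klin (pw_br r). Proof. exact: opm_lin. Qed.
Lemma pw_bl_linr F : klin (pw_bl^~ F).
Proof.
move=> a r s; rewrite /pw_bl -vmap_linf; apply: vmap_ext => y; exact: bl_linr.
Qed.
Lemma pw_br_linr F : klin (pw_br^~ F).
Proof.
move=> a r s; rewrite /pw_br -opm_linf; apply: opm_ext => b.
by rewrite psl mulrDr scalerAr.
Qed.
Lemma pw_blM r s F : pw_bl (r * s) F = pw_bl r (pw_bl s F).
Proof. by rewrite /pw_bl vmap_comp; apply: vmap_ext => y; rewrite blM. Qed.
Lemma pw_brM r s F : pw_br (r * s) F = pw_br s (pw_br r F).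
Proof.
rewrite /pw_br opm_comp; [|exact: mul_linl|exact: mul_linl].
by apply: opm_ext => b; rewrite psM mulrA.
Qed.
Lemma pw_blr r s F : pw_bl r (pw_br s F) = pw_br s (pw_bl r F).
Proof. by rewrite /pw_br opm_vmap //; [exact: mul_linl|exact: bl_lin]. Qed.
Definition pw : bimod L := Bimod pw_bl_lin pw_br_lin pw_bl_linr pw_br_linr pw_blM pw_brM pw_blr.

(** The coinvariants of this bimodule are B (x)_L D, and its Hochschild homology over L is Tor^L(B,
    D). *)
Definition pwD (D : Y -> Prop) (F : pw) : Prop := forall i, D (F i).

Lemma pw_sbm (D : Y -> Prop) : sbm D -> sbm (pwD D).
Proof.
move=> hD; have [h0 hA hZ hl hr h1 h2] := hD.
split=> [i|x y hx hy i|a x hx i|r x hx i|r x hx i|x hx|x hx]; rewrite ?ffunE //.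
- exact: hA.
- exact: hZ.
- exact: hl.
- by rewrite [br _ _]/= /pw_br opmE; apply: sbm_sum => // j; apply: hZ.
- by apply/ffunP => i; rewrite ffunE h1.
- by rewrite [br _ _]/= /pw_br -[RHS]opm_id; apply: opm_ext => b; rewrite ps1 mulr1.
Qed.

Lemma pw_lfree (D : Y -> Prop) s : lfree D s -> lfree (pwD D) (fun i => vmap (s i) : pw -> pw).
Proof.
case=> sl sD sr sb se; split=> [i|i F hF j|i r F|j r F|F hF].
- exact: vmap_lin.
- by rewrite ffunE; apply: sD.
- by rewrite [LHS]/= /pw_br -[LHS]opm_vmap //; exact: mul_linl.
- apply/ffunP => l; rewrite !ffunE sb sum_ffunE; apply: eq_bigr => i _.
  by rewrite !ffunE.
- apply/ffunP => l; rewrite sum_ffunE -[RHS]se //; apply: eq_bigr => i _.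
  by rewrite !ffunE.
Qed.
End Obj.

Lemma pw_ses (Y Z : bimod L) (D : Y -> Prop) (D' : Z -> Prop) (g : Y -> Z) :
  ses D D' g -> ses (@pwD Y D) (@pwD Z D') (vmap g : pw Y -> pw Z).
Proof.
move=> hs; have [hD hD' [gl gb gr] hi hsur] := hs; split.
- exact: pw_sbm.
- exact: pw_sbm.
- split=> [|r F|r F]; first exact: vmap_lin.
    by apply/ffunP => i; rewrite !ffunE gb.
  by rewrite [LHS]/= /pw_br -[LHS]opm_vmap //; exact: mul_linl.
- by move=> F hF i; rewrite ffunE; apply: hi.
- move=> F hF; have /choice [G hG] : forall i, exists y, D y /\ g y = F i.
    by move=> i; have [y hy ey] := hsur _ (hF i); exists y.
  exists [ffun i => G i] => [i|]; first by rewrite ffunE; have [] := hG i.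
  by apply/ffunP => i; rewrite !ffunE; have [] := hG i.
Qed.

Lemma pw_ker (Y Z : bimod L) (D : Y -> Prop) (g : Y -> Z) F :
  kerD (@pwD Y D) (vmap g : pw Y -> pw Z) F <-> @pwD Y (kerD D g) F.
Proof.
split=> [[h /ffunP h'] i|h].
  by split; [exact: h|have := h' i; rewrite !ffunE].
split; first by move=> i; have [] := h i.
by apply/ffunP => i; rewrite !ffunE; have [] := h i.
Qed.

(** The subgroup L e D, built up term by term like [comm]. *)
Inductive gene (e : L) (Y : bimod L) (D : Y -> Prop) : Y -> Prop :=
| gene0 : gene e D 0
| geneS r y x : D y -> gene e D x -> gene e D (bl (r * e) y + x).

Lemma gene_img e (Y Z : bimod L) (D : Y -> Prop) (D' : Z -> Prop) (g : Y -> Z) y :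
  bhom g -> (forall y, D y -> D' (g y)) -> gene e D y -> gene e D' (g y).
Proof.
move=> [gl gb gr] h; elim=> [|r x z hx _ IH]; first by rewrite klin0 //; exact: gene0.
by rewrite klinD // gb; apply: geneS => //; apply: h.
Qed.

(* Since ps kills e, the elements u (x) r e y = r e (u (x) y) are commutators. *)
Lemma pw_gene_comm e (Y : bimod L) (D : Y -> Prop) F : ps e = 0 -> sbm D ->
  (forall y, D y -> gene e D y) -> pwD D F -> comm (@pwD Y D) F.
Proof.
move=> pe hD hg hF; rewrite [F]VT_sum; apply: comm_sum => i.
elim: (hg _ (hF i)) => [|r y x hy _ IH]; first by rewrite (klin0 (pur_linr _)); exact: comm0.
rewrite (klinD (pur_linr _)); apply: commD => //.
have hp : pwD D (pur (bs i) y : pw Y) by move=> j; rewrite purE; apply: sbmZ.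
have -> : pur (bs i) (bl (r * e) y) = bl (r * e) (pur (bs i) y : pw Y) - br (r * e) (pur (bs i) y : pw Y).
  have -> : bl (r * e) (pur (bs i) y : pw Y) = pur (bs i) (bl (r * e) y).
    exact: (vmap_pur _ _ (bl_lin _)).
  have -> : br (r * e) (pur (bs i) y : pw Y) = pur (bs i * ps (r * e)) y.
    exact: (opm_pur _ _ (@mul_linl _ B _)).
  by rewrite psM pe !mulr0 (klin0 (pur_linl _)) subr0.
exact: comm1.
Qed.
End Pw.

Section FreeBimodule.
Variables (k : fieldType) (L B : falgType k) (ps : L -> B).
Hypotheses (psl : klin ps) (psM : forall x y, ps (x * y) = ps x * ps y) (ps1 : ps 1 = 1).
Hypothesis sur : forall b, exists r, ps r = b.
Local Notation Be := ((envelop B)^c).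
Local Notation BB := (pw psl psM (infl psl psM (regb B))).

(* The free bimodule on J is a direct sum of copies of B (x) B. *)
Lemma free_dsum (J : choiceType) : exists p q,
  @dsum k L J (infl psl psM (ofE (FM Be J : lmodType Be))) (fun _ => True) BB (fun _ => True) p q.
Proof.
pose F : lmodType Be := FM Be J.
have pb := pure_balanced (fun (c : k) (x : B) => c *: x) (fun (c : k) (x : B) => c *: x).
have tbal : balanced (fun (c : k) (x : B) => c *: x) (fun (c : k) (x : B) => c *: x)
    (fun a b => pur a b : VT B B).
  split=> [a a' b|a b b'|c a b].
  - by rewrite (klinD (pur_linl _)).
  - by rewrite (klinD (pur_linr _)).
  - exact: purZ.
pose t : envelop B -> VT B B := env_lift (fun a b => pur a b : VT B B).
have tE a b : t (epure a b) = pur a b by exact: env_liftE.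
have tD x y : t (x + y) = t x + t y by exact: env_liftD.
have tZ c x : t ((epure (c%:A : B) 1 : Be) * (x : Be)) = c *: t x.
  elim/env_ind: x => [x y hx hy|a b].
    by rewrite mulrDr tD scalerDr -hx -hy; exact: tD.
  rewrite [X in t X]env_mulE tE tE mul1r -scalerAr mulr1.
  by rewrite (klinZ (pur_linl _)).
have tl r x : t ((epure 1 (ps r) : Be) * (x : Be)) = vmap (fun y => ps r * y) (t x).
  elim/env_ind: x => [x y hx hy|a b].
    by rewrite mulrDr tD (klinD (vmap_lin (@mul_linr _ B (ps r)))) -hx -hy; exact: tD.
  by rewrite [X in t X]env_mulE !tE mulr1 vmap_pur //; exact: mul_linr.
have tr r x : t ((epure (ps r) 1 : Be) * (x : Be)) = opm (fun y => y * ps r) (t x).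
  elim/env_ind: x => [x y hx hy|a b].
    by rewrite mulrDr tD (klinD (opm_lin _)) -hx -hy; exact: tD.
  by rewrite [X in t X]env_mulE !tE mul1r opm_pur //; exact: mul_linl.
pose p (j : J) (x : infl psl psM (ofE F)) : BB := t (fm_co Be j x).
pose u (j : J) (a b : B) : ofE F := (epure a b : Be) *: (fm_gen Be j : F).
pose q (j : J) (G : BB) : infl psl psM (ofE F) := vlift (u j) G.
have cg (s s' : Be) j : s = s' -> s *: (fm_gen Be j : F) = s' *: (fm_gen Be j : F) by move->.
have cA (s s' : Be) j : s *: (s' *: (fm_gen Be j : F)) = (s * s') *: (fm_gen Be j : F).
  exact: scalerA.
have uE c a b j : c *: u j a b = u j (c *: a) b.
  transitivity (((epure (c%:A : B) 1 : Be) * (epure a b : Be)) *: (fm_gen Be j : F)).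
    exact: (cA (epure (c%:A : B) 1)).
  by apply: cg; rewrite [LHS]env_mulE -scalerAr mulr1 mul1r.
have ul a j : klin (u j a : B -> ofE F).
  move=> c b b'; rewrite {1}/u epureDr scalerDl; congr (_ + _).
  by rewrite uE /u epureZ.
have ul' b j : klin ((u j)^~ b : B -> ofE F).
  by move=> c a a'; rewrite {1}/u epureDl scalerDl uE.
have qpur j a b : q j (pur a b) = u j a b by exact: vlift_pur.
have qlin j : klin (q j : BB -> ofE F) by apply: vlift_lin.
have qt j x : q j (t x) = (x : Be) *: (fm_gen Be j : F).
  elim/env_ind: x => [x y hx hy|a b].
    by rewrite tD (klinD (qlin j)) hx hy [RHS]scalerDl.
  by rewrite tE qpur.
have t0 : t 0 = 0 by apply: (addIr (t 0)); rewrite -tD !add0r.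
have coZ j (r : Be) (x : F) : fm_co Be j (r *: x) = r * (fm_co Be j x : Be).
  by rewrite linearZ.
exists p, q; split=> //.
- move=> j; split=> [c x y|r x|r x].
  + rewrite /p [fm_co Be j _]linearD tD; congr (_ + _); rewrite -tZ; congr t; exact: (coZ j (epure (c%:A : B) 1)).
  + by rewrite /p -[RHS]tl; congr t; exact: (coZ j (epure 1 (ps r))).
  + by rewrite /p -[RHS]tr; congr t; exact: (coZ j (epure (ps r) 1)).
- move=> j; split; first exact: qlin.
  + move=> r; apply: VT_ext => [||a b].
    * exact: klin_comp (qlin j) (@bl_lin _ _ BB r).
    * exact: klin_comp (@bl_lin _ _ (infl psl psM (ofE F)) r) (qlin j).
    rewrite qpur [X in q j X](_ : _ = pur a (ps r * b)); last first.
      exact: (vmap_pur a b (@mul_linr _ B (ps r))).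
    rewrite qpur; apply: (etrans _ (esym (cA (epure 1 (ps r)) _ j))); apply: cg.
    by rewrite [RHS]env_mulE mulr1.
  + move=> r; apply: VT_ext => [||a b].
    * exact: klin_comp (qlin j) (@br_lin _ _ BB r).
    * exact: klin_comp (@br_lin _ _ (infl psl psM (ofE F)) r) (qlin j).
    rewrite qpur [X in q j X](_ : _ = pur (a * ps r) b); last first.
      exact: (opm_pur a b (@mul_linl _ B (ps r))).
    rewrite qpur; apply: (etrans _ (esym (cA (epure (ps r) 1) _ j))); apply: cg.
    by rewrite [RHS]env_mulE mul1r.
- move=> y _; exists [seq p.2 | p <- fm_rep y] => j hj.
  by rewrite /p fm_co_fin.
move=> y s _ us hs.
(* The coordinates themselves have to vanish, not only their images under [t]; [vlift v] is a left
   inverse of [t]. *)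
have tinj x : t x = 0 -> x = 0.
  move=> tx; pose v (a b : B) : ofE (Be^o : lmodType Be) := (epure a b : Be).
  have vl : forall a, klin (v a).
    move=> a c b b'; rewrite /v epureDr; congr (_ + _).
    transitivity (epure (a * (c%:A : B)) (1 * b)); last exact/esym/env_mulE.
    by rewrite -scalerAr mulr1 mul1r epureZ.
  have vl' : forall b, klin (v^~ b).
    move=> b c a a'; rewrite /v epureDl; congr (_ + _).
    transitivity (epure (a * (c%:A : B)) (1 * b)); last exact/esym/env_mulE.
    by rewrite -scalerAr mulr1 mul1r.
  have h z : vlift v (t z) = z.
    elim/env_ind: z => [z w hz hw|a b]; last by rewrite tE vlift_pur.
    by rewrite tD (klinD (vlift_lin vl)) hz hw.
  by rewrite -(h x) tx (klin0 (vlift_lin vl)).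
apply: (etrans (fm_co_sum (S := Be) (x := (y : FM Be J)) us _)) => [j /hs hj|]; first exact: tinj.
by apply: eq_bigr => j _; rewrite /p qt.
Qed.

Lemma infl_resol (Y : nat -> bimod B) D J g : @resol k B Y D J g ->
  (forall n m, HV m (D n.+1 : infl psl psM (Y n.+1) -> Prop)) ->
  @resol k L (fun n => infl psl psM (Y n)) D J g.
Proof.
by case=> hs hk _ hv; split=> // n; apply: infl_ses.
Qed.

(** [hBB] says that Tor^L(B, B) vanishes in positive degrees. Then free B-bimodules, being sums of
    copies of B (x) B, stay acyclic over L, so a free resolution over B computes both homologies;
    the coinvariants agree by [infl_comm]. *)
Lemma infl_HV (hBB : forall m, HV m (fun _ : BB => True)) n :
  HV n (fun _ : regb B => True) -> HV n (fun _ : infl psl psM (regb B) => True).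
Proof.
pose M : lmodType Be := regular_right B.
move=> /regular_right_HV h.
have [J hJ] := HH_resol (free_res M).
have hJ0 : J 0 = (fun _ => True).
  apply/funext => x; apply/propext; split=> // _.
  have [y <-] := res_aug_surj (free_res M) x; exact: (ses_in (rs_ses hJ 0)).
have /(dim_shift n hJ) ti : HV n (J 0) by rewrite hJ0.
have hJ' := infl_resol hJ.
have : HV n (fun _ : infl psl psM (ofE M) => True).
  rewrite -hJ0; apply: (proj2 (dim_shift n (hJ' _))) => [m i|].
    have [p [q hd]] := free_dsum (syz M m); exact: dsum_HV hd (hBB i).
  by move=> x hx /(@infl_comm _ _ _ _ psl psM _ sur) cx; apply/(@infl_comm _ _ _ _ psl psM _ sur); apply: ti.
have hs : @ses _ B (ofE M) (fun _ => True) (regb B) (fun _ => True) (fun x => x).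
  by split=> //; [exact: ofE_unital|exact: regb_unital|exact: regular_right_hom|move=> z _; exists z].
by apply: (HV_iso (infl_ses psl psM ps1 hs)).
Qed.
End FreeBimodule.

(** * Hochschild homology along an idempotent ideal *)

Section Setup.
Variables (k : fieldType) (L A B : falgType k) (e : L).
Variables (jA : A -> L) (pA : L -> A) (ps : L -> B) (jB : B -> L).
Hypotheses (ee : e * e = e).
Hypotheses (jAl : klin jA) (jAM : forall x y, jA (x * y) = jA x * jA y) (jA1 : jA 1 = e).
Hypotheses (pAl : klin pA) (jpA : forall x, jA (pA x) = e * x * e) (pjA : forall a, pA (jA a) = a).
Hypotheses (psl : klin ps) (psM : forall x y, ps (x * y) = ps x * ps y) (ps1 : ps 1 = 1).
Hypotheses (jBl : klin jB) (jBM : forall x y, jB (x * y) = jB x * jB y) (psj : forall b, ps (jB b) = b).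
Hypothesis ps_ker : forall x, ps x = 0 <-> (1 - e) * x * (1 - e) = 0.

Let pe : ps e = 0.
Proof. by apply/ps_ker; rewrite mulrBl mul1r ee subrr mul0r. Qed.
(** With f = 1 - e, the equation f x f = 0 reads x - e x = (x - e x) e. Hence the kernel of [ps] is
    eL + fLe, which is LeL. *)
Let ps_dec x : ps x = 0 -> x = e * x + (x - e * x) * e.
Proof.
move=> /ps_ker; rewrite mulrBr mulr1 mulrBl mul1r => /eqP.
by rewrite subr_eq0 => /eqP <-; rewrite addrC subrK.
Qed.
Let ejA a : e * jA a = jA a. Proof. by rewrite -jA1 -jAM mul1r. Qed.
Let jAe a : jA a * e = jA a. Proof. by rewrite -jA1 -jAM mulr1. Qed.
Let jinj a b : jA a = jA b -> a = b. Proof. by move=> h; rewrite -(pjA a) h pjA. Qed.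
Let pAl_ a x : pA (jA a * x) = a * pA x.
Proof. by apply: jinj; rewrite jAM !jpA !mulrA ejA jAe. Qed.
Let pAr_ a x : pA (x * jA a) = pA x * a.
Proof. by apply: jinj; rewrite jAM !jpA -!mulrA ejA jAe. Qed.

(* The A-bimodule eL (x) Le, inside L (x) L. *)
Definition E_bl (a : A) (F : VT L L) : VT L L := opm (fun x => jA a * x) F.
Definition E_br (a : A) (F : VT L L) : VT L L := vmap (fun x => x * jA a) F.
Lemma E_bl_lin a : klin (E_bl a). Proof. exact: opm_lin. Qed.
Lemma E_br_lin a : klin (E_br a). Proof. exact: vmap_lin (@mul_linl _ L _). Qed.
Lemma E_bl_linr F : klin (E_bl^~ F).
Proof.
move=> c a b; rewrite /E_bl -opm_linf; apply: opm_ext => x.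
by rewrite jAl mulrDl scalerAl.
Qed.
Lemma E_br_linr F : klin (E_br^~ F).
Proof.
move=> c a b; rewrite /E_br -vmap_linf; apply: vmap_ext => x.
by rewrite jAl mulrDr scalerAr.
Qed.
Lemma E_blM a b F : E_bl (a * b) F = E_bl a (E_bl b F).
Proof.
rewrite /E_bl opm_comp; [|exact: mul_linr|exact: mul_linr].
by apply: opm_ext => x; rewrite jAM mulrA.
Qed.
Lemma E_brM a b F : E_br (a * b) F = E_br b (E_br a F).
Proof. by rewrite /E_br vmap_comp; apply: vmap_ext => x; rewrite jAM mulrA. Qed.
Lemma E_blr a b F : E_bl a (E_br b F) = E_br b (E_bl a F).
Proof. by rewrite /E_bl /E_br opm_vmap //; [exact: mul_linr|exact: mul_linl]. Qed.
Definition EA : bimod A :=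
  Bimod E_bl_lin E_br_lin E_bl_linr E_br_linr E_blM E_brM E_blr.

Definition DE (F : EA) : Prop := opm (fun x => e * x) F = F /\ vmap (fun x => x * e) F = F.

Lemma sbm_DE : sbm DE.
Proof.
have hl := @opm_lin k L L L (fun x => e * x).
have hr := @vmap_lin k L L L _ (@mul_linl k L e).
split=> [|x y [hx hx'] [hy hy']|a x [hx hx']|a x [hx hx']|a x [hx hx']|x [hx hx']|x [hx hx']].
- by split; [exact: klin0 hl|exact: klin0 hr].
- by split; [rewrite (klinD hl) hx hy|rewrite (klinD hr) hx' hy'].
- by split; [rewrite (klinZ hl) hx|rewrite (klinZ hr) hx'].
- split.
  + rewrite [bl _ _]/= /E_bl opm_comp; [|exact: mul_linr|exact: mul_linr].
    by apply: opm_ext => y; rewrite mulrA ejA.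
  + rewrite -[RHS](_ : bl a (vmap (fun x => x * e) x : EA) = _); last by rewrite hx'.
    by rewrite [RHS]opm_vmap //; [exact: mul_linr|exact: mul_linl].
- split.
  + rewrite -[RHS](_ : br a (opm (fun x => e * x) x : EA) = _); last by rewrite hx.
    by rewrite [LHS]opm_vmap //; [exact: mul_linr|exact: mul_linl].
  + rewrite [br _ _]/= /E_br vmap_comp.
    by apply: vmap_ext => y; rewrite -mulrA jAe.
- by rewrite [LHS]/= /E_bl -[RHS]hx; apply: opm_ext => y; rewrite jA1.
- by rewrite [LHS]/= /E_br -[RHS]hx'; apply: vmap_ext => y; rewrite jA1.
Qed.

(** The first factor lies in eL and the second in Le, so the product is taken in reverse order;
    modulo A-commutators, eL (x) Le becomes Le (x)_A eL. *)
Definition mulE (F : VT L L) : L := vlift (fun v y => y * v) F.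
Lemma mulE_lin : klin mulE. Proof. apply: vlift_lin => v; exact: mul_linl. Qed.
Lemma mulE_pur v y : mulE (pur v y) = y * v.
Proof. by rewrite /mulE vlift_pur //; [exact: mul_linl|exact: mul_linr]. Qed.

(* Injectivity of Le (x)_A eL -> L, and vanishing of Tor^A_i(Le, eL) for i > 0. *)
Hypothesis mulE_inj : forall F, DE F -> mulE F = 0 -> comm DE F.
Hypothesis HV_DE : forall n, HV n DE.

(** The outer actions: L acts on the left of Le, the second factor, and on the right of eL, the
    first. They commute with the inner actions of A. *)
Let gl (r : L) : EA -> EA := vmap (fun x => r * x).
Let gr (r : L) : EA -> EA := opm (fun x => x * r).
Let gl_hom r : bhom (gl r).
Proof.
split=> [|a F|a F]; first exact: vmap_lin (@mul_linr _ L r).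
  by rewrite [RHS]opm_vmap //; exact: mul_linr.
by rewrite /gl [LHS]vmap_comp [RHS]vmap_comp; apply: vmap_ext => x; rewrite mulrA.
Qed.
Let gr_hom r : bhom (gr r).
Proof.
split=> [|a F|a F]; first exact: opm_lin.
  rewrite [LHS]opm_comp; [|exact: mul_linl|exact: mul_linr].
  rewrite [RHS]opm_comp; [|exact: mul_linr|exact: mul_linl].
  by apply: opm_ext => x; rewrite mulrA.
by rewrite [LHS]opm_vmap //; exact: mul_linl.
Qed.
Let gl_DE r F : DE F -> DE (gl r F).
Proof.
move=> [h1 h2]; split.
- by rewrite /gl opm_vmap ?h1 //; exact: mul_linr.
- rewrite -[in RHS]h2 /gl !vmap_comp; apply: vmap_ext => x; exact/esym/mulrA.
Qed.
Let gr_DE r F : DE F -> DE (gr r F).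
Proof.
move=> [h1 h2]; split.
- rewrite -[in RHS]h1 /gr !opm_comp; try exact: mul_linl; try exact: mul_linr.
  by apply: opm_ext => x; rewrite mulrA.
- by rewrite /gr -opm_vmap ?h2 //; exact: mul_linl.
Qed.

Section Outer.
Variable n : nat.
Let bE (r : L) : VTn n EA -> VTn n EA := @Kmap _ _ n EA EA (gl r).
Let rE (r : L) : VTn n EA -> VTn n EA := @Kmap _ _ n EA EA (gr r).
Lemma EL_bl_lin r : klin (bE r). Proof. exact: Kmap_lin (bh_lin (gl_hom r)). Qed.
Lemma EL_br_lin r : klin (rE r). Proof. exact: Kmap_lin (bh_lin (gr_hom r)). Qed.
Lemma EL_bl_linr F : klin (bE^~ F).
Proof.
move=> c r s; rewrite /bE -Kmap_linf; apply: Kmap_eq => G.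
rewrite /gl -vmap_linf; apply: vmap_ext => x; by rewrite mulrDl scalerAl.
Qed.
Lemma EL_br_linr F : klin (rE^~ F).
Proof.
move=> c r s; rewrite /rE -Kmap_linf; apply: Kmap_eq => G.
rewrite /gr -opm_linf; apply: opm_ext => x; by rewrite mulrDr scalerAr.
Qed.
Lemma EL_blM r s F : bE (r * s) F = bE r (bE s F).
Proof.
rewrite /bE Kmap_comp; apply: Kmap_eq => G; rewrite /gl vmap_comp.
by apply: vmap_ext => x; rewrite mulrA.
Qed.
Lemma EL_brM r s F : rE (r * s) F = rE s (rE r F).
Proof.
rewrite /rE Kmap_comp; apply: Kmap_eq => G; rewrite /gr opm_comp; try exact: mul_linl.
by apply: opm_ext => x; rewrite mulrA.
Qed.
Lemma EL_blr r s F : bE r (rE s F) = rE s (bE r F).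
Proof.
rewrite /rE /bE !Kmap_comp; apply: Kmap_eq => G.
by rewrite /gl /gr opm_vmap //; [exact: mul_linl|exact: mul_linr].
Qed.
(* The n-th A-syzygy of eL (x) Le, as an L-bimodule through the outer actions. *)
Definition EL : bimod L :=
  @Bimod k L (VTn n EA) bE rE EL_bl_lin EL_br_lin EL_bl_linr EL_br_linr EL_blM EL_brM EL_blr.

Definition DEn : EL -> Prop := @KDn _ _ n EA DE.

Lemma sbm_DEn : sbm DEn.
Proof.
have [h0 hA hZ _ _ _ _] := sbm_KDn n sbm_DE; split=> //.
- by move=> r x; apply: Kmap_KDn; [exact: bhom_lhom|exact: gl_DE].
- by move=> r x; apply: Kmap_KDn; [exact: bhom_lhom|exact: gr_DE].
- move=> x _; rewrite -[RHS]Kmap_id; apply: Kmap_eq => F.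
  by apply/ffunP => i; rewrite ffunE mul1r.
- move=> x _; rewrite -[RHS]Kmap_id; apply: Kmap_eq => F.
  by rewrite -[RHS]opm_id; apply: opm_ext => i; rewrite mulr1.
Qed.

(** For x in Le, x = sum_l b_l (co_l(x) e), so Le is a direct factor of L as a left module. These
    coordinates are left A-linear only, which suffices to pass to the A-syzygies. *)
Definition EL_co (l : ix L) : EL -> EL :=
  @Kmap _ _ n EA EA (vmap (fun x : L => co l x *: e)).

Let co_lhom l : lhom (vmap (fun x : L => co l x *: e) : EA -> EA).
Proof.
have h : klin (fun x : L => co l x *: e).
  by move=> c x y; rewrite (co_lin l) scalerDl scalerA.
split=> [|a F]; first exact: vmap_lin.
by rewrite [RHS]opm_vmap //; exact: mul_linr.
Qed.
Let co_DE l F : DE F -> DE (vmap (fun x : L => co l x *: e) F).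
Proof.
have h : klin (fun x : L => co l x *: e).
  by move=> c x y; rewrite (co_lin l) scalerDl scalerA.
move=> [h1 h2]; split.
- by rewrite opm_vmap ?h1 //; exact: mul_linr.
- by rewrite vmap_comp; apply: vmap_ext => x; rewrite -scalerAl ee.
Qed.

Lemma EL_lfree : lfree DEn EL_co.
Proof.
have h l : klin (fun x : L => co l x *: e).
  by move=> c x y; rewrite (co_lin l) scalerDl scalerA.
split=> [l|l F hF|l r F|j r F|F hF].
- exact: Kmap_lin (lh_lin (co_lhom l)).
- by apply: Kmap_KDn hF; [exact: co_lhom|exact: co_DE].
- rewrite /EL_co [LHS]Kmap_comp [RHS]Kmap_comp; apply: Kmap_eq => G.
  by rewrite /gr opm_vmap //; exact: mul_linl.
- rewrite /EL_co [LHS]Kmap_comp.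
  under eq_bigr do rewrite -Kmap_scale.
  rewrite -Kmap_sum; apply: Kmap_eq => G; rewrite /gl vmap_comp.
  apply/ffunP => i; rewrite ffunE sum_ffunE -[in LHS](co_sum (G i)) mulr_sumr.
  rewrite (klin_sum (co_lin j)) scaler_suml; apply: eq_bigr => l _.
  by rewrite !ffunE -scalerAr (klinZ (co_lin j)) scalerA mulrC.
- rewrite /EL_co; under eq_bigr do rewrite [bl _ _]Kmap_comp.
  rewrite -Kmap_sum -[RHS]Kmap_id; apply: Kmap_eqD hF => G [_ hG].
  rewrite -[RHS]hG; apply/ffunP => i; rewrite ffunE sum_ffunE -[in RHS](co_sum (G i)) mulr_suml.
  by apply: eq_bigr => l _; rewrite !ffunE -scalerAr -scalerAl.
Qed.

(** The second factors of the coordinates are multiples of e, so each b_l in the reconstruction may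
    be replaced by b_l e. *)
Lemma EL_gene F : DEn F -> gene e DEn F.
Proof.
move=> hF; rewrite -(lf_rec EL_lfree hF).
have aux (s : seq (ix L)) : gene e DEn (\sum_(l <- s) bl (bs l) (EL_co l F)).
  elim: s => [|l s IH]; first by rewrite big_nil; exact: gene0.
  rewrite big_cons; have -> : bl (bs l) (EL_co l F) = bl (bs l * e) (EL_co l F).
    rewrite /EL_co [LHS]Kmap_comp [RHS]Kmap_comp; apply: Kmap_eq => G.
    rewrite /gl !vmap_comp; apply: vmap_ext => x.
    by rewrite -!scalerAr -mulrA ee.
  by apply: geneS => //; apply: (lf_D EL_lfree).
exact: aux.
Qed.
End Outer.

Definition J0 (x : regb L) : Prop := ps x = 0.

Lemma ps_ses : ses (fun _ : regb L => True) (fun _ : infl psl psM (regb B) => True) ps.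
Proof.
split=> //; [exact: regb_unital| | |by move=> z _; exists (jB z); rewrite ?psj].
- by apply: infl_sbm => //; exact: regb_unital.
- split=> //= r y; exact: psM.
Qed.

Lemma mulE_ses : ses (@DEn 0) J0 (mulE : EL 0 -> regb L).
Proof.
split; first exact: sbm_DEn.
- have := sbm_ker ps_ses; congr sbm; apply/funext => x; apply/propext.
  by split=> [[]|].
- split; first exact: mulE_lin.
  + move=> r; apply: VT_ext => [||v y].
    * exact: klin_comp mulE_lin (vmap_lin (@mul_linr _ L r)).
    * exact: klin_comp (@mul_linr _ L r) mulE_lin.
    * have -> : bl r (pur v y : EL 0) = pur v (r * y) by exact: (vmap_pur _ _ (@mul_linr _ L r)).
      by rewrite !mulE_pur [RHS]mulrA.
  + move=> r; apply: VT_ext => [||v y].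
    * exact: klin_comp mulE_lin (opm_lin _).
    * exact: klin_comp (@mul_linl _ L r) mulE_lin.
    * have -> : br r (pur v y : EL 0) = pur (v * r) y by exact: (opm_pur _ _ (@mul_linl _ L r)).
      by rewrite !mulE_pur mulrA.
- move=> F [h1 h2]; rewrite /J0 -h2 /mulE /vlift (klin_sum psl) big1 // => i _.
  by rewrite ffunE psM psM pe mulr0 mul0r.
(* By [ps_dec], x = e (e x) + (f x e) e, with the factors written in the reversed order of
   [mulE]. *)
- move=> x hx; exists (pur (e * x) e + pur e ((x - e * x) * e)).
    apply: (sbmD sbm_DE); split.
    + by rewrite opm_pur ?mulrA ?ee //; exact: mul_linr.
    + by rewrite vmap_pur ?ee //; exact: mul_linl.
    + by rewrite opm_pur ?ee //; exact: mul_linr.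
    + by rewrite vmap_pur -?mulrA ?ee //; exact: mul_linl.
  by rewrite (klinD mulE_lin) !mulE_pur [in RHS](ps_dec hx) mulrA ee -mulrA ee.
Qed.

Lemma kerE_comm F : kerD (@DEn 0) (mulE : EL 0 -> regb L) F <-> @comm _ _ EA DE F.
Proof.
split=> [[h1 h2]|h]; first exact: mulE_inj.
split; first exact: comm_in sbm_DE h.
elim: h => [|a y x _ _ IH]; first exact: klin0 mulE_lin.
rewrite (klinD mulE_lin) IH addr0 (klinB mulE_lin).
apply/eqP; rewrite subr_eq0; apply/eqP; move: y; apply: VT_ext => [||v y].
- exact: klin_comp mulE_lin (E_bl_lin a).
- exact: klin_comp mulE_lin (E_br_lin a).
- rewrite [bl a _]opm_pur; last exact: mul_linr.
  rewrite [br a _]vmap_pur; last exact: mul_linl.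
  by rewrite !mulE_pur mulrA.
Qed.

(** The resolution ... -> EL 1 -> EL 0 -> LeL -> 0. On the next A-syzygy [eps] is zero, so [rho]
    agrees up to sign with [eps - rho] and maps it onto the A-commutators of the present one.
    Exactness is then [mulE_inj] at the start and [HV_DE] further on. *)
Definition YE (n : nat) : bimod L := if n is m.+1 then EL m else regb L.
Definition DY (n : nat) : YE n -> Prop :=
  match n with 0 => fun _ => True | m.+1 => @DEn m end.
Definition JY (n : nat) : YE n -> Prop :=
  match n with 0 => J0 | m.+1 => fun F => @comm _ _ (VTn m EA) (@KDn _ _ m EA DE) F end.
Definition gY (n : nat) : YE n.+1 -> YE n :=
  match n with 0 => mulE | m.+1 => @rho _ _ (VTn m EA) end.

Lemma rho_ses n : ses (@DEn n.+1) (@JY n.+1) (@rho _ _ (VTn n EA) : EL n.+1 -> EL n).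
Proof.
have hK := sbm_KDn n sbm_DE.
have hgl r := Kmap_bhom n (gl_hom r); have hgr r := Kmap_bhom n (gr_hom r).
split; first exact: sbm_DEn.
- have [_ _ _ hl hr h1 h2] := sbm_DEn n; split.
  + exact: comm0.
  + by move=> x y; apply: commD.
  + by move=> a x; apply: commZ.
  + by move=> r x; apply: comm_img (hgl r) _ => y hy; apply: hl.
  + by move=> r x; apply: comm_img (hgr r) _ => y hy; apply: hr.
  + by move=> x hx; apply: h1; apply: comm_in hx.
  + by move=> x hx; apply: h2; apply: comm_in hx.
- split; first exact: rho_lin.
  + by move=> r F; exact: bhom_rho (hgl r).
  + by move=> r F; exact: bhom_rho (hgr r).
- move=> F [hF eF]; have := eps_rho_comm hF; rewrite eF sub0r => h.
  by rewrite -[rho F]opprK; apply: commN.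
- move=> z /(comm_witness hK) [G hG ->].
  exists (pur 1 (eps G) - G); last first.
    rewrite (klinB (@rho_lin _ _ _)) rho_pur (sbm1r hK) //; exact: eps_D.
  split; last by rewrite (klinB (@eps_lin _ _ _)) eps_pur (sbm1l hK) ?subrr //; exact: eps_D.
  exact: (sbmB (sbm_ten hK) (pur_D hK 1 (eps_D hK hG)) hG).
Qed.

Lemma resolE : @resol _ _ YE DY JY gY.
Proof.
split.
- by case=> [|n]; [exact: mulE_ses|exact: rho_ses].
- case=> [|n] F; first exact: kerE_comm.
  split=> [[h1 h2]|h]; first exact: HV_DE n _ h1 h2.
  by split; [exact: comm_in (sbm_KDn n.+1 sbm_DE) h|exact: rho_comm h].
- by move=> n m; apply: lfree_HV (EL_lfree n); exact: sbm_DEn.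
Qed.

Lemma JY_gene n F : @JY n F -> gene e (@JY n) F.
Proof.
move=> hF; have [G hG <-] := ses_sur (rs_ses resolE n) hF.
apply: gene_img (ses_h (rs_ses resolE n)) (ses_in (rs_ses resolE n)) _.
exact: EL_gene.
Qed.

Local Notation BB := (pw psl psM (infl psl psM (regb B))).

(** Positive Tor^L(B, LeL), from the resolution tensored with B. All its syzygies are generated by e
    from the left, so B kills them: every element is a commutator and the injectivity in [dim_shift]
    is automatic. *)
Lemma HV_pwJ m : HV m (@pwD _ _ _ _ psl psM _ J0).
Proof.
have hr : @resol _ _ (fun n => pw psl psM (YE n)) (fun n => pwD (@DY n)) (fun n => pwD (@JY n))
    (fun n => vmap (@gY n)).
  split=> [n|n F|n i].
  - by apply: pw_ses => //; exact: rs_ses resolE n.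
  - rewrite pw_ker; split=> h i; first exact: (proj1 (rs_ker resolE n (F i)) (h i)).
    exact: (proj2 (rs_ker resolE n (F i)) (h i)).
  - apply: lfree_HV (pw_lfree psl psM (EL_lfree n)); apply: pw_sbm => //; exact: sbm_DEn.
apply: (proj2 (dim_shift m hr)) => F hF _.
have -> : kerD (@pwD _ _ _ _ psl psM _ (@DY m.+1)) (vmap (@gY m) : pw psl psM (YE m.+1) -> pw psl psM (YE m)) = pwD (@JY m.+1).
  by apply/funext => G; apply/propext; exact: (rs_ker hr m).
apply: (@pw_gene_comm _ _ _ _ psl psM e) => //.
- exact: ses_s' (rs_ses resolE m.+1).
- exact: JY_gene.
- exact: (proj1 (rs_ker hr m F)).
Qed.

Let True_pw (Y : bimod L) : @pwD _ _ _ _ psl psM Y (fun _ => True) = (fun _ => True).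
Proof. by apply/funext => F; apply/propext. Qed.

Lemma pw_regb_HV m : HV m (fun _ : pw psl psM (regb L) => True).
Proof.
pose c (i : ix L) (x : L) := co i x *: (1 : L).
have cl i : klin (c i) by move=> a x y; rewrite /c (co_lin i) scalerDl scalerA.
have h : lfree (fun _ : pw psl psM (regb L) => True) (fun i F => vmap (c i) F).
  split=> // [i|i r F|j r F|F _].
  - exact: vmap_lin.
  - by rewrite [RHS]opm_vmap //; exact: mul_linl.
  - apply/ffunP => l; rewrite !ffunE sum_ffunE -[in LHS](co_sum (F l)) [bl _ _]mulr_sumr.
    rewrite (klin_sum (cl j)); apply: eq_bigr => i _.
    by rewrite !ffunE -scalerAr (klinZ (cl j)) /c !scalerA mulrC.
  - apply/ffunP => l; rewrite sum_ffunE -[RHS](co_sum (F l)); apply: eq_bigr => i _.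
    by rewrite !ffunE /c /= -scalerAr mulr1.
apply: lfree_HV h; rewrite -True_pw; apply: pw_sbm => //; exact: regb_unital.
Qed.

(** Tor_i^L(B, B) = 0 for i > 0, from 0 -> LeL -> L -> B -> 0. In degree one, B (x)_L LeL = 0
    replaces the vanishing of Tor. *)
Lemma HV_BB m : HV m (fun _ : BB => True).
Proof.
have hs := pw_ses psl psM ps1 ps_ses; rewrite !True_pw in hs.
have hk : kerD (fun _ : pw psl psM (regb L) => True) (vmap ps : _ -> BB) = pwD J0.
  apply/funext => F; apply/propext; rewrite -(True_pw (regb L)) pw_ker.
  by split=> h i; [case: (h i)|split=> //; apply: h].
case: m => [|m]; last first.
  apply: (HV_quot hs); last exact: pw_regb_HV.
  rewrite hk; exact: HV_pwJ.
apply: (HV_quot0 hs); last exact: pw_regb_HV.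
move=> F hF _; rewrite hk in hF *; apply: (@pw_gene_comm _ _ _ _ psl psM e) hF => //.
- exact: ses_s' mulE_ses.
- exact: (@JY_gene 0).
Qed.

Lemma HV_inflB n : HV n (fun _ : regb B => True) ->
  HV n (fun _ : infl psl psM (regb B) => True).
Proof.
by apply: infl_HV => //; [move=> b; exists (jB b)|exact: HV_BB].
Qed.

(** H_{n+1}(LeL) sits between H_{n+2}(B) and H_{n+1}(L), whence the shift. *)
Lemma HV_J0 n : HV n.+1 (fun _ : infl psl psM (regb B) => True) ->
  HV n (fun _ : regb L => True) -> HV n J0.
Proof.
move=> h1 h2; have := HV_ker ps_ses h1 h2; congr HV.
by apply/funext => x; apply/propext; split=> [[]|].
Qed.

(** The coinvariants of eL (x) Le under the outer L-actions are eL (x)_L Le = eLe = A. [si] is the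
    projection and [ph] a section of it, left A-linear only. *)
Let ph (a : regb A) : EA := pur (jA a) e.
Let si (F : EA) : regb A := pA (vlift (fun v y => v * y) F).
Let vl (v : L) : klin (fun y => v * y). Proof. exact: mul_linr. Qed.
Let si_lin : klin si.
Proof. by apply: klin_comp pAl _; apply: vlift_lin => v; exact: mul_linr. Qed.
Let si_pur v y : si (pur v y) = pA (v * y).
Proof. by rewrite /si vlift_pur //; exact: mul_linl. Qed.
Let ph_lhom : lhom ph.
Proof.
split=> [|a b]; first exact: klin_comp (pur_linl e) jAl.
by rewrite /ph [RHS]opm_pur ?jAM //; exact: mul_linr.
Qed.
Let si_hom : bhom si.
Proof.
split=> [|a|a]; first exact: si_lin.
- apply: VT_ext => [||v y].
  + exact: klin_comp si_lin (E_bl_lin a).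
  + exact: klin_comp (@mul_linr _ A a) si_lin.
  + have -> : bl a (pur v y : EA) = pur (jA a * v) y by exact: (opm_pur _ _ (@mul_linr _ L _)).
    by rewrite !si_pur -mulrA pAl_.
- apply: VT_ext => [||v y].
  + exact: klin_comp si_lin (E_br_lin a).
  + exact: klin_comp (@mul_linl _ A a) si_lin.
  + have -> : br a (pur v y : EA) = pur v (y * jA a) by exact: (vmap_pur _ _ (@mul_linl _ L _)).
    by rewrite !si_pur mulrA pAr_.
Qed.
Let ph_DE a : True -> DE (ph a).
Proof.
move=> _; split.
- by rewrite opm_pur ?ejA //; exact: mul_linr.
- by rewrite vmap_pur ?ee //; exact: mul_linl.
Qed.
Let si_comm n F : @comm _ L (EL n) (@DEn n) F -> @Kmap _ _ n _ _ si F = 0.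
Proof.
have hl := Kmap_lin n si_lin.
elim=> [|r y x _ _ IH]; first exact: klin0 hl.
rewrite (klinD hl) IH addr0 (klinB hl); apply/eqP; rewrite subr_eq0; apply/eqP.
rewrite [LHS]Kmap_comp [RHS]Kmap_comp; apply: Kmap_eq; apply: VT_ext => [||v z].
- exact: klin_comp si_lin (bh_lin (gl_hom r)).
- exact: klin_comp si_lin (bh_lin (gr_hom r)).
- have -> : gl r (pur v z) = pur v (r * z) by exact: (vmap_pur _ _ (@mul_linr _ L _)).
  have -> : gr r (pur v z) = pur (v * r) z by exact: (opm_pur _ _ (@mul_linl _ L _)).
  by rewrite !si_pur mulrA.
Qed.
(** In left coordinates F = sum_i b_i F_i with F_i = [EL_co i F], while the outer right action gives
    sum_i F_i b_i = ph (si F). *)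
Let ph_si n F : @DEn n F -> @comm _ L (EL n) (@DEn n) (F - @Kmap _ _ n _ _ ph (@Kmap _ _ n _ _ si F)).
Proof.
move=> hF; rewrite -{1}(lf_rec (EL_lfree n) hF).
have -> : @Kmap _ _ n _ _ ph (@Kmap _ _ n _ _ si F) = \sum_i br (bs i) (EL_co i F).
  rewrite Kmap_comp; under eq_bigr do rewrite [br _ _]Kmap_comp.
  rewrite -Kmap_sum; apply: Kmap_eqD hF => G [h1 h2].
  have -> : G = vmap (fun x => x * e) (opm (fun x => e * x) G) by rewrite h1 h2.
  move: G {h1 h2}; apply: VT_ext => [||v y].
  - apply: klin_comp (lh_lin ph_lhom) _; apply: klin_comp si_lin _.
    apply: klin_comp (vmap_lin (@mul_linl _ L e)) _; exact: opm_lin.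
  - apply: klin_bigsum => i; apply: klin_comp (bh_lin (gr_hom (bs i))) _.
    apply: klin_comp (vmap_lin _) (klin_comp (vmap_lin (@mul_linl _ L e)) (opm_lin _)).
    by move=> a x z; rewrite (co_lin i) scalerDl scalerA.
  rewrite opm_pur; last exact: mul_linr.
  rewrite vmap_pur; last exact: mul_linl.
  rewrite si_pur /ph jpA.
  transitivity (\sum_i pur (e * v * (co i (y * e) *: bs i)) e : VT L L).
    rewrite -(klin_sum (pur_linl e)) -mulr_sumr co_sum.
    by rewrite !mulrA ee -[_ * e * e]mulrA ee.
  apply: eq_bigr => i _.
  rewrite vmap_pur; last by move=> a x z; rewrite (co_lin i) scalerDl scalerA.
  rewrite [RHS](opm_pur _ _ (@mul_linl _ L _)).
  by rewrite -scalerAr purZ.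
rewrite -sumrB; apply: comm_sum => i; apply: comm1; exact: lf_D (EL_lfree n) _ _ hF.
Qed.

(** [si] and [ph] identify the L-coinvariants of [EL m] with the m-th A-syzygy of A, so the
    resolution that yields HH(L, LeL) also yields HH(A). *)
Lemma HV_A n : HV n J0 -> HV n (fun _ : regb A => True).
Proof.
move=> /(dim_shift n resolE) ti K hK rK.
pose F : VTn n.+1 EA := @Kmap _ _ n.+1 _ _ ph K.
have hF : @DEn n.+1 F by apply: (Kmap_KDn n.+1) hK; [exact: ph_lhom|exact: ph_DE].
have siK m (G : VTn m (regb A)) : @Kmap _ _ m _ _ si (@Kmap _ _ m _ _ ph G) = G.
  rewrite Kmap_comp -[RHS]Kmap_id; apply: Kmap_eq => a.
  by rewrite /ph si_pur jAe pjA.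
have hj : @JY n.+1 (rho F) by apply: (ses_in (rho_ses n)).
have cj : comm (@DEn n) (rho F : EL n).
  have h := ph_si (comm_in (sbm_KDn n sbm_DE) hj).
  have e0 : @Kmap _ _ n _ _ si (rho F) = 0.
    by rewrite -(bhom_rho _ (Kmap_bhom n si_hom)) [vmap _ F](siK n.+1).
  by rewrite e0 (klin0 (Kmap_lin n (lh_lin ph_lhom))) subr0 in h.
have := ti _ (proj2 (rs_ker resolE n _) hj) cj.
have -> : kerD (@DY n.+1) (@gY n) = @JY n.+1.
  by apply/funext => G; apply/propext; exact: (rs_ker resolE n).
move=> /(comm_lift (ses_h (rho_ses n)) (ses_sur (rho_ses n))) [G hG eG].
(* [F] and [G] have the same [rho], so F - G is a sum of A-commutators by exactness. [si] kills the
   L-commutator [G], and sends F back to [K]. *)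
have hFG : @JY n.+2 (F - G).
  apply: (proj1 (rs_ker resolE n.+1 _)); split.
    exact: (sbmB (sbm_DEn n.+1) hF (comm_in (sbm_DEn n.+1) hG)).
  by rewrite [LHS](klinB (@rho_lin _ _ (VTn n EA))) eG subrr.
have hl := Kmap_lin n.+1 si_lin.
rewrite -(siK n.+1 K) -[@Kmap _ _ n.+1 _ _ ph K]/F -[F](subrK G) (klinD hl) (si_comm hG) addr0.
apply: comm_img (Kmap_bhom n.+1 si_hom) _ hFG => y hy.
by apply: (Kmap_KDn n.+1) hy => //; exact: bhom_lhom si_hom.
Qed.

Lemma HV_corners N : (forall n, (N <= n)%N -> HV n (fun _ : regb L => True)) ->
  (forall n, (N <= n)%N -> HV n (fun _ : regb A => True)) /\
  (forall n, (N <= n)%N -> HV n (fun _ : regb B => True)).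
Proof.
move=> h; have hB n : (N <= n)%N -> HV n (fun _ : regb B => True).
  move=> hn; apply: (HV_retract jBl jBM psl psM psj); exact: h.
split=> // n hn; apply: HV_A; apply: HV_J0; last exact: h.
by apply: HV_inflB; apply: hB; apply: leqW.
Qed.
End Setup.

(** * The corner algebra *)

Section CornerAlgebra.
Variables (k : fieldType) (L : falgType k).

Definition iv (e : idem L) : L := idem_val e.
Lemma ivP e : iv e * iv e = iv e. Proof. exact: idemP. Qed.

Variable e : idem L.

(** A [falgType] is nontrivial, so the proof that e is nonzero has to be an argument of the type. *)
Definition cfalg of iv e != 0 : Type := corner e.
Hypothesis ne : iv e != 0.
Local Notation C := (cfalg ne).
HB.instance Definition _ := GRing.PzRing.on C.

Lemma cfalg_nz : (1 : C) != 0.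
Proof. by apply/eqP => /(congr1 (@peirce_val _ e e)) /eqP h; move/negP: ne; apply. Qed.
HB.instance Definition _ := GRing.PzSemiRing_isNonZero.Build C cfalg_nz.

Lemma cscale_subproof (c : k) (x : corner e) : c *: (peirce_val x : L) \in peirce_pred e e.
Proof. by rewrite unfold_in -[idem_val e]/(iv e) -scalerAr -scalerAl [iv e * _ * _]peirceE. Qed.
Definition cscale (c : k) (x : C) : C := Peirce (cscale_subproof c (x : corner e)).

Lemma cscaleA a b x : cscale a (cscale b x) = cscale (a * b) x.
Proof. by apply: val_inj; exact: scalerA. Qed.
Lemma cscale1 : left_id 1 cscale.
Proof. by move=> x; apply: val_inj; exact: scale1r. Qed.
Lemma cscaleDr : right_distributive cscale +%R.
Proof. by move=> a x y; apply: val_inj; exact: scalerDr. Qed.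
Lemma cscaleDl x : {morph cscale^~ x : a b / a + b}.
Proof. by move=> a b; apply: val_inj; exact: scalerDl. Qed.
HB.instance Definition _ :=
  GRing.Zmodule_isLmodule.Build k C cscaleA cscale1 cscaleDr cscaleDl.
Lemma cscaleAl (a : k) (x y : C) : a *: (x * y) = (a *: x) * y.
Proof. by apply: val_inj; exact: scalerAl. Qed.
Lemma cscaleAr (a : k) (x y : C) : a *: (x * y) = x * (a *: y).
Proof. by apply: val_inj; exact: scalerAr. Qed.
HB.instance Definition _ := GRing.Lmodule_isLalgebra.Build k C cscaleAl.
HB.instance Definition _ := GRing.Lalgebra_isAlgebra.Build k C cscaleAr.

Definition cval (x : C) : L := peirce_val (x : corner e).
Lemma cproj_subproof (x : L) : iv e * x * iv e \in peirce_pred e e.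
Proof. by rewrite unfold_in -[idem_val e]/(iv e) !mulrA ivP -!mulrA ivP. Qed.
Definition cproj (x : L) : C := Peirce (cproj_subproof x).
Lemma cvalK : cancel cval cproj.
Proof. by move=> x; apply: val_inj; exact: (peirceE (x : peirce e e)). Qed.
Lemma cval_lin : klin cval. Proof. by []. Qed.
Lemma cproj_lin : klin cproj.
Proof.
move=> a x y; apply: val_inj.
by rewrite [LHS]/= mulrDr mulrDl -scalerAr -scalerAl.
Qed.

Let h (x : L) : L := cval (cproj x).
Let h_linear : linear h. Proof. by move=> a x y; rewrite /h cproj_lin cval_lin. Qed.
Let hL : {linear L -> L} := HB.pack h (GRing.isLinear.Build k L L *:%R h h_linear).
Let U : {vspace L} := limg (linfun hL).

(** eLe is the image of the linear projection x -> e x e of L, whose finite dimension is carried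
    over. *)
Lemma cfalg_vect : Vector.axiom (\dim U) C.
Proof.
have [f fl fb] : Vector.axiom (\dim U) (subvs_of U) by exact: subvs_vect_iso.
have hU x : x \in U -> h x = x.
  move=> /memv_imgP [y _ ->]; rewrite lfunE /= /h; congr cval; exact: cvalK.
have Uc x : cval x \in U.
  by apply/memv_imgP; exists (cval x); rewrite ?memvf // lfunE /= /h cvalK.
exists (fun x : C => f (Subvs (Uc x))).
  by move=> a x y; rewrite -fl; congr f; apply: val_inj.
have [g gK fK] := fb.
exists (fun r => cproj (vsval (g r))) => [x|r].
  by rewrite gK /= cvalK.
rewrite -[RHS]fK; congr f; apply: val_inj => /=.
by rewrite -[LHS]/(h _) hU ?subvsP.
Qed.
HB.instance Definition _ := Lmodule_hasFinDim.Build k C cfalg_vect.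
HB.instance Definition _ := Algebra_isFalgebra.Build k C.
Definition cornerF : falgType k := C.
End CornerAlgebra.

(** * Tor over the corner algebra *)

Section ScalarModule.
Variables (k S : pzRingType) (i : k -> S).
Hypotheses (iD : forall a b, i (a + b) = i a + i b) (iM : forall a b, i (a * b) = i a * i b) (i1 : i 1 = 1).

Definition scm (_ : forall a b, i (a + b) = i a + i b) (_ : forall a b, i (a * b) = i a * i b)
  (_ : i 1 = 1) (X : lmodType S) : Type := X.
Variable X : lmodType S.
Local Notation T := (scm iD iM i1 X).
HB.instance Definition _ := GRing.Zmodule.on T.
Definition scm_scale (c : k) (x : T) : T := i c *: (x : X).
Lemma scm_scaleA a b x : scm_scale a (scm_scale b x) = scm_scale (a * b) x.
Proof. by rewrite /scm_scale scalerA iM. Qed.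
Lemma scm_scale1 : left_id 1 scm_scale.
Proof. by move=> x; rewrite /scm_scale i1; exact: (@scale1r _ X). Qed.
Lemma scm_scaleDr : right_distributive scm_scale +%R.
Proof. by move=> a x y; exact: (@scalerDr _ X). Qed.
Lemma scm_scaleDl x : {morph scm_scale^~ x : a b / a + b}.
Proof. by move=> a b; rewrite /scm_scale iD; exact: (@scalerDl _ X). Qed.
HB.instance Definition _ :=
  GRing.Zmodule_isLmodule.Build k T scm_scaleA scm_scale1 scm_scaleDr scm_scaleDl.
Definition scmod : lmodType k := T.
End ScalarModule.

Section CornerTor.
Variables (k : fieldType) (L : falgType k) (e : idem L) (ne : iv e != 0).
Local Notation A := (cornerF ne).
Local Notation C := (corner e).
Local Notation jA := (@cval k L e ne).
Local Notation pA := (@cproj k L e ne).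

Lemma jAM x y : jA (x * y) = jA x * jA y. Proof. by []. Qed.
Lemma jA1 : jA 1 = iv e. Proof. by []. Qed.
Lemma jpA x : jA (pA x) = iv e * x * iv e. Proof. by []. Qed.
Lemma jA_l a : iv e * jA a = jA a. Proof. exact: (peirce_l (a : peirce e e)). Qed.
Lemma jA_r a : jA a * iv e = jA a. Proof. exact: (peirce_r (a : peirce e e)). Qed.

Definition ki (c : k) : C := cscale (ne := ne) c 1.
Lemma kiD a b : ki (a + b) = ki a + ki b.
Proof. exact: (@scalerDl k A 1). Qed.
Lemma kiM a b : ki (a * b) = ki a * ki b.
Proof.
apply: val_inj; rewrite [LHS]/= [RHS]/=.
by rewrite -scalerAl -scalerAr scalerA; congr (_ *: _); exact/esym/ivP.
Qed.
Lemma kiMc a b : (ki (a * b) : C^c) = (ki a : C^c) * (ki b : C^c).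
Proof. by rewrite mulrC kiM. Qed.
Lemma ki1 : ki 1 = 1. Proof. exact: cscale1. Qed.
Lemma kiE c (a : A) : (ki c : A) * a = c *: a.
Proof.
apply: (@val_inj _ _ (peirce e e)); transitivity ((c *: iv e) * jA a); first by [].
by rewrite -scalerAl jA_l.
Qed.
Lemma kiEr c (a : A) : a * (ki c : A) = c *: a.
Proof.
apply: (@val_inj _ _ (peirce e e)); transitivity (jA a * (c *: iv e)); first by [].
by rewrite -scalerAr jA_r.
Qed.

Definition rk (X : lmodType C^c) : lmodType k := scmod (i := (ki : k -> C^c)) kiD kiMc ki1 X.

Section RightModule.
Variable X : lmodType C^c.
Definition ra (a : A) (x : rk X) : rk X := ((a : C) : C^c) *: (x : X).
Let cg (r r' : C^c) (x : X) : r = r' -> r *: x = r' *: x. Proof. by move->. Qed.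
Let sA (r r' : C^c) (x : X) : r *: (r' *: x) = (r * r') *: x. Proof. exact: scalerA. Qed.
Lemma ra_lin a : klin (ra a).
Proof.
move=> c x y; rewrite [LHS](@scalerDr _ X); congr (_ + _).
apply: (etrans (sA _ (ki c) x)); apply: (etrans _ (esym (sA (ki c) _ x))); apply: cg.
exact: (etrans (kiE c a) (esym (kiEr c a))).
Qed.
Lemma ra_linr x : klin (ra^~ x).
Proof.
move=> c a b; rewrite [LHS](@scalerDl _ X); congr (_ + _).
apply: (etrans _ (esym (sA (ki c) _ x))); apply: cg; exact/esym/kiEr.
Qed.
Lemma raM a b x : ra (a * b) x = ra b (ra a x).
Proof. exact/esym/(sA (b : C) (a : C)). Qed.
Lemma ra1 x : ra 1 x = x.
Proof. exact: (@scale1r _ X). Qed.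

(* The A-bimodule eL (x) X, as a part of L (x) X. *)
Definition LX_bl (a : A) (F : VT L (rk X)) : VT L (rk X) := opm (fun v => jA a * v) F.
Definition LX_br (a : A) (F : VT L (rk X)) : VT L (rk X) := vmap (ra a) F.
Lemma LX_bl_lin a : klin (LX_bl a). Proof. exact: opm_lin. Qed.
Lemma LX_br_lin a : klin (LX_br a). Proof. exact: vmap_lin (ra_lin a). Qed.
Lemma LX_bl_linr F : klin (LX_bl^~ F).
Proof.
move=> c a b; rewrite /LX_bl -opm_linf; apply: opm_ext => x.
by rewrite (cval_lin (ne := ne)) mulrDl scalerAl.
Qed.
Lemma LX_br_linr F : klin (LX_br^~ F).
Proof.
move=> c a b; rewrite /LX_br -vmap_linf; apply: vmap_ext => x; exact: ra_linr.
Qed.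
Lemma LX_blM a b F : LX_bl (a * b) F = LX_bl a (LX_bl b F).
Proof.
rewrite /LX_bl opm_comp; [|exact: mul_linr|exact: mul_linr].
by apply: opm_ext => x; rewrite jAM mulrA.
Qed.
Lemma LX_brM a b F : LX_br (a * b) F = LX_br b (LX_br a F).
Proof. by rewrite /LX_br vmap_comp; apply: vmap_ext => x; rewrite raM. Qed.
Lemma LX_blr a b F : LX_bl a (LX_br b F) = LX_br b (LX_bl a F).
Proof. by rewrite /LX_bl /LX_br opm_vmap //; [exact: mul_linr|exact: ra_lin]. Qed.
Definition LX : bimod A := Bimod LX_bl_lin LX_br_lin LX_bl_linr LX_br_linr LX_blM LX_brM LX_blr.
(** The subspace eL (x) X. Its Hochschild homology over A is Tor^A(X, eL), which is how Tor over the
    corner meets [HV]. *)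
Definition eLX (F : LX) : Prop := opm (fun v => iv e * v) F = F.

Lemma DX_opm F : eLX (opm (fun v => iv e * v) F).
Proof.
rewrite /eLX opm_comp; [|exact: mul_linr|exact: mul_linr].
by apply: opm_ext => v; rewrite mulrA ivP.
Qed.

Lemma sbm_DX : sbm eLX.
Proof.
have hl := @opm_lin k L L (rk X) (fun x => iv e * x).
split=> [|x y hx hy|c x hx|a x hx|a x hx|x hx|x hx]; rewrite /eLX.
- exact: klin0 hl.
- by rewrite (klinD hl) hx hy.
- by rewrite (klinZ hl) hx.
- rewrite [bl _ _]/= /LX_bl opm_comp; [|exact: mul_linr|exact: mul_linr].
  by apply: opm_ext => v; rewrite mulrA jA_l.
- rewrite -[in RHS]hx; exact: (opm_vmap _ (@mul_linr _ L (iv e)) (ra_lin a)).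
- by rewrite [LHS]/= /LX_bl -[RHS]hx; apply: opm_ext => v; rewrite jA1.
- by apply/ffunP => i; rewrite ffunE ra1.
Qed.

Lemma DX_pur v x : eLX (pur (iv e * v) x).
Proof. by rewrite /eLX opm_pur ?mulrA ?ivP //; exact: mul_linr. Qed.

(* X (x)_k A, as a right A-module. *)
Definition XA : Type := VT A (rk X).
HB.instance Definition _ := GRing.Zmodule.on XA.
Definition XA_act (a : C^c) (F : XA) : XA := opm (fun s : A => s * (a : C)) (F : VT A (rk X)).
Lemma XA_actA a b F : XA_act a (XA_act b F) = XA_act (a * b) F.
Proof.
rewrite /XA_act opm_comp; [|exact: (@mul_linl k A)|exact: (@mul_linl k A)].
by apply: opm_ext => s; rewrite -[LHS](@mulrA A).
Qed.
Lemma XA_act1 : left_id 1 XA_act.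
Proof. by move=> F; rewrite /XA_act -[RHS]opm_id; apply: opm_ext => s; exact: (@mulr1 A). Qed.
Lemma XA_actDr : right_distributive XA_act +%R.
Proof. by move=> a F G; exact: (klinD (@opm_lin _ _ _ _ _)). Qed.
Lemma XA_actDl F : {morph XA_act^~ F : a b / a + b}.
Proof.
move=> a b; rewrite /XA_act -[opm (fun s : A => s * (a : C)) _]scale1r -opm_linf.
by apply: opm_ext => s; rewrite scale1r; exact: (@mulrDr A).
Qed.
HB.instance Definition _ := GRing.Zmodule_isLmodule.Build C^c XA XA_actA XA_act1 XA_actDr XA_actDl.

Definition XA_mul (F : XA) : X := vlift (fun (s : A) (x : rk X) => ra s x) (F : VT A (rk X)).
Lemma XA_mul_lin : klin (XA_mul : VT A (rk X) -> rk X).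
Proof. by apply: vlift_lin; exact: ra_lin. Qed.
Lemma XA_mul_pur s x : XA_mul (pur s x) = ra s x.
Proof. by rewrite /XA_mul vlift_pur //; [exact: ra_lin|exact: ra_linr]. Qed.
Lemma XA_mul_linear : GRing.linear_for *:%R XA_mul.
Proof.
move=> a F G; rewrite [LHS](klinD XA_mul_lin); congr (_ + _).
suff aux : forall F : VT A (rk X), XA_mul (opm (fun s : A => s * (a : C)) F) = ra a (XA_mul F) :> rk X.
  exact: aux.
apply: VT_ext => [||s x].
- exact: klin_comp XA_mul_lin (opm_lin _).
- exact: klin_comp (ra_lin a) XA_mul_lin.
- by rewrite opm_pur ?XA_mul_pur ?raM //; exact: (@mul_linl k A).
Qed.

(** As in [proj_lfree], but on the right: projectivity splits the action X (x) A -> X, and the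
    resulting coordinates act on the second factor of eL (x) X. *)
Lemma proj_rfree : projective X -> exists s, rfree eLX s.
Proof.
move=> hX.
have [|h hh] := hX _ X (mklin XA_mul_linear) (mklin (fun a (x y : X) => erefl (a *: x + y))).
  by move=> y; exists (pur 1 (y : rk X)); rewrite [LHS]XA_mul_pur; exact: ra1.
pose t (i : ix A) (x : rk X) : rk X := (h x : VT A (rk X)) i.
have ha a x : h (ra a x) = opm (fun s : A => s * a) (h x : VT A (rk X)) by exact: linearZ.
have tl i : klin (t i).
  move=> c x y; rewrite /t [h _]linearD ffunE; congr (_ + _).
  rewrite -[h _]/(h (ra (ki c) x)) ha opmE.
  under eq_bigr do rewrite kiEr (klinZ (co_lin i)) co_bs.
  rewrite (bigD1 i) //= eqxx big1 => [|j /negPf ji].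
    by rewrite addr0; congr (_ *: _); exact: mulr1.
  by rewrite eq_sym ji /= scaler0 scale0r.
exists (fun i => vmap (t i)); split=> [i|i F hF|i a F|j a F|F _].
- exact: vmap_lin.
- by rewrite /eLX opm_vmap ?hF //; exact: mul_linr.
- by rewrite [RHS]opm_vmap //; exact: mul_linr.
- apply/ffunP => l; rewrite !ffunE sum_ffunE /t ha opmE.
  by apply: eq_bigr => i _; rewrite !ffunE.
- apply/ffunP => l; rewrite sum_ffunE -[RHS](hh (F l)).
  by apply: eq_bigr => i _; rewrite !ffunE.
Qed.
Lemma proj_HV_DX n : projective X -> HV n eLX.
Proof. by move=> /proj_rfree [s hs]; apply: rfree_HV hs; exact: sbm_DX. Qed.
End RightModule.
End CornerTor.

Section TorVanish.
Variables (k : fieldType) (L : falgType k) (e : idem L) (ne : iv e != 0).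
Local Notation A := (cornerF ne).
Local Notation C := (corner e).
Local Notation jA := (@cval k L e ne).
Local Notation E := (EA (@cval_lin k L e ne) (@jAM k L e ne)).
Local Notation DE := (@DE k L A (iv e) jA (@cval_lin k L e ne) (@jAM k L e ne)).
Local Notation DX := (@eLX k L e ne _).
Local Notation M := (peirce_right (idem1 L) e).
Local Notation N := (peirce_left e (idem1 L)).

Lemma nproj_subproof (x : L) : iv e * x \in peirce_pred e (idem1 L).
Proof. by rewrite unfold_in -[idem_val e]/(iv e) mulrA ivP [_ * _](mulr1 (iv e * x)). Qed.
Definition nproj (x : L) : N := Peirce (nproj_subproof x).
Definition nval (n : N) : L := peirce_val (n : peirce e (idem1 L)).
Lemma nvalE n : iv e * nval n = nval n. Proof. exact: (peirce_l (n : peirce e (idem1 L))). Qed.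
Lemma nvalK n : nproj (nval n) = n.
Proof. by apply: (@val_inj _ _ (peirce e (idem1 L))); exact: nvalE. Qed.
Lemma nprojD x y : nproj (x + y) = nproj x + nproj y.
Proof. by apply: (@val_inj _ _ (peirce e (idem1 L))); exact: mulrDr. Qed.
Lemma nproj_act (a : C) x : nproj ((jA a : L) * x) = a *: nproj x.
Proof.
apply: (@val_inj _ _ (peirce e (idem1 L))).
transitivity (iv e * (jA a * x)); first by [].
by rewrite mulrA jA_l; transitivity (jA a * (iv e * x)); rewrite // mulrA jA_r.
Qed.
Lemma mval_subproof (x : L) : x * iv e \in peirce_pred (idem1 L) e.
Proof. by rewrite unfold_in -[idem_val e]/(iv e) [1 * _]mul1r -mulrA ivP. Qed.
Definition mproj (x : L) : M := Peirce (mval_subproof x).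
Definition mval (m : M) : L := peirce_val (m : peirce (idem1 L) e).
Lemma mvalE m : mval m * iv e = mval m. Proof. exact: (peirce_r (m : peirce (idem1 L) e)). Qed.

Section TensorModel.
Variable X : lmodType C^c.
Local Notation T := (tens X N).
Let pb := pure_balanced (fun (a : C) (x : X) => (a : C^c) *: x) (fun (a : C) (y : N) => a *: y).

Let hDX := @sbm_DX k L e ne X.

(** Identifies the A-coinvariants of eL (x) X with X (x)_C eL: [Phi_comm], [Phi_sur] and [Phi_eq0]
    are well-definedness, surjectivity and injectivity. *)
Definition Phi (F : VT L (rk ne X)) : T := \sum_i pure _ _ (F i : X) (nproj (bs i)).

Lemma PhiD F G : Phi (F + G) = Phi F + Phi G.
Proof.
by rewrite /Phi -big_split /=; apply: eq_bigr => i _; rewrite ffunE; exact: (balDl pb).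
Qed.
Let T0r x : pure _ _ x 0 = 0 :> T. Proof. exact: (bal0r x pb). Qed.
Lemma Phi_pur v x : Phi (pur v x) = pure _ _ (x : X) (nproj v).
Proof.
rewrite /Phi -[in RHS](co_sum v).
have h (s : seq (ix L)) : pure _ _ (x : X) (nproj (\sum_(i <- s) co i v *: bs i)) =
    \sum_(i <- s) pure _ _ (x : X) (nproj (co i v *: bs i)) :> T.
  elim: s => [|i s IH].
    rewrite !big_nil (_ : nproj 0 = 0) ?T0r //.
    by apply: (@val_inj _ _ (peirce e (idem1 L))); exact: mulr0.
  by rewrite !big_cons nprojD (balDr pb) IH.
rewrite h; apply: eq_bigr => i _; rewrite purE.
have -> : nproj (co i v *: bs i) = (ki ne (co i v) : C) *: nproj (bs i).
  rewrite -nproj_act; apply: (@val_inj _ _ (peirce e (idem1 L))).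
  transitivity (iv e * (co i v *: bs i)); first by [].
  transitivity (iv e * ((co i v *: iv e) * bs i)); last by [].
  by rewrite -scalerAl -!scalerAr mulrA ivP.
exact: (balZ pb).
Qed.
Lemma Phi0 : Phi 0 = 0.
Proof. by apply: (addIr (Phi 0)); rewrite -PhiD !add0r. Qed.
Lemma PhiN F : Phi (- F) = - Phi F.
Proof. by apply: (addIr (Phi F)); rewrite -PhiD !addNr Phi0. Qed.
Lemma Phi_act (a : A) F : Phi (bl a (F : LX ne X)) = Phi (br a (F : LX ne X)).
Proof.
rewrite [F]VT_sum (klin_sum (bl_lin a)) (klin_sum (br_lin a)).
rewrite !(big_morph Phi PhiD Phi0); apply: eq_bigr => i _.
have -> : bl a (pur (bs i) (F i) : LX ne X) = pur (jA a * bs i) (F i).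
  exact: (opm_pur _ _ (@mul_linr _ L _)).
have -> : br a (pur (bs i) (F i) : LX ne X) = pur (bs i) (ra a (F i)).
  exact: (vmap_pur _ _ (ra_lin _)).
by rewrite !Phi_pur nproj_act; exact/esym/(balZ pb).
Qed.
Lemma Phi_comm F : comm DX F -> Phi F = 0.
Proof.
elim=> [|a y x _ _ IH]; first exact: Phi0.
by rewrite PhiD IH addr0 PhiD PhiN Phi_act subrr.
Qed.
Lemma Phi_sur t : exists2 F, DX F & Phi F = t.
Proof.
have [s ->] := tens_sumP t; elim: s => [|p s [F hF eF]].
  by exists 0; [exact: sbm0 hDX|rewrite big_nil Phi0].
exists (pur (nval p.2) (p.1 : rk ne X) + F).
  by apply: (sbmD hDX) => //; rewrite -nvalE; exact: DX_pur.
by rewrite PhiD eF big_cons Phi_pur nvalK.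
Qed.
Lemma tens_comm (Y : bimod A) (D : Y -> Prop) (t : X -> N -> Y) (s : seq (X * N)) : sbm D ->
  (forall x n, D (t x n)) ->
  (forall x x' y, t (x + x') y = t x y + t x' y) ->
  (forall x y y', t x (y + y') = t x y + t x y') ->
  (forall (a : C) x y, t ((a : C^c) *: x) y = br (a : A) (t x y)) ->
  (forall (a : C) x y, t x (a *: y) = bl (a : A) (t x y)) ->
  \sum_(p <- s) (pure _ _ p.1 p.2 : T) = 0 -> comm D (\sum_(p <- s) t p.1 p.2).
Proof.
move=> hD tD tl tr ta tb; apply: (@tens_zeroP C X N Y (comm D) t s) => //.
- exact: comm0.
- by move=> x y; apply: commB.
- by move=> a x y; rewrite ta tb; apply: commC.
Qed.
Lemma Phi_eq0 F : DX F -> Phi F = 0 -> comm DX F.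
Proof.
move=> hF h; pose t (x : X) (n : N) : LX ne X := pur (nval n) (x : rk ne X).
have -> : F = \sum_(p <- [seq (F i : X, nproj (bs i)) | i : ix L]) t p.1 p.2.
  rewrite big_map -[LHS]hF [X in opm _ X]VT_sum (klin_sum (opm_lin _)) big_enum /=.
  by apply: eq_bigr => i _; rewrite opm_pur //; exact: mul_linr.
apply: (@tens_comm _ (eLX (ne := ne) (X := X)) t); rewrite ?big_map ?big_enum //.
- by move=> x n; rewrite /t -nvalE; apply: DX_pur.
- by move=> x x' y; exact: (klinD (pur_linr _)).
- by move=> x y y'; exact: (klinD (pur_linl _)).
- by move=> a x y; exact/esym/(vmap_pur _ _ (ra_lin _)).
- by move=> a x y; exact/esym/(opm_pur _ _ (@mul_linr _ L _)).
Qed.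
End TensorModel.

Lemma Phi_map (X X' : lmodType C^c) (g : {linear X -> X'}) F :
  tens_map g (Phi F) = Phi (vmap (g : rk ne X -> rk ne X') F).
Proof.
have pb := pure_balanced (fun (a : C) (x : X') => (a : C^c) *: x) (fun (a : C) (y : N) => a *: y).
have gb : balanced (fun (a : C) (x : X) => (a : C^c) *: x) (fun (a : C) (y : N) => a *: y)
    (fun x y => pure _ _ (g x) y : tens X' N).
  split=> [x x' y|x y y'|s x y].
  - by rewrite linearD (balDl pb).
  - by rewrite (balDr pb).
  - by rewrite linearZ (balZ pb).
have g0 : tens_map g (0 : tens X N) = 0.
  by apply: (addIr (tens_map g (0 : tens X N))); rewrite -(tens_liftD gb) !add0r.
rewrite /Phi (big_morph (tens_map g) (tens_liftD gb) g0).
by apply: eq_bigr => i _; rewrite ffunE [LHS](tens_liftE _ _ gb).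
Qed.

Lemma rk_lin (X X' : lmodType C^c) (g : {linear X -> X'}) : klin (g : rk ne X -> rk ne X').
Proof.
have gZ (r : C^c) x : g (r *: x) = r *: g x by exact: linearZ.
by move=> c x y; rewrite [LHS]linearD; congr (_ + _); exact: (gZ (ki ne c)).
Qed.

Lemma rk_hom (X X' : lmodType C^c) (g : {linear X -> X'}) :
  bhom (vmap (g : rk ne X -> rk ne X') : LX ne X -> LX ne X').
Proof.
have gl := rk_lin g.
have gZ (r : C^c) x : g (r *: x) = r *: g x by exact: linearZ.
split=> [|a F|a F]; first exact: vmap_lin.
  by rewrite [RHS]opm_vmap //; exact: mul_linr.
by apply/ffunP => i; rewrite !ffunE; exact: (gZ (a : C)).
Qed.

Lemma rk_ses (X X' : lmodType C^c) (g : {linear X -> X'}) (K : X' -> Prop) :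
  (forall x, K (g x)) -> (forall x, K x -> exists y, g y = x) ->
  ses (fun F : LX ne X => DX F) (fun F : LX ne X' => DX F /\ forall i, K (F i))
    (vmap (g : rk ne X -> rk ne X') : LX ne X -> LX ne X').
Proof.
move=> hK hs; have gh := rk_hom g; have gl := rk_lin g.
have gD F : DX F -> DX (vmap (g : rk ne X -> rk ne X') F).
  move=> hF; rewrite /eLX opm_vmap ?hF //; exact: mul_linr.
have sur (F : LX ne X') : DX F -> (forall i, K (F i)) ->
    exists2 G : LX ne X, DX G & vmap (g : rk ne X -> rk ne X') G = F.
  move=> hF hKF; have /choice [G hG] : forall i, exists x, g x = F i by move=> i; apply: hs.
  (* A coordinatewise lift need not lie in eL (x) X. Multiplying its first factor by e puts it
     there, and leaves the image F unchanged. *)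
  exists (opm (fun v => iv e * v) ([ffun i => (G i : rk ne X)] : VT L (rk ne X))); first exact: DX_opm.
  rewrite -opm_vmap //; last exact: mul_linr.
  rewrite -[RHS]hF; congr opm; apply/ffunP => i; rewrite !ffunE; exact: hG.
have K0 : K 0 by rewrite -(linear0 g).
have KD x y : K x -> K y -> K (x + y).
  by move=> /hs [x' <-] /hs [y' <-]; rewrite -linearD.
have KZ a x : K x -> K (a *: x) by move=> /hs [x' <-]; rewrite -linearZ.
have hD := @sbm_DX k L e ne X'.
split=> //.
- exact: sbm_DX.
- have [h0 hA hZ hl hr h1 h2] := hD.
  have KS (F : LX ne X') (f : L -> L) : klin f -> (forall i, K (F i)) -> forall i, K (opm f F i).
    move=> fl hF i; rewrite opmE; apply: (big_ind (fun x => K x)) => // j _; exact: KZ.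
  split=> [|x y [hx kx] [hy ky]|a x [hx kx]|a x [hx kx]|a x [hx kx]|x [hx _]|x [hx _]].
  + by split=> // i; rewrite ffunE.
  + by split; [exact: hA|move=> i; rewrite ffunE; exact: KD].
  + by split; [exact: hZ|move=> i; rewrite ffunE; exact: KZ].
  + by split; [exact: hl|apply: KS => //; exact: mul_linr].
  + by split; [exact: hr|move=> i; rewrite ffunE; exact: KZ].
  + exact: h1.
  + exact: h2.
- by move=> F hF; split; [exact: gD|move=> i; rewrite ffunE].
- by move=> F [hF kF]; exact: sur.
Qed.
End TorVanish.

Section TorHV.
Variables (k : fieldType) (L : falgType k) (e : idem L) (ne : iv e != 0).
Local Notation A := (cornerF ne).
Local Notation C := (corner e).
Local Notation jA := (@cval k L e ne).
Local Notation E := (EA (@cval_lin k L e ne) (@jAM k L e ne)).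
Local Notation DE := (@DE k L A (iv e) jA (@cval_lin k L e ne) (@jAM k L e ne)).
Local Notation DX := (@eLX k L e ne _).
Local Notation M := (peirce_right (idem1 L) e).
Local Notation N := (peirce_left e (idem1 L)).

Section Resolution.
Variables (X : lmodType C^c) (P : proj_resolution X).

Definition robj (m : nat) : lmodType C^c := if m is m'.+1 then P m' else X.
Definition rmap (m : nat) : {linear robj m.+1 -> robj m} :=
  match m return {linear robj m.+1 -> robj m} with 0 => res_aug P | m'.+1 => res_diff P m' end.

Lemma rmap_exact m x : rmap m x = 0 <-> exists y, rmap m.+1 y = x.
Proof. by case: m x => [|m] x; [exact: res_exact0|exact: res_exact]. Qed.

Lemma Tor_resol : @resol _ A (fun m => LX ne (robj m)) (fun m => DX)
  (fun m F => DX F /\ forall i, exists y, rmap m y = F i)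
  (fun m => vmap (rmap m : rk ne _ -> rk ne _)).
Proof.
split=> [m|m F|m i].
- apply: (@rk_ses _ _ _ ne _ _ (rmap m) (fun z => exists y, rmap m y = z)) => [x|x //].
  by exists x.
- split=> [[h /ffunP e0]|[h e0]].
    by split=> // i; apply/rmap_exact; have := e0 i; rewrite !ffunE.
  by split=> //; apply/ffunP => i; rewrite !ffunE; apply: (proj2 (rmap_exact _)); exact: e0.
- by apply: proj_HV_DX; exact: res_proj.
Qed.

(** The argument of [HH_acyclicP], with [Phi] in place of x -> x (x) 1. The converse is [HV_Tor]. *)
Lemma Tor_HV n : tens_acyclic_at P N n.+1 -> HV n (DX : LX ne X -> Prop).
Proof.
move=> hac; have hr := Tor_resol.
have <- : (fun F => DX F /\ forall i, exists y, rmap 0 y = (F : LX ne X) i) = DX.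
  apply/funext => F; apply/propext; split=> [[]|h] //; split=> // i.
  by have [y hy] := res_aug_surj P (F i : X); exists y.
apply: (proj2 (dim_shift n hr)) => x hx cx.
have [y hy yx] := ses_sur (rs_ses hr n.+1) (proj1 (rs_ker hr n x) hx).
have [|w hw] := hac (Phi (y : LX ne (P n.+1))).
  rewrite /= Phi_map; apply: Phi_comm.
  by rewrite [vmap _ _]yx.
have [w' hw' ew] := Phi_sur ne w.
have hyw : comm DX ((y : LX ne (P n.+1)) - vmap (res_diff P n.+1 : rk ne _ -> rk ne _) w').
  apply: Phi_eq0.
    apply: (sbmB (@sbm_DX k L e ne (P n.+1))) => //.
    exact: (proj1 (ses_in (rs_ses hr n.+2) hw')).
  by rewrite PhiD PhiN -Phi_map ew hw subrr.
have -> : x = vmap (rmap n.+1 : rk ne _ -> rk ne _)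
    ((y : LX ne (P n.+1)) - vmap (res_diff P n.+1 : rk ne _ -> rk ne _) w').
  rewrite [RHS](klinB (bh_lin (ses_h (rs_ses hr n.+1)))) yx -[LHS]subr0; congr (_ - _).
  by have [_ ->] := proj2 (rs_ker hr n.+1 _) (ses_in (rs_ses hr n.+2) hw').
apply: comm_img (ses_h (rs_ses hr n.+1)) _ hyw => z hz.
exact: (proj2 (rs_ker hr n _) (ses_in (rs_ses hr n.+1) hz)).
Qed.
End Resolution.

Lemma Tor_zero_HV (X : lmodType C^c) n : @Tor_zero C X N n.+1 -> HV n (DX : LX ne X -> Prop).
Proof. by case=> P; exact: Tor_HV. Qed.

Lemma mval_hom : bhom (vmap (fun m : rk ne M => mval (m : M) : L) : LX ne M -> E).
Proof.
have ml : klin (fun m : rk ne M => mval (m : M) : L).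
  move=> c x y; transitivity (mval (x : M) * (c *: iv e) + mval (y : M)); first by [].
  by rewrite -scalerAr mvalE.
split=> [|a F|a F]; first exact: vmap_lin.
  by rewrite [RHS]opm_vmap //; exact: mul_linr.
by apply/ffunP => i; rewrite !ffunE.
Qed.

Lemma DE_DX_ses : ses (DX : LX ne M -> Prop) DE (vmap (fun m : rk ne M => mval (m : M) : L)).
Proof.
have mh := mval_hom; have ml : klin (fun m : rk ne M => mval (m : M) : L).
  move=> c x y; transitivity (mval (x : M) * (c *: iv e) + mval (y : M)); first by [].
  by rewrite -scalerAr mvalE.
split=> //.
- exact: sbm_DX.
- by apply: sbm_DE; exact: jA1.
- move=> F hF; split; first by rewrite opm_vmap ?hF //; exact: mul_linr.
  by rewrite vmap_comp; apply: vmap_ext => m; exact: mvalE.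
- move=> F [h1 h2]; exists (opm (fun v => iv e * v) ([ffun i => (mproj e (F i) : rk ne M)] : VT L (rk ne M))).
    exact: DX_opm.
  rewrite -opm_vmap //; last exact: mul_linr.
  by rewrite -[RHS]h1; congr opm; rewrite -[RHS]h2; apply/ffunP => i; rewrite !ffunE.
Qed.

Lemma HV_DE : (forall n, (0 < n)%N -> @Tor_zero C M N n) -> forall n, HV n DE.
Proof.
move=> hT n; apply: (HV_iso DE_DX_ses); last exact/Tor_zero_HV/hT.
move=> F _ /ffunP h; apply/ffunP => i; have := h i; rewrite !ffunE => hi.
exact: (@val_inj _ _ (peirce (idem1 L) e)).
Qed.

Local Notation f := (idemC e).
Hypothesis hMN : @tens_trivial C (peirce_right f e) (peirce_left e f).

(** Multiplication fLe x eLf -> L is balanced, so it vanishes with the tensor product. *)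
Lemma MN_zero x y : iv f * x * iv e * (iv e * y * iv f) = 0.
Proof.
have p1 : iv f * x * iv e \in peirce_pred f e.
  by rewrite unfold_in -[idem_val f]/(iv f) -[idem_val e]/(iv e) !mulrA ivP -!mulrA ivP.
have p2 : iv e * y * iv f \in peirce_pred e f.
  by rewrite unfold_in -[idem_val f]/(iv f) -[idem_val e]/(iv e) !mulrA ivP -!mulrA ivP.
have := @tens_zeroP C (peirce_right f e) (peirce_left e f) L (fun x => x = 0)
  (fun m n => peirce_val m * peirce_val n) [:: (Peirce p1, Peirce p2)].
rewrite !big_seq1 /=; apply=> //.
- by move=> ? ? -> ->; rewrite subr0.
- by move=> a b c; exact: mulrDl.
- by move=> a b c; exact: mulrDr.
- by move=> a b c; apply/eqP; rewrite subr_eq0; apply/eqP; exact/esym/mulrA.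
Qed.

(** Peirce decomposition of Le (x)_A eL. On eLe (x) eL and on fLe (x) eLe the factor in A can be
    moved across, so the product determines the tensor; the remaining part fLe (x) eLf is zero by
    [hMN]. *)
Lemma mulE_inj F : DE F -> mulE F = 0 -> comm DE F.
Proof.
have hD : sbm DE by apply: sbm_DE; exact: jA1.
have fE : iv f = 1 - iv e by [].
move=> hF; have [h1 h2] := hF; move=> m0.
pose a x : A := cproj ne x.
have aE x : jA (a x) = iv e * x * iv e by [].
have blp (r : A) v y : bl r (pur v y : E) = pur (jA r * v) y.
  exact: (opm_pur _ _ (@mul_linr _ L _)).
have brp (r : A) v y : br r (pur v y : E) = pur v (y * jA r).
  exact: (vmap_pur _ _ (@mul_linl _ L _)).
have inD v y : DE (pur (iv e * v) (y * iv e)).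
  split; first by rewrite opm_pur ?mulrA ?ivP //; exact: mul_linr.
  by rewrite vmap_pur -?mulrA ?ivP //; exact: mul_linl.
have inDe y : DE (pur (iv e) (y * iv e)) by have := inD (iv e) y; rewrite ivP.
have inDe' v : DE (pur (iv e * v) (iv e)) by have := inD v (iv e); rewrite ivP.
have Fe i : F i * iv e = F i by move/ffunP: h2 => /(_ i); rewrite ffunE.
have vl : klin (fun y : L => iv e * y) by exact: mul_linr.
have el : klin (fun y : L => iv f * y) by exact: mul_linr.
have -> : F = vmap (fun y => iv e * y) F + vmap (fun y => iv f * y) F.
  by apply/ffunP => i; rewrite !ffunE -mulrDl fE addrC subrK mul1r.
apply: commD.
- have -> : vmap (fun y => iv e * y) F = \sum_i pur (iv e * bs i) (jA (a (F i))).
    rewrite -[X in vmap _ X]h1 -opm_vmap //.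
    rewrite [X in opm _ X]VT_sum (klin_sum (opm_lin _)); apply: eq_bigr => i _.
    by rewrite opm_pur ?ffunE ?aE -?mulrA ?Fe //; exact: mul_linr.
  (* With the A-factors moved across, the sum collapses to e [mulE F] (x) e, which is zero. *)
  have e0 : \sum_i pur (jA (a (F i)) * (iv e * bs i)) (iv e) = 0 :> VT L L.
    rewrite -(klin_sum (pur_linl _)) (_ : \sum_i _ = iv e * mulE F).
      by rewrite m0 mulr0 (klin0 (pur_linl _)).
    rewrite /mulE /vlift mulr_sumr; apply: eq_bigr => i _.
    by rewrite aE -{2}(Fe i) -!mulrA [iv e * (iv e * _)]mulrA ivP.
  rewrite (_ : \sum_i _ = \sum_i (pur (iv e * bs i) (jA (a (F i))) -
    pur (jA (a (F i)) * (iv e * bs i)) (iv e) : E)); last by rewrite sumrB e0 subr0.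
  apply: comm_sum => i; have := commC (a (F i)) hD (inDe' (bs i)); rewrite blp brp.
  by rewrite jA_l.
set G := vmap (fun y => iv f * y) F.
have GE i : G i = iv f * F i by rewrite ffunE.
have hG : opm (fun x => iv e * x) G = G by rewrite opm_vmap ?h1.
have -> : G = opm (fun x => iv e * x * iv e) G + opm (fun x => iv e * x * iv f) G.
  rewrite -{1}hG /opm /vlift -big_split /=; apply: eq_bigr => i _.
  by rewrite -(klinD (pur_linl _)) -mulrDr [iv e + _]addrC -fE fE subrK mulr1.
apply: commD.
- have -> : opm (fun x => iv e * x * iv e) G = \sum_i pur (jA (a (bs i))) (G i).
    by [].
  have e0 : \sum_i pur (iv e) (G i * jA (a (bs i))) = 0 :> VT L L.
    rewrite -(klin_sum (pur_linr _)) (_ : \sum_i _ = iv f * mulE F * iv e).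
      by rewrite m0 mulr0 mul0r (klin0 (pur_linr _)).
    rewrite /mulE /vlift mulr_sumr mulr_suml; apply: eq_bigr => i _.
    by rewrite GE aE !mulrA -[_ * F i * iv e]mulrA Fe.
  rewrite (_ : \sum_i _ = \sum_i (pur (jA (a (bs i))) (G i) -
    pur (iv e) (G i * jA (a (bs i))) : E)); last by rewrite sumrB e0 subr0.
  apply: comm_sum => i.
  have hy : G i = G i * iv e by rewrite GE -mulrA Fe.
  have := @comm1 _ _ E DE (a (bs i)) _ (inDe (G i)); rewrite blp brp -hy.
  by rewrite jA_r.
pose t (x : peirce_right f e) (n : peirce_left e f) : E := pur (peirce_val n : L) (peirce_val x : L).
have p1 i : iv f * F i \in peirce_pred f e.
  by rewrite unfold_in -[idem_val f]/(iv f) -[idem_val e]/(iv e) !mulrA ivP -!mulrA Fe.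
have p2 i : iv e * bs i * iv f \in peirce_pred e f.
  by rewrite unfold_in -[idem_val f]/(iv f) -[idem_val e]/(iv e) !mulrA ivP -!mulrA ivP.
have -> : opm (fun x => iv e * x * iv f) G =
    \sum_(p <- [seq ((Peirce (p1 i) : peirce_right f e), (Peirce (p2 i) : peirce_left e f)) | i : ix L]) t p.1 p.2.
  rewrite big_map big_enum; apply: eq_bigr => i _; by rewrite /t GE.
apply: (@tens_zeroP C _ _ E (comm DE) t); last exact: hMN.
- exact: comm0.
- by move=> x y; apply: commB.
- by move=> x x' y; exact: (klinD (pur_linr _)).
- by move=> x y y'; exact: (klinD (pur_linl _)).
- move=> r x y.
  have -> : t ((r : C^c) *: x) y = br (r : A) (t x y) by rewrite brp.
  have -> : t x (r *: y) = bl (r : A) (t x y) by rewrite blp.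
  apply: commC => //; rewrite /t.
  rewrite -[peirce_val y](peirce_l (y : peirce e f)) -[peirce_val x](peirce_r (x : peirce f e)).
  exact: inD.
Qed.
End TorHV.

(** * Finiteness of Hochschild homology for both corners *)

Section CornerHH.
Variables (k : fieldType) (L : falgType k) (e : idem L) (ne : iv e != 0).
Local Notation C := (corner e).
Local Notation A := (cornerF ne).
Local Notation DX := (@eLX k L e ne _).
Local Notation DE := (@DE k L (cornerF ne) (iv e) (@cval k L e ne) (@cval_lin k L e ne) (@jAM k L e ne)).
Local Notation M := (peirce_right (idem1 L) e).
Local Notation N := (peirce_left e (idem1 L)).
Local Notation f := (idemC e).

Lemma HV_Tor (X : lmodType C^c) (P : proj_resolution X) n :
  HV n (DX : LX ne X -> Prop) -> tens_acyclic_at P N n.+1.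
Proof.
have hr := Tor_resol ne P.
have <- : (fun F => DX F /\ forall i, exists y, rmap P 0 y = (F : LX ne X) i) = DX.
  apply/funext => F; apply/propext; split=> [[]|h] //; split=> // i.
  by have [y hy] := res_aug_surj P (F i : X); exists y.
move=> /(dim_shift n hr) ti z; have [y hy <-] := Phi_sur ne z.
rewrite /= Phi_map => h0.
have hdy := ses_in (rs_ses hr n.+1) hy.
have cdy : comm DX (vmap (rmap P n.+1 : rk ne _ -> rk ne _) y).
  by apply: Phi_eq0 => //; case: hdy.
have cK := ti _ (proj2 (rs_ker hr n _) hdy) cdy.
have [c hc ec] := comm_lift (ses_h (rs_ses hr n.+1))
  (fun z hz => ses_sur (rs_ses hr n.+1) (proj1 (rs_ker hr n z) hz)) cK.
have hk : kerD DX (vmap (rmap P n.+1 : rk ne _ -> rk ne _) : LX ne (P n.+1) -> LX ne (P n)) (y - c : LX ne (P n.+1)).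
  split; last by rewrite (klinB (bh_lin (ses_h (rs_ses hr n.+1)))) ec subrr.
  apply: (sbmB (@sbm_DX k L e ne (P n.+1))) => //.
  by apply: comm_in hc; exact: sbm_DX.
have [w hw ew] := ses_sur (rs_ses hr n.+2) (proj1 (rs_ker hr n.+1 _) hk).
exists (Phi (w : LX ne (P n.+2))); rewrite Phi_map.
transitivity (Phi (y - c : LX ne (P n.+1))); first by rewrite -ew.
by rewrite PhiD PhiN (Phi_comm hc) subr0.
Qed.

Hypothesis hT : forall n, (0 < n)%N -> @Tor_zero C M N n.
Hypothesis hMN : @tens_trivial C (peirce_right f e) (peirce_left e f).

(** The hypothesis gives a resolution for each degree separately. As [HV] does not depend on the
    resolution, passing through it yields a single one that is acyclic in all positive degrees. *)
Lemma Tor_free_res n : (0 < n)%N -> tens_acyclic_at (free_res (M : lmodType C^c)) N n.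
Proof. by case: n => // n _; apply: HV_Tor; apply/Tor_zero_HV/hT. Qed.

(** [mulE_inj] for formal tensors: commutators of eL (x) Le lift to eL (x) M, and [Phi] kills them
    there. *)
Lemma tens_MN_inj (s : seq (M * N)) : \sum_(p <- s) mval p.1 * nval p.2 = 0 ->
  \sum_(p <- s) pure _ _ p.1 p.2 = 0 :> tens M N.
Proof.
move=> h0; pose G : LX ne M := \sum_(p <- s) pur (nval p.2) (p.1 : rk ne M).
have hDX := @sbm_DX k L e ne M.
have hG : DX G.
  apply: (@sbm_sum _ A (LX ne M) (eLX (ne := ne) (X := M)) _ s
    (fun p => pur (nval p.2) (p.1 : rk ne M)) hDX) => p.
  by rewrite -nvalE; apply: DX_pur.
have -> : \sum_(p <- s) pure _ _ p.1 p.2 = Phi G :> tens M N.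
  rewrite /G (big_morph (@Phi k L e ne M) (@PhiD k L e ne M) (@Phi0 k L e ne M)).
  by apply: eq_bigr => p _; rewrite Phi_pur nvalK.
have ml : klin (fun m : rk ne M => mval (m : M) : L).
  move=> c x y; transitivity (mval (x : M) * (c *: iv e) + mval (y : M)); first by [].
  by rewrite -scalerAr mvalE.
have hs := DE_DX_ses ne.
have cF : comm DE (vmap (fun m : rk ne M => mval (m : M) : L) G).
  have hE := ses_in hs hG.
  apply: (mulE_inj hMN hE).
  rewrite /G (klin_sum (vmap_lin ml)) (klin_sum (@mulE_lin k L)) -[RHS]h0.
  by apply: eq_bigr => p _; rewrite vmap_pur // mulE_pur.
have [G' hG' eG] := comm_lift (ses_h hs) (ses_sur hs) cF.
suff -> : G = G' by exact: Phi_comm.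
apply/ffunP => i; have /ffunP /(_ i) := eG; rewrite !ffunE => h.
exact/esym/(@val_inj _ _ (peirce (idem1 L) e)).
Qed.

Hypothesis nf : iv f != 0.

Lemma HH_corners : HH_finite L -> HH_finite (cornerF ne) /\ HH_finite (cornerF nf).
Proof.
have fE : iv f = 1 - iv e by [].
have MN x y : iv f * x * iv e * y * iv f = 0.
  by have := MN_zero hMN x y; rewrite !mulrA -[_ * iv e * iv e]mulrA ivP.
pose ps := @cproj k L f nf; pose jB := @cval k L f nf.
have psM x y : ps (x * y) = ps x * ps y.
  apply: (@val_inj _ _ (peirce f f)).
  transitivity (iv f * x * y * iv f); first by rewrite -[LHS]/(iv f * (x * y) * iv f) !mulrA.
  transitivity (iv f * x * iv f * (iv f * y * iv f)); last by [].
  rewrite !mulrA -[_ * iv f * iv f]mulrA ivP.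
  (* The difference f x y f - f x f y f is f x e y f, which is zero by [MN]. *)
  apply/eqP; rewrite -subr_eq0 -mulrBl -mulrBl -[X in X - _]mulr1 -mulrBr.
  by rewrite fE subKr -fE MN.
have ps1 : ps 1 = 1.
  by apply: (@val_inj _ _ (peirce f f)); transitivity (iv f * 1 * iv f); rewrite // mulr1 ivP.
have ps_ker x : ps x = 0 <-> (1 - iv e) * x * (1 - iv e) = 0.
  split=> [h|h]; last by apply: (@val_inj _ _ (peirce f f)).
  by rewrite -fE -[LHS]/(cval (ps x)) h.
case=> m hm.
(* [HV n] concerns degree n + 1, so vanishing above degree m is [HV] from m on. *)
have hHV n : (m <= n)%N -> HV n (fun _ : regb L => True).
  by move=> hn; apply/HH_regb; apply: hm.
have [hA hB] := @HV_corners k L (cornerF ne) (cornerF nf) (iv e) (@cval k L e ne) (@cproj k L e ne) ps jB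
  (ivP e) (@cval_lin k L e ne) (@jAM k L e ne) (@jA1 k L e ne) (@cproj_lin k L e ne) (@jpA k L e ne)
  (@cvalK k L e ne) (@cproj_lin k L f nf) psM ps1 (@cval_lin k L f nf) (@jAM k L f nf)
  (@cvalK k L f nf) ps_ker (mulE_inj hMN) (HV_DE (ne := ne) hT) m hHV.
by split; exists m; case=> // n hn; apply/HH_regb; [apply: hA|apply: hB].
Qed.
End CornerHH.

(** * Projective dimension *)

Section ProjDim.
Variable S : pzRingType.
Implicit Types X Y Z W P E : lmodType S.

Lemma lin_factor X Y W (i : {linear X -> Y}) (f : {linear W -> Y}) : injective i ->
  (forall w, exists x, i x = f w) -> exists h : {linear W -> X}, forall w, i (h w) = f w.
Proof.
move=> ii /choice [h hh].
have hl : GRing.linear_for *:%R h by move=> a x y; apply: ii; rewrite linearP !hh linearP.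
by exists (mklin hl).
Qed.

Lemma proj_retract X E (i : {linear X -> E}) (r : {linear E -> X}) :
  cancel i r -> projective E -> projective X.
Proof.
move=> ir hE A B q f hq; have [h hh] := hE _ _ q (f \o r : {linear E -> B}) hq.
by exists (h \o i : {linear X -> A}) => p; rewrite /= hh /= ir.
Qed.

Lemma plus_lin X Y Z (a : {linear X -> Z}) (b : {linear Y -> Z}) :
  GRing.linear_for *:%R (fun p : X * Y => a p.1 + b p.2).
Proof. by move=> c x y; rewrite !linearP /= scalerDr addrACA. Qed.
Lemma pair_lin X Y Z (a : {linear Z -> X}) (b : {linear Z -> Y}) :
  GRing.linear_for *:%R (fun z => (a z, b z)).
Proof. by move=> c x y; rewrite !linearP. Qed.
Lemma sub_lin X Y (a b : {linear X -> Y}) : GRing.linear_for *:%R (fun x => a x - b x).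
Proof. by move=> c x y; rewrite !linearP scalerDr addrACA. Qed.

Lemma proj_prod X Y : projective X -> projective Y -> projective (X * Y)%type.
Proof.
move=> hX hY A B q f hq.
have l1 : GRing.linear_for *:%R (fun x : X => (x, 0) : X * Y).
  by move=> c x y; congr (_, _); rewrite /= scaler0 addr0.
have l2 : GRing.linear_for *:%R (fun y : Y => (0, y) : X * Y).
  by move=> c x y; congr (_, _); rewrite /= scaler0 addr0.
have [h hh] := hX _ _ q (f \o mklin l1 : {linear X -> B}) hq.
have [h' hh'] := hY _ _ q (f \o mklin l2 : {linear Y -> B}) hq.
exists (mklin (plus_lin h h')) => -[x y]; rewrite /= linearD hh hh' /= -linearD.
by congr (f _); congr (_, _); rewrite /= ?addr0 ?add0r.
Qed.

Definition lses X Y Z (i : {linear X -> Y}) (g : {linear Y -> Z}) : Prop :=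
  [/\ injective i, forall z, exists y, g y = z & forall y, g y = 0 <-> exists x, i x = y].

(** Projective dimension at most n, through the existence of one good cover. Independence of the
    cover is not built in, so the closure properties below are proved by induction with explicit
    covers. *)
Fixpoint pdle (n : nat) (X : lmodType S) : Prop :=
  if n is n'.+1 then exists (P : lmodType S) (g : {linear P -> X}),
    [/\ projective P, forall x, exists y, g y = x & pdle n' (kmod g)]
  else projective X.

Lemma kval_inj X Y (g : {linear X -> Y}) : injective (kincl g).
Proof. exact: val_inj. Qed.

Lemma lift_ker X Y W (g : {linear X -> Y}) (f : {linear W -> X}) :
  (forall w, g (f w) = 0) -> exists h : {linear W -> kmod g}, forall w, kval (h w) = f w.
Proof. by move=> h; apply: (lin_factor (@kval_inj _ _ g)) => w; apply: ker_mem. Qed.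

Lemma kmod_ses X Y (g : {linear X -> Y}) : (forall y, exists x, g x = y) -> lses (kincl g) g.
Proof.
move=> hg; split=> // [|y]; first exact: kval_inj.
by split=> [/ker_mem //|[x <-]]; exact: kvalE.
Qed.

(* If [P -> E] has kernel [K] and [X] is a retract of [E], then the kernel of
   [P -> E -> X] is a retract of [K * P]. *)
Lemma pdle_retract_prod n :
  (forall X E (i : {linear X -> E}) (r : {linear E -> X}), cancel i r -> pdle n E -> pdle n X) /\
  (forall X P, projective P -> pdle n X -> pdle n (X * P)%type).
Proof.
elim: n => [|n [IHr IHp]].
  by split=> [X E i r|X P hP hX]; [exact: proj_retract|exact: proj_prod].
split=> [X E i r ir|X Q hQ] [P [g [hP gs hk]]].
  have hs : forall x, exists p, (r \o g : {linear P -> X}) p = x.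
    by move=> x; have [p hp] := gs (i x); exists p; rewrite /= hp ir.
  exists P, (r \o g : {linear P -> X}); split=> //.
  have [a ha] := hP _ _ g (i \o r \o g : {linear P -> E}) gs.
  have [|u hu] := @lift_ker _ _ _ g (a \o kincl (r \o g : {linear P -> X}) : {linear kmod (r \o g : {linear P -> X}) -> P}).
    by move=> w; rewrite /= ha /= [r _](kvalE w) linear0.
  have [|v hv] := @lift_ker _ _ _ (r \o g : {linear P -> X})
    (mklin (plus_lin (kincl g) (mklin (sub_lin (idfun : {linear P -> P}) a)))).
    by move=> [x p] /=; rewrite linearD linearB /= kvalE add0r ha /= linearB ir subrr.
  apply: (IHr _ _ (mklin (pair_lin u (kincl (r \o g : {linear P -> X})))) v) (IHp _ _ hP hk).
  by move=> w; apply: val_inj; rewrite [LHS]hv /= [kval _]hu /= addrC subrK.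
have gl : GRing.linear_for *:%R (fun p : P * Q => (g p.1, p.2)) by move=> c x y; rewrite linearP.
exists (P * Q)%type, (mklin gl); split; first exact: proj_prod.
  by move=> [x p]; have [y hy] := gs x; exists (y, p); rewrite /= hy.
have fl : GRing.linear_for *:%R (@fst P Q) by [].
have sl : GRing.linear_for *:%R (fun y : P => (y, 0) : P * Q).
  by move=> c x y; congr (_, _); rewrite /= scaler0 addr0.
have [|u hu] := @lift_ker _ _ _ g (mklin fl \o kincl (mklin gl) : {linear kmod (mklin gl) -> P}).
  by move=> w; have /(congr1 fst) := kvalE w.
have [|v hv] := @lift_ker _ _ _ (mklin gl) (mklin sl \o kincl g : {linear kmod g -> (P * Q)%type}).
  by move=> w; rewrite /= kvalE.
apply: (IHr _ _ u v) hk => w; apply: val_inj; rewrite [LHS]hv /= [kval _]hu /=.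
by have /(congr1 snd) /= := kvalE w; case: (kval w) => x y /= ->.
Qed.

Lemma pdle_retract n X E (i : {linear X -> E}) (r : {linear E -> X}) :
  cancel i r -> pdle n E -> pdle n X.
Proof. exact: (proj1 (pdle_retract_prod n)). Qed.

Lemma pdle_iso n X Y (i : {linear X -> Y}) : injective i -> (forall y, exists x, i x = y) ->
  pdle n X <-> pdle n Y.
Proof.
move=> ii hi; have [j hj] := lin_factor (f := idfun : {linear Y -> Y}) ii hi.
have jK : cancel i j by move=> x; apply: ii; rewrite hj.
by split; [apply: (pdle_retract (i := j) (r := i)) => x; exact: hj|exact: pdle_retract jK].
Qed.

Lemma pdle_zero n X : (forall x : X, x = 0) -> pdle n X.
Proof.
elim: n X => [|n IH] X hX.
  move=> A B q f hq; have l : GRing.linear_for *:%R (fun _ : X => 0 : A).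
    by move=> c x y; rewrite scaler0 addr0.
  by exists (mklin l) => p; rewrite (hX p) /= !linear0.
have hid : projective X.
  move=> A B q f hq; have l : GRing.linear_for *:%R (fun _ : X => 0 : A).
    by move=> c x y; rewrite scaler0 addr0.
  by exists (mklin l) => p; rewrite (hX p) /= !linear0.
exists X, (idfun : {linear X -> X}); split=> // [x|]; first by exists x.
by apply: IH => x; apply: val_inj; rewrite /= [LHS](hX _) [RHS](hX _).
Qed.

Lemma pdleS n X : pdle n X -> pdle n.+1 X.
Proof.
elim: n X => [|n IH] X.
  move=> hX; exists X, (idfun : {linear X -> X}); split=> // [x|]; first by exists x.
  by apply: pdle_zero => x; apply: val_inj; exact: (kvalE x).
by case=> [P [g [hP gs /IH hk]]]; exists P, g.
Qed.
Lemma pdle_le m n X : (m <= n)%N -> pdle m X -> pdle n X.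
Proof. by move=> /subnK <-; elim: (n - m)%N => // d IH /IH /pdleS. Qed.

(** Horseshoe lemma: P x Q covers Y by i p + s, where s lifts q along g, and the kernels again form
    a short exact sequence. *)
Lemma pdle_ext n X Y Z (i : {linear X -> Y}) (g : {linear Y -> Z}) : lses i g ->
  pdle n X -> pdle n Z -> pdle n Y.
Proof.
elim: n X Y Z i g => [|n IH] X Y Z i g [ii gs hk].
  move=> hX hZ A B q f hq.
  have [s hs] := hZ _ _ g (idfun : {linear Z -> Z}) gs.
  have [a ha] := hX _ _ q (f \o i : {linear X -> B}) hq.
  have [b hb] := hZ _ _ q (f \o s : {linear Z -> B}) hq.
  have [|j hj] := lin_factor (f := mklin (sub_lin (idfun : {linear Y -> Y}) (s \o g : {linear Y -> Y}))) ii.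
    by move=> y; apply/hk; rewrite /= linearB hs /= subrr.
  exists (mklin (plus_lin a (b \o g : {linear Y -> A})) \o mklin (pair_lin j (idfun : {linear Y -> Y})) : {linear Y -> A}).
  by move=> y; rewrite /= linearD ha hb /= hj /= -linearD subrK.
case=> [P [p [hP ps hK]]] [Q [q [hQ qs hL]]].
have [s hs] := hQ _ _ g q gs.
pose h := mklin (plus_lin (i \o p : {linear P -> Y}) s).
exists (P * Q)%type, h; split; first exact: proj_prod.
  move=> y; have [w hw] := qs (g y).
  have /hk [x hx] : g (y - s w) = 0 by rewrite linearB hs hw subrr.
  by have [z hz] := ps x; exists (z, w); rewrite /= hz hx subrK.
have gi x : g (i x) = 0 by apply/hk; exists x.
have sl : GRing.linear_for *:%R (fun y : P => (y, 0) : P * Q).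
  by move=> c x y; congr (_, _); rewrite /= scaler0 addr0.
have tl : GRing.linear_for *:%R (@snd P Q) by [].
have [|u hu] := @lift_ker _ _ _ h (mklin sl \o kincl p : {linear kmod p -> (P * Q)%type}).
  by move=> w; rewrite /= kvalE !linear0 addr0.
have [|v hv] := @lift_ker _ _ _ q (mklin tl \o kincl h : {linear kmod h -> Q}).
  by move=> w; rewrite /= -hs; have /(congr1 g) := kvalE w; rewrite /= linearD gi add0r linear0.
apply: (IH _ _ _ u v _ hK hL); split.
- move=> x y e; apply: val_inj; have := congr1 (fun z => (kval z).1) e.
  by rewrite /= !hu.
- move=> w; have /hk [x hx] : g (s (kval w)) = 0 by rewrite hs kvalE.
  have [z hz] := ps (- x).
  have [|y hy] := @ker_mem _ _ _ h (z, kval w); first by rewrite /= hz linearN hx addNr.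
  by exists y; apply: val_inj; rewrite /= [LHS]hv /= hy.
- move=> y; split=> [e|[x <-]]; last by apply: val_inj; rewrite /= [LHS]hv /= hu.
  have e2 : (kval y).2 = 0 by have := congr1 (@kval _ _ _ q) e; rewrite hv.
  have [|x hx] := @ker_mem _ _ _ p (kval y).1.
    apply: ii; have := kvalE y; by rewrite /= e2 !linear0 addr0.
  by exists x; apply: val_inj; rewrite /= [LHS]hu /= hx -e2; case: (kval y).
Qed.

(** If p covers Y, the kernel of g p is an extension of X by the kernel of p. *)
Lemma pdle_quot n X Y Z (i : {linear X -> Y}) (g : {linear Y -> Z}) : lses i g ->
  pdle n X -> pdle n.+1 Y -> pdle n.+1 Z.
Proof.
move=> [ii gs hk] hX [P [p [hP ps hK]]].
have hs : forall z, exists x, (g \o p : {linear P -> Z}) x = z.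
  by move=> z; have [y <-] := gs z; have [x <-] := ps y; exists x.
exists P, (g \o p : {linear P -> Z}); split=> //.
have [|u hu] := @lift_ker _ _ _ (g \o p : {linear P -> Z}) (kincl p).
  by move=> w; rewrite /= kvalE linear0.
have [|v hv] := lin_factor (f := p \o kincl (g \o p : {linear P -> Z}) : {linear kmod (g \o p : {linear P -> Z}) -> Y}) ii.
  by move=> w; apply/hk; exact: (kvalE w).
apply: (@pdle_ext _ _ _ _ u v) hK hX; split.
- move=> x y e; apply: val_inj; have := congr1 (@kval _ _ _ _) e; by rewrite !hu.
- move=> x; have [y hy] := ps (i x).
  have [|w hw] := @ker_mem _ _ _ (g \o p : {linear P -> Z}) y.
    by rewrite /= hy; apply/hk; exists x.
  by exists w; apply: ii; rewrite hv /= hw.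
- move=> y; split=> [e|[x <-]]; last by apply: ii; rewrite hv /= hu linear0 /= kvalE.
  have [|x hx] := @ker_mem _ _ _ p (kval y); first by have := hv y; rewrite e linear0.
  by exists x; apply: val_inj; rewrite /= [LHS]hu.
Qed.

End ProjDim.

Section GlobalDim.
Variable S : pzRingType.
Implicit Types X M : lmodType S.

Lemma shift_aug M (P : proj_resolution M) :
  exists a : {linear P 1%N -> kmod (res_aug P)}, forall x, kval (a x) = res_diff P 0 x.
Proof. by apply: lift_ker => w; apply/res_exact0; exists w. Qed.

Lemma resolution_pdle d M (P : proj_resolution M) :
  (forall n, (d < n)%N -> forall x : P n, x = 0) -> pdle d M.
Proof.
elim: d M P => [|d IH] M P hP.
  have ii : injective (res_aug P).
    move=> x y e; apply/eqP; rewrite -subr_eq0; apply/eqP.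
    have /res_exact0 [z <-] : res_aug P (x - y) = 0 by rewrite linearB e subrr.
    by rewrite (hP 1%N isT z) linear0.
  exact: (proj1 (pdle_iso 0 ii (@res_aug_surj _ _ P)) (@res_proj _ _ P 0)).
exists (P 0%N), (res_aug P); split; [exact: res_proj|exact: res_aug_surj|].
have [a ha] := shift_aug P.
have h1 m : exists x, a x = m.
  have /(res_exact0 (p:=P)) [x hx] := kvalE m; exists x; apply: val_inj; exact: etrans (ha x) hx.
have h2 x : a x = 0 <-> exists y, res_diff P 1 y = x.
  split=> [h|/res_exact h]; first by apply/res_exact; rewrite -ha h.
  by apply: val_inj; exact: etrans (ha x) h.
refine (IH _ (@ProjResolution S _ (fun n => P n.+1) (fun n => res_diff P n.+1) a
  (fun n => @res_proj _ _ P n.+1) h1 h2 (fun n => @res_exact _ _ P n.+1)) _) => n hn.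
exact: (hP n.+1 hn).
Qed.

Section Splice.
Variables (M Q : lmodType S) (g : {linear Q -> M}) (hQ : projective Q)
  (gs : forall x, exists y, g y = x) (P : proj_resolution (kmod g)).

Definition splice_obj (n : nat) : lmodType S := if n is n'.+1 then P n' else Q.
Definition splice_diff (n : nat) : {linear splice_obj n.+1 -> splice_obj n} :=
  match n return {linear splice_obj n.+1 -> splice_obj n} with
  | 0 => kincl g \o res_aug P
  | n'.+1 => res_diff P n'
  end.
Lemma splice_proj n : projective (splice_obj n).
Proof. by case: n => // n; exact: res_proj. Qed.
Lemma splice_exact0 x : g x = 0 <-> exists y, splice_diff 0 y = x.
Proof.
split=> [/ker_mem [y <-]|[y <-]]; last exact: kvalE.
by have [z <-] := res_aug_surj P y; exists z.
Qed.
Lemma splice_exact n x : splice_diff n x = 0 <-> exists y, splice_diff n.+1 y = x.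
Proof.
case: n x => [|n] x; last exact: res_exact.
split=> [h|/res_exact0 h]; last by rewrite /= h.
by apply/res_exact0; apply: val_inj.
Qed.
Definition splice : proj_resolution M :=
  ProjResolution splice_proj gs splice_exact0 splice_exact.
End Splice.

(** Resolutions are indexed by all of nat, so a finite one has to be continued by zero modules. *)
Lemma zero_resolution M : (forall x : M, x = 0) ->
  exists P : proj_resolution M, forall n (x : P n), x = 0.
Proof.
move=> hM; have pM : projective M := pdle_zero 0 hM.
exists (@ProjResolution S M (fun _ => M) (fun _ => idfun) idfun (fun _ => pM)
  (fun m => ex_intro _ m erefl) (fun x => conj (fun _ => ex_intro _ x erefl) (fun _ => hM _))
  (fun _ x => conj (fun _ => ex_intro _ x erefl) (fun _ => hM _))).
by move=> n x; exact: hM.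
Qed.

Lemma pdle_resolution d M : pdle d M ->
  exists P : proj_resolution M, forall n, (d < n)%N -> forall x : P n, x = 0.
Proof.
elim: d M => [|d IH] M.
  move=> hM; have hs (x : M) : exists y, (idfun : {linear M -> M}) y = x by exists x.
  have [|P hP] := @zero_resolution (kmod (idfun : {linear M -> M})).
    by move=> x; apply: val_inj; exact: (kvalE x).
  by exists (splice hM hs P) => -[|n] // _ x; exact: hP.
case=> [Q [g [hQ gs /IH [P hP]]]].
by exists (splice hQ gs P) => -[|n] //; rewrite ltnS => hn x; exact: hP.
Qed.

Lemma finite_gldimP : finite_gldim S <-> exists d, forall M : lmodType S, pdle d M.
Proof.
split=> -[d h]; exists d => M; last exact: pdle_resolution.
by have [P hP] := h M; apply: resolution_pdle hP.
Qed.
End GlobalDim.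

(** * Balancing Tor *)

Section TensorLemmas.
Variable C : pzRingType.
Implicit Types (X Y : lmodType C^c) (V W : lmodType C).

Local Notation pr X V := (@pure C X V (fun (a : C) (x : X) => (a : C^c) *: x) (fun (a : C) (y : V) => a *: y) : X -> V -> tens X V).
Local Notation bal X V f := (@balanced C X V (fun (a : C) (x : X) => (a : C^c) *: x) (fun (a : C) (y : V) => a *: y) _ f).

Definition ptens X V (x : X) (v : V) : tens X V := pure _ _ x v.
Lemma ptens_bal X V : bal X V (@ptens X V).
Proof. exact: pure_balanced. Qed.
Lemma ptensDl X V x x' (v : V) : ptens (x + x' : X) v = ptens x v + ptens x' v.
Proof. exact: (balDl (ptens_bal X V)). Qed.
Lemma ptensDr X V x (v v' : V) : ptens (x : X) (v + v') = ptens x v + ptens x v'.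
Proof. exact: (balDr (ptens_bal X V)). Qed.
Lemma ptensZ X V (c : C) x (v : V) : ptens ((c : C^c) *: x : X) v = ptens x (c *: v).
Proof. exact: (balZ (ptens_bal X V)). Qed.
Lemma ptens0l X V (v : V) : ptens (0 : X) v = 0.
Proof. exact: (bal0l _ (ptens_bal X V)). Qed.
Lemma ptens0r X V (x : X) : ptens x (0 : V) = 0.
Proof. exact: (bal0r _ (ptens_bal X V)). Qed.

Lemma tens_ind X V (Q : tens X V -> Prop) : Q 0 -> (forall t u, Q t -> Q u -> Q (t + u)) ->
  (forall x v, Q (ptens x v)) -> forall t, Q t.
Proof.
move=> Q0 QD Qp t; have [s ->] := tens_sumP t.
by elim: s => [|p s IH]; rewrite ?big_nil ?big_cons //; apply: QD => //; exact: Qp.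
Qed.

Definition tlift X V (Z : zmodType) (f : X -> V -> Z) (t : tens X V) : Z := tens_lift f t.

Section Lift.
Variables (X : lmodType C^c) (V : lmodType C) (Z : zmodType) (f : X -> V -> Z).
Hypothesis fb : bal X V f.
Lemma tliftD t u : tlift f (t + u) = tlift f t + tlift f u. Proof. exact: (tens_liftD fb). Qed.
Lemma tlift0 : tlift f 0 = 0. Proof. exact: (tens_lift_zero fb). Qed.
Lemma tliftE x v : tlift f (ptens x v) = f x v. Proof. exact: (tens_liftE x v fb). Qed.
Lemma tliftN t : tlift f (- t) = - tlift f t.
Proof. by apply: (addIr (tlift f t)); rewrite -tliftD !addNr tlift0. Qed.
Lemma tliftB t u : tlift f (t - u) = tlift f t - tlift f u. Proof. by rewrite tliftD tliftN. Qed.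
Lemma tlift_sum (I : Type) (s : seq I) (F : I -> tens X V) :
  tlift f (\sum_(i <- s) F i) = \sum_(i <- s) tlift f (F i).
Proof. exact: (big_morph _ tliftD tlift0). Qed.
End Lift.

Definition tmap X Y (g : X -> Y) V W (h : V -> W) : tens X V -> tens Y W :=
  tlift (fun x v => ptens (g x) (h v)).
End TensorLemmas.

Section TensorMap.
Variable C : pzRingType.
Implicit Types (X Y Z : lmodType C^c) (U V W : lmodType C).
Local Notation bal X V f := (@balanced C X V (fun (a : C) (x : X) => (a : C^c) *: x) (fun (a : C) (y : V) => a *: y) _ f).

Lemma tmap_bal X Y (g : {linear X -> Y}) V W (h : {linear V -> W}) :
  bal X V (fun x v => ptens (g x) (h v)).
Proof.
split=> [x x' v|x v v'|c x v].
- by rewrite linearD ptensDl.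
- by rewrite linearD ptensDr.
- have -> : g ((c : C^c) *: x) = (c : C^c) *: g x by exact: linearZ.
  by rewrite ptensZ; have -> : h (c *: v) = c *: h v by exact: linearZ.
Qed.
Section One.
Variables (X Y : lmodType C^c) (g : {linear X -> Y}) (V W : lmodType C) (h : {linear V -> W}).
Lemma tmapD t u : tmap g h (t + u) = tmap g h t + tmap g h u.
Proof. exact: (tliftD (tmap_bal g h)). Qed.
Lemma tmap0 : tmap g h 0 = 0. Proof. exact: (tlift0 (tmap_bal g h)). Qed.
Lemma tmapE x v : tmap g h (ptens x v) = ptens (g x) (h v).
Proof. exact: (tliftE (tmap_bal g h)). Qed.
Lemma tmapB t u : tmap g h (t - u) = tmap g h t - tmap g h u.
Proof. exact: (tliftB (tmap_bal g h)). Qed.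
Lemma tmap_sum (I : Type) (s : seq I) (F : I -> tens X V) :
  tmap g h (\sum_(i <- s) F i) = \sum_(i <- s) tmap g h (F i).
Proof. exact: (tlift_sum (tmap_bal g h)). Qed.
End One.

Lemma tmap_comp X Y Z (g : {linear X -> Y}) (g' : {linear Y -> Z}) (g2 : {linear X -> Z})
    U V W (h : {linear U -> V}) (h' : {linear V -> W}) (h2 : {linear U -> W}) t :
  (forall x, g2 x = g' (g x)) -> (forall u, h2 u = h' (h u)) ->
  tmap g' h' (tmap g h t) = tmap g2 h2 t.
Proof.
move=> eg eh; elim/tens_ind: t => [|t u IH IH'|x v]; first by rewrite !tmap0.
  by rewrite !tmapD IH IH'.
by rewrite !tmapE eg eh.
Qed.

Lemma tmap_id X V (g : {linear X -> X}) (h : {linear V -> V}) t :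
  (forall x, g x = x) -> (forall v, h v = v) -> tmap g h t = t.
Proof.
move=> eg eh; elim/tens_ind: t => [|t u IH IH'|x v]; first by rewrite !tmap0.
  by rewrite !tmapD IH IH'.
by rewrite !tmapE eg eh.
Qed.

Lemma tmap_sur X Y (g : {linear X -> Y}) V W (h : {linear V -> W}) :
  (forall y, exists x, g x = y) -> (forall w, exists v, h v = w) ->
  forall t, exists u, tmap g h u = t.
Proof.
move=> gs hs t; elim/tens_ind: t => [|t u [t' <-] [u' <-]|x v].
- by exists 0; rewrite tmap0.
- by exists (t' + u'); rewrite tmapD.
- by have [y <-] := gs x; have [w <-] := hs v; exists (ptens y w); rewrite tmapE.
Qed.

(* A dual basis of the projective module [V] splits any tensor over [V]. *)
Lemma proj_coords V : projective V -> exists c : V -> forall X, tens X V -> X,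
  [/\ forall j X (t u : tens X V), c j X (t + u) = c j X t + c j X u,
      forall j X Y (g : {linear X -> Y}) t, c j Y (tmap g (@idfun V) t) = g (c j X t)
    & forall X (t : tens X V), exists s : seq V, t = \sum_(j <- s) ptens (c j X t) j].
Proof.
move=> hV; have [s hs] := hV _ _ (fcov V) (idfun : {linear V -> V}) (@fcov_surj _ V).
pose f j (X : lmodType C^c) (x : X) (v : V) : X := (fm_co C j (s v) : C^c) *: x.
have fb j X : bal X V (@f j X).
  split=> [x x' v|x v v'|c x v]; rewrite /f.
  - exact: scalerDr.
  - by rewrite !linearD; exact: scalerDl.
  - rewrite scalerA; congr (_ *: _); rewrite linearZ.
    by have -> : fm_co C j (c *: s v) = c * fm_co C j (s v) by exact: linearZ.
exists (fun j X => tlift (@f j X)); split=> [j X|j X Y g t|X t].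
- exact: tliftD (fb j X).
- elim/tens_ind: t => [|t u IH IH'|x v]; first by rewrite tmap0 !tlift0 // linear0.
    by rewrite tmapD !tliftD // IH IH' linearD.
  by rewrite tmapE !tliftE // /f linearZ.
have aux (S : seq V) : uniq S -> forall l : seq (X * V), t = \sum_(p <- l) ptens p.1 p.2 ->
    (forall p, p \in l -> forall j, j \notin S -> fm_co C j (s p.2) = 0) ->
    t = \sum_(j <- S) ptens (tlift (@f j X) t) j.
  move=> uS l -> hl.
  transitivity (\sum_(p <- l) \sum_(j <- S) ptens (f j X p.1 p.2) j).
    rewrite [LHS]big_seq [RHS]big_seq; apply: eq_bigr => p pl.
    rewrite -[p.2 in LHS]/(idfun p.2) -hs [s _](fm_co_sum uS (hl p pl)) linear_sum.
    have p0 : ptens p.1 (0 : V) = 0 by exact: ptens0r.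
    rewrite (big_morph _ (fun v v' => ptensDr p.1 v v') p0); apply: eq_bigr => j _.
    by rewrite linearZ /= fm_lift_gen /f ptensZ.
  rewrite exchange_big; apply: eq_bigr => j _.
  rewrite (tlift_sum (fb j X)) (big_morph _ (fun x x' => ptensDl x x' j) (ptens0l _ j)).
  by apply: eq_bigr => p _; rewrite tliftE.
have [l hl] := tens_sumP t.
exists (undup (flatten [seq [seq q.2 | q <- fm_rep (s p.2)] | p <- l])).
apply: (aux _ (undup_uniq _) l hl) => p pl j; rewrite mem_undup => hj.
apply: fm_co_fin; apply: contra hj => hj; apply/flattenP; exists [seq q.2 | q <- fm_rep (s p.2)] => //.
by apply/mapP; exists p.
Qed.

Lemma proj_exact X Y Z (g : {linear X -> Y}) (h : {linear Y -> Z}) V : projective V ->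
  (forall y, h y = 0 -> exists x, g x = y) ->
  forall t : tens Y V, tmap h (@idfun V) t = 0 -> exists u : tens X V, tmap g (@idfun V) u = t.
Proof.
move=> hV gh t t0; have [c [cD cn cs]] := proj_coords hV.
have c0 j (W : lmodType C^c) : c j W 0 = 0 by apply: (addIr (c j W 0)); rewrite -cD !add0r.
have /choice [y hy] : forall j, exists y, g y = c j _ t by move=> j; apply: gh; rewrite -cn t0 c0.
have [s es] := cs _ t; exists (\sum_(j <- s) ptens (y j) j); rewrite [RHS]es.
by rewrite (tmap_sum g idfun); apply: eq_bigr => j _; rewrite (tmapE g idfun) hy.
Qed.
End TensorMap.

Section TensorExact.
Variable C : pzRingType.
Implicit Types (X Y Z : lmodType C^c) (U V W : lmodType C).
Local Notation bal X V f := (@balanced C X V (fun (a : C) (x : X) => (a : C^c) *: x) (fun (a : C) (y : V) => a *: y) _ f).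

Lemma proj_coordsr X : projective X -> exists c : X -> forall V, tens X V -> V,
  [/\ forall j V (t u : tens X V), c j V (t + u) = c j V t + c j V u,
      forall j V W (h : {linear V -> W}) t, c j W (tmap (@idfun X) h t) = h (c j V t)
    & forall V (t : tens X V), exists s : seq X, t = \sum_(j <- s) ptens j (c j V t)].
Proof.
move=> hX; have [s hs] := hX _ _ (fcov X) (idfun : {linear X -> X}) (@fcov_surj _ X).
pose f j (V : lmodType C) (x : X) (v : V) : V := (fm_co C^c j (s x) : C) *: v.
have fb j V : bal X V (@f j V).
  split=> [x x' v|x v v'|c x v]; rewrite /f.
  - by rewrite !linearD; exact: scalerDl.
  - exact: scalerDr.
  - rewrite scalerA; congr (_ *: _).
    have -> : s ((c : C^c) *: x) = (c : C^c) *: s x by exact: linearZ.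
    by have -> : fm_co C^c j ((c : C^c) *: s x) = (c : C^c) * fm_co C^c j (s x) by exact: linearZ.
exists (fun j V => tlift (@f j V)); split=> [j V|j V W h t|V t].
- exact: tliftD (fb j V).
- elim/tens_ind: t => [|t u IH IH'|x v]; first by rewrite tmap0 !tlift0 // linear0.
    by rewrite tmapD !tliftD // IH IH' linearD.
  by rewrite tmapE !tliftE // /f linearZ.
have aux (S : seq X) : uniq S -> forall l : seq (X * V), t = \sum_(p <- l) ptens p.1 p.2 ->
    (forall p, p \in l -> forall j, j \notin S -> fm_co C^c j (s p.1) = 0) ->
    t = \sum_(j <- S) ptens j (tlift (@f j V) t).
  move=> uS l -> hl.
  transitivity (\sum_(p <- l) \sum_(j <- S) ptens j (f j V p.1 p.2)).
    rewrite [LHS]big_seq [RHS]big_seq; apply: eq_bigr => p pl.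
    rewrite -[p.1 in LHS]/(idfun p.1) -hs [s _](fm_co_sum uS (hl p pl)) linear_sum.
    have p0 : ptens (0 : X) p.2 = 0 by exact: ptens0l.
    rewrite (big_morph (fun x => ptens x p.2) (fun x x' => ptensDl x x' p.2) p0); apply: eq_bigr => j _.
    by rewrite linearZ /= fm_lift_gen /f ptensZ.
  rewrite exchange_big; apply: eq_bigr => j _.
  rewrite (tlift_sum (fb j V)) (big_morph _ (fun v v' => ptensDr j v v') (ptens0r _ j)).
  by apply: eq_bigr => p _; rewrite tliftE.
have [l hl] := tens_sumP t.
exists (undup (flatten [seq [seq q.2 | q <- fm_rep (s p.1)] | p <- l])).
apply: (aux _ (undup_uniq _) l hl) => p pl j; rewrite mem_undup => hj.
apply: fm_co_fin; apply: contra hj => hj; apply/flattenP; exists [seq q.2 | q <- fm_rep (s p.1)] => //.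
by apply/mapP; exists p.
Qed.

Lemma proj_exactr X U V W (g : {linear U -> V}) (h : {linear V -> W}) : projective X ->
  (forall v, h v = 0 -> exists u, g u = v) ->
  forall t : tens X V, tmap (@idfun X) h t = 0 -> exists u : tens X U, tmap (@idfun X) g u = t.
Proof.
move=> hX gh t t0; have [c [cD cn cs]] := proj_coordsr hX.
have c0 j (V' : lmodType C) : c j V' 0 = 0 by apply: (addIr (c j V' 0)); rewrite -cD !add0r.
have /choice [y hy] : forall j, exists y, g y = c j _ t by move=> j; apply: gh; rewrite -cn t0 c0.
have [s es] := cs _ t; exists (\sum_(j <- s) ptens j (y j)); rewrite [RHS]es.
by rewrite (tmap_sum idfun g); apply: eq_bigr => j _; rewrite (tmapE idfun g) hy.
Qed.

Lemma proj_injr X U V (i : {linear U -> V}) : projective X -> injective i ->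
  forall t : tens X U, tmap (@idfun X) i t = 0 -> t = 0.
Proof.
move=> hX ii t t0; have [c [cD cn cs]] := proj_coordsr hX.
have c0 j (V' : lmodType C) : c j V' 0 = 0 by apply: (addIr (c j V' 0)); rewrite -cD !add0r.
have [s ->] := cs _ t; apply: big1 => j _.
suff -> : c j _ t = 0 by exact: ptens0r.
by apply: ii; rewrite -cn t0 c0 linear0.
Qed.

(** A choice [s] of preimages under q defines a map from X x W to the cokernel of X (x) U -> X (x)
    V. By exactness it does not depend on [s], hence is balanced, and it inverts the map induced by
    q. *)
Lemma tens_rexact X U V W (i : {linear U -> V}) (q : {linear V -> W}) : lses i q ->
  forall t : tens X V, tmap (@idfun X) q t = 0 -> exists u : tens X U, tmap (@idfun X) i u = t.
Proof.
case=> _ qs hk.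
pose I (t : tens X V) := exists u : tens X U, tmap (@idfun X) i u = t.
have I0 : I 0 by exists 0; exact: (tmap0 idfun).
have IB x y : I x -> I y -> I (x - y).
  by move=> [u <-] [v <-]; exists (u - v); exact: (tmapB idfun).
have [Q [p [pD pI _]]] := quotient_group I0 IB.
have pB x y : p (x - y) = p x - p y by apply: (addIr (p y)); rewrite -pD !subrK.
have /choice [s hs] := qs.
pose f (x : X) w := p (ptens x (s w)).
have key x v v' : q v = q v' -> p (ptens x v) = p (ptens x v').
  move=> e; have /hk [u hu] : q (v - v') = 0 by rewrite linearB e subrr.
  apply/eqP; rewrite -subr_eq0 -pB; apply/eqP/pI; exists (ptens x u).
  rewrite (tmapE idfun) hu /=; apply: (addIr (ptens x v')); by rewrite -ptensDr !subrK.
have fb : bal X W f.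
  split=> [x x' w|x w w'|c x w]; rewrite /f.
  - by rewrite ptensDl pD.
  - by rewrite -pD -ptensDr; apply: key; rewrite linearD !hs.
  - by rewrite ptensZ; apply: key; rewrite linearZ !hs.
have e t : p t = tlift f (tmap (@idfun X) q t).
  elim/tens_ind: t => [|t u IH IH'|x v].
  - by rewrite (tmap0 idfun) tlift0 //; apply/pI.
  - by rewrite (tmapD idfun) tliftD // pD IH IH'.
  - by rewrite (tmapE idfun) tliftE //; apply: key; rewrite hs.
by move=> t t0; apply/pI; rewrite e t0 tlift0.
Qed.

(** The image of u in X1 (x) W is a cycle, hence a boundary; correcting u by a lift of it to X2 (x)
    V puts u in the image of X1 (x) U. The element found there maps to z because X0 (x) U -> X0 (x)
    V is injective. *)
Lemma tens_chase X0 X1 X2 (g0 : {linear X1 -> X0}) (g1 : {linear X2 -> X1})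
    U V W (i : {linear U -> V}) (q : {linear V -> W}) (z : tens X0 U) (u : tens X1 V) :
  projective X0 -> projective X1 -> lses i q -> (forall x, g0 (g1 x) = 0) ->
  (forall t : tens X1 W, tmap g0 (@idfun W) t = 0 -> exists w : tens X2 W, tmap g1 (@idfun W) w = t) ->
  tmap (@idfun X0) i z = tmap g0 (@idfun V) u ->
  exists w : tens X1 U, tmap g0 (@idfun U) w = z.
Proof.
move=> p0 p1 [ii qs hk] g01 ex zu.
have q_i x : q (i x) = 0 by apply/hk; exists x.
have [|w hw] := ex (tmap (@idfun X1) q u).
  rewrite (@tmap_comp _ _ _ _ idfun g0 g0 _ _ _ q idfun q) //.
  rewrite -(@tmap_comp _ _ _ _ g0 idfun g0 _ _ _ idfun q q) // -zu.
  elim/tens_ind: (z) => [|t s IH IH'|x v].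
  - by rewrite !(tmap0 idfun).
  - by rewrite !(tmapD idfun) IH IH' addr0.
  - by rewrite !(tmapE idfun) /= q_i ptens0r.
have [w' hw'] := @tmap_sur _ X2 X2 idfun _ _ q (fun y => ex_intro _ y erefl) qs w.
have [|v hv] := proj_exactr p1 (fun v => proj1 (hk v)) (t := u - tmap g1 (@idfun V) w').
  rewrite (tmapB idfun) -hw -hw'.
  rewrite (@tmap_comp _ _ _ _ g1 idfun g1 _ _ _ idfun q q) //.
  by rewrite (@tmap_comp _ _ _ _ idfun g1 g1 _ _ _ q idfun q) // subrr.
exists v; apply/eqP; rewrite -subr_eq0; apply/eqP; apply: (proj_injr p0 ii).
rewrite (tmapB idfun) (@tmap_comp _ _ _ _ g0 idfun g0 _ _ _ idfun i i) //.
rewrite -(@tmap_comp _ _ _ _ idfun g0 g0 _ _ _ i idfun i) // hv zu (tmapB _ idfun).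
suff -> : tmap g0 idfun (tmap g1 (@idfun V) w') = 0 by rewrite subr0 subrr.
elim/tens_ind: (w') => [|t s IH IH'|x y].
- by rewrite (tmap0 g1 idfun) (tmap0 g0 idfun).
- by rewrite (tmapD g1 idfun) (tmapD g0 idfun) IH IH' addr0.
- by rewrite (tmapE g1 idfun) (tmapE g0 idfun) g01 ptens0l.
Qed.

Section Balance.
Variables (X : lmodType C^c) (P : proj_resolution X).
Definition tens_acyclic (V : lmodType C) : Prop := forall n, (0 < n)%N -> tens_acyclic_at P V n.
Variables (U V W : lmodType C) (i : {linear U -> V}) (q : {linear V -> W}).
Hypotheses (hs : lses i q) (hV : projective V) (hW : tens_acyclic W).

(** Exactness of Tor_1(X, W) -> X (x) U -> X (x) V, read off a resolution of X. *)
Lemma tens_acyclic_inj (t : tens X U) : tmap (@idfun X) i t = 0 -> t = 0.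
Proof.
move=> t0; have [z hz] := tmap_sur (@res_aug_surj _ _ P) (fun u : U => ex_intro (fun y => idfun y = u) u erefl) t.
have [|u hu] := proj_exact (g := res_diff P 0) (h := res_aug P) hV (fun y => proj1 (res_exact0 y)) (t := tmap (@idfun (P 0%N)) i z).
  rewrite (@tmap_comp _ _ _ _ idfun (res_aug P) (res_aug P) _ _ _ i idfun i) //.
  by rewrite -(@tmap_comp _ _ _ _ (res_aug P) idfun (res_aug P) _ _ _ idfun i i) // hz.
have [||w hw] := tens_chase (@res_proj _ _ P 0) (@res_proj _ _ P 1) hs _ _ (esym hu) (g1 := res_diff P 1).
- by move=> x; apply/res_exact; exists x.
- by move=> t' h; exact: (hW (n := 1) isT h).
rewrite -hz -hw; elim/tens_ind: (w) => [|t' s IH IH'|x y].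
- by rewrite (tmap0 _ idfun) (tmap0 _ idfun).
- by rewrite (tmapD _ idfun) (tmapD _ idfun) IH IH' addr0.
- by rewrite (tmapE _ idfun) (tmapE _ idfun) (proj2 (res_exact0 _)) ?ptens0l //; exists x.
Qed.

(** Tor_n(X, U) lies between Tor_{n+1}(X, W) and Tor_n(X, V), and the latter vanishes as V is
    projective. *)
Lemma tens_acyclic_ker : tens_acyclic U.
Proof.
case=> // n _ z z0.
have [|u hu] := proj_exact (g := res_diff P n.+1) (h := res_diff P n) hV (fun y => proj1 (res_exact y)) (t := tmap (@idfun (P n.+1)) i z).
  rewrite (@tmap_comp _ _ _ _ idfun (res_diff P n) (res_diff P n) _ _ _ i idfun i) //.
  rewrite -(@tmap_comp _ _ _ _ (res_diff P n) idfun (res_diff P n) _ _ _ idfun i i) //.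
  by rewrite [tmap _ idfun z]z0 (tmap0 idfun).
apply: (tens_chase (@res_proj _ _ P n.+1) (@res_proj _ _ P n.+2) hs _ _ (esym hu) (g1 := res_diff P n.+2)).
- by move=> x; apply/res_exact; exists x.
- by move=> t' h; exact: (hW (n := n.+2) isT h).
Qed.
End Balance.
End TensorExact.

(** * Induction from the corner *)

Lemma quotient_module (S : pzRingType) (Y X : lmodType S) (g : {linear Y -> X}) :
  exists (Q : lmodType S) (p : {linear X -> Q}), [/\ forall q, exists x, p x = q
    & forall x, p x = 0 <-> exists y, g y = x].
Proof.
pose I x := exists y, g y = x.
have I0 : I 0 by exists 0; rewrite linear0.
have IB x y : I x -> I y -> I (x - y).
  by move=> [u <-] [v <-]; exists (u - v); rewrite linearB.
have [[QT Qc] [p [pD pI ps]]] := quotient_group I0 IB; pose Q : zmodType := GRing.Zmodule.Pack Qc.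
have pB x y : p (x - y) = p x - p y by apply: (addIr (p y)); rewrite -pD !subrK.
have /choice [s hs] := ps.
pose sc (a : S) (q : Q) : Q := p (a *: s q).
have scE a x : sc a (p x) = p (a *: x).
  apply/eqP; rewrite -subr_eq0 -pB -scalerBr; apply/eqP/pI.
  have /pI [y hy] : p (s (p x) - x) = 0 by rewrite pB hs subrr.
  by exists (a *: y); rewrite linearZ /= hy.
have ind (T : Q -> Prop) : (forall x, T (p x)) -> forall q, T q.
  by move=> h q; rewrite -(hs q).
have sA a b q : sc a (sc b q) = sc (a * b) q.
  by elim/ind: q => x; rewrite !scE scalerA.
have s1 : left_id 1 sc by elim/ind=> x; rewrite scE scale1r.
have sDr : right_distributive sc +%R.
  by move=> a; elim/ind=> x; elim/ind=> y; rewrite -pD !scE scalerDr pD.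
have sDl q : {morph sc^~ q : a b / a + b}.
  by move=> a b; elim/ind: q => x; rewrite !scE scalerDl pD.
pose Q' : lmodType S := HB.pack QT Qc
  (GRing.Zmodule_isLmodule.Build S Q sA s1 sDr sDl).
have pl : GRing.linear_for *:%R (p : X -> Q').
  by move=> a x y; rewrite pD; congr (_ + _); exact/esym/scE.
by exists Q', (mklin pl).
Qed.

Section PeirceModule.
Variables (R : pzRingType) (e : idem R) (X : lmodType R).

Definition em_pred : {pred X} := fun x => (e : R) *: x == x.
Record emod := Emod { emv :> X; emvP : emv \in em_pred }.
Lemma em_zmod_closed : zmod_closed em_pred.
Proof.
split=> [|x y]; rewrite !unfold_in ?scaler0 //.
by move=> /eqP hx /eqP hy; rewrite scalerBr hx hy.
Qed.
HB.instance Definition _ := GRing.isZmodClosed.Build X em_pred em_zmod_closed.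
HB.instance Definition _ := [isSub for emv].
HB.instance Definition _ := [Choice of emod by <:].
HB.instance Definition _ := [SubChoice_isSubZmodule of emod by <:].

Lemma emE (x : emod) : (e : R) *: emv x = emv x. Proof. exact/eqP/(emvP x). Qed.
Lemma em_scale_subproof (c : corner e) (x : emod) : peirce_val c *: emv x \in em_pred.
Proof. by rewrite unfold_in scalerA peirce_l. Qed.
Definition em_scale (c : corner e) (x : emod) : emod := Emod (em_scale_subproof c x).
Lemma em_scaleA a b x : em_scale a (em_scale b x) = em_scale (a * b) x.
Proof. by apply: val_inj; exact: scalerA. Qed.
Lemma em_scale1 : left_id 1 em_scale.
Proof. by move=> x; apply: val_inj; exact: emE. Qed.
Lemma em_scaleDr : right_distributive em_scale +%R.
Proof. by move=> a x y; apply: val_inj; exact: scalerDr. Qed.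
Lemma em_scaleDl x : {morph em_scale^~ x : a b / a + b}.
Proof. by move=> a b; apply: val_inj; exact: scalerDl. Qed.
HB.instance Definition _ := GRing.Zmodule_isLmodule.Build (corner e) emod
  em_scaleA em_scale1 em_scaleDr em_scaleDl.

Lemma emp_subproof x : (e : R) *: x \in em_pred.
Proof. by rewrite unfold_in scalerA idemP. Qed.
Definition emp (x : X) : emod := Emod (emp_subproof x).
End PeirceModule.

Section Induced.
Variables (R : pzRingType) (e : idem R).
Local Notation C := (corner e).
Local Notation M := (peirce_right (idem1 R) e).

Lemma lact_subproof (r : R) (m : M) : r * peirce_val m \in peirce_pred (idem1 R) e.
Proof. by rewrite unfold_in mul1r -mulrA (peirce_r (m : peirce _ _)). Qed.
Definition lact_fun (r : R) (m : M) : M := Peirce (lact_subproof r m).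
Lemma lact_linear r : GRing.linear_for *:%R (lact_fun r).
Proof.
by move=> a x y; apply: (@val_inj _ _ (peirce (idem1 R) e)); rewrite /= mulrDr mulrA.
Qed.
Definition lact r : {linear M -> M} := mklin (lact_linear r).

Section Obj.
Variable V : lmodType C.
(** The induced module Re (x)_{eRe} V; R acts on the factor Re through [lact]. *)
Definition Ind : Type := tens M V.
HB.instance Definition _ := GRing.Zmodule.on Ind.
Definition ind_scale (r : R) (t : Ind) : Ind := tmap (lact r) (@idfun V) t.
Lemma ind_scaleA a b t : ind_scale a (ind_scale b t) = ind_scale (a * b) t.
Proof.
apply: tmap_comp => // m; apply: (@val_inj _ _ (peirce (idem1 R) e)).
by rewrite /= mulrA.
Qed.
Lemma ind_scale1 : left_id 1 ind_scale.
Proof.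
move=> t; apply: tmap_id => // m; apply: (@val_inj _ _ (peirce (idem1 R) e)).
by rewrite /= mul1r.
Qed.
Lemma ind_scaleDr : right_distributive ind_scale +%R.
Proof. by move=> a t u; exact: (tmapD _ idfun). Qed.
Lemma ind_scaleDl t : {morph ind_scale^~ t : a b / a + b}.
Proof.
move=> a b; rewrite /ind_scale; elim/tens_ind: t => [|t u IH IH'|m v].
- by rewrite !(tmap0 _ idfun) addr0.
- by rewrite !(tmapD _ idfun) IH IH' addrACA.
- rewrite !(tmapE _ idfun) -ptensDl; congr ptens.
  by apply: (@val_inj _ _ (peirce (idem1 R) e)); rewrite /= mulrDl.
Qed.
HB.instance Definition _ := GRing.Zmodule_isLmodule.Build R Ind
  ind_scaleA ind_scale1 ind_scaleDr ind_scaleDl.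
End Obj.
End Induced.

Section InducedMaps.
Variables (R : pzRingType) (e : idem R).
Local Notation C := (corner e).
Local Notation M := (peirce_right (idem1 R) e).
Local Notation N := (peirce_left e (idem1 R)).
Implicit Types (U V W : lmodType C) (X Y : lmodType R).
Local Notation bal V f := (@balanced C M V (fun (a : C) (x : M) => (a : C^c) *: x) (fun (a : C) (y : V) => a *: y) _ f).
Local Notation pv := (@peirce_val R (idem1 R) e).

Definition ip V (m : M) (v : V) : Ind V := ptens m v.
Lemma ind_act V r m (v : V) : r *: ip m v = ip (lact e r m) v.
Proof. exact: (tmapE _ idfun). Qed.
Lemma ind_ind V (Q : Ind V -> Prop) : Q 0 -> (forall t u, Q t -> Q u -> Q (t + u)) ->
  (forall x v, Q (ip x v)) -> forall t, Q t.
Proof. exact: tens_ind. Qed.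

Lemma peir_subproof (r : R) : r * (e : R) \in peirce_pred (idem1 R) e.
Proof. by rewrite unfold_in mul1r -mulrA idemP. Qed.
Definition peir r : M := Peirce (peir_subproof r).

Lemma ind_map_linear V W (h : {linear V -> W}) :
  GRing.linear_for *:%R (tmap idfun h : Ind V -> Ind W).
Proof.
move=> r t u; rewrite [LHS](tmapD idfun h); congr (_ + _).
rewrite [LHS](@tmap_comp _ _ _ _ (lact e r) idfun (lact e r) _ _ _ idfun h h) //.
by rewrite [RHS](@tmap_comp _ _ _ _ idfun (lact e r) (lact e r) _ _ _ h idfun h).
Qed.
Definition ind_map V W (h : {linear V -> W}) : {linear Ind V -> Ind W} :=
  mklin (ind_map_linear h).
Lemma ind_mapE V W (h : {linear V -> W}) m v : ind_map h (ip m v) = ip m (h v).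
Proof. exact: (tmapE idfun h). Qed.

Section Lift.
Variables (V : lmodType C) (X : lmodType R) (h : {linear V -> emod e X}).
Let f (m : M) (v : V) : X := pv m *: emv (h v).
Let fb : bal V f.
Proof.
split=> [x x' v|x v v'|c x v]; rewrite /f.
- exact: scalerDl.
- by rewrite linearD; exact: scalerDr.
- have -> : h (c *: v) = c *: h v by exact: linearZ.
  by rewrite /= scalerA.
Qed.
Lemma ind_lift_linear : GRing.linear_for *:%R (tlift f : Ind V -> X).
Proof.
move=> r t u; rewrite [LHS](tliftD fb); congr (_ + _).
elim/ind_ind: t => [|t s IH IH'|m v].
- by rewrite [_ *: 0]scaler0 (tlift0 fb) scaler0.
- by rewrite [_ *: (t + s)]scalerDr !(tliftD fb) IH IH' scalerDr.
- by rewrite ind_act !(tliftE fb) /f scalerA.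
Qed.
Definition ind_lift : {linear Ind V -> X} := mklin ind_lift_linear.
Lemma ind_liftE m v : ind_lift (ip m v) = pv m *: emv (h v).
Proof. exact: (tliftE fb). Qed.
End Lift.

Lemma ind_hom_ext V X (g g' : {linear Ind V -> X}) :
  (forall v, g (ip (peir 1) v) = g' (ip (peir 1) v)) -> forall t, g t = g' t.
Proof.
move=> h; apply: ind_ind => [|t u IH IH'|m v]; rewrite ?linear0 ?linearD ?IH ?IH' //.
have -> : ip m v = pv m *: ip (peir 1) v.
  rewrite ind_act; congr ip; apply: (@val_inj _ _ (peirce (idem1 R) e)).
  by rewrite /= mul1r (peirce_r (m : peirce _ _)).
by rewrite !linearZ h.
Qed.

Lemma emod_map_subproof X Y (g : {linear X -> Y}) (x : emod e X) : g (emv x) \in @em_pred R e Y.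
Proof. by rewrite unfold_in -linearZ /= emE. Qed.
Definition emod_fun X Y (g : {linear X -> Y}) x : emod e Y := Emod (emod_map_subproof g x).
Lemma emod_fun_linear X Y (g : {linear X -> Y}) : GRing.linear_for *:%R (emod_fun g).
Proof. by move=> c x y; apply: val_inj; rewrite /= linearP. Qed.
Definition emod_map X Y (g : {linear X -> Y}) : {linear emod e X -> emod e Y} :=
  mklin (emod_fun_linear g).

Lemma emod_of_linear V X (g : {linear Ind V -> X}) :
  GRing.linear_for *:%R (fun v => emp e (g (ip (peir 1) v))).
Proof.
have act c v : peirce_val (c : C) *: ip (peir 1) v = ip (peir 1) (c *: v).
  rewrite ind_act /ip -ptensZ; congr ptens; apply: (@val_inj _ _ (peirce (idem1 R) e)).
  by rewrite /= !mul1r peirce_r peirce_l.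
move=> c u v; apply: val_inj; rewrite /= [ip _ _](ptensDr (peir 1)) -[ptens _ (c *: u)]act.
rewrite linearD scalerDr; congr (_ + _); rewrite linearZ /= !scalerA peirce_l.
by rewrite peirce_r.
Qed.

(** [Ind] is left adjoint to X -> eX, which preserves surjections. *)
Lemma ind_projective V : projective V -> projective (Ind V).
Proof.
move=> hV X Y q f hq; pose phi : {linear V -> emod e Y} := mklin (emod_of_linear f).
have [|h hh] := hV _ _ (emod_map q) phi.
  move=> y; have [x hx] := hq (emv y); exists (emp e x); apply: val_inj.
  by rewrite /= linearZ /= hx emE.
exists (ind_lift h); apply: (ind_hom_ext (g := q \o ind_lift h : {linear Ind V -> Y})) => v.
have /(congr1 (@emv _ _ _)) /= hv := hh v.
transitivity (q (pv (peir 1) *: emv (h v))); first by rewrite -ind_liftE.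
rewrite linearZ [q _]hv /= scalerA -[LHS]linearZ; congr (f _).
rewrite [LHS]ind_act; congr ip.
by apply: (@val_inj _ _ (peirce (idem1 R) e)); rewrite /= !mul1r !idemP.
Qed.

Lemma cm_subproof (m : M) : (e : R) * pv m \in peirce_pred e e.
Proof. by rewrite unfold_in mulrA idemP -mulrA (peirce_r (m : peirce _ _)). Qed.
Definition cm (m : M) : C := Peirce (cm_subproof m).
(** On e (Ind V) this is the isomorphism to V inverse to v -> e (x) v; see [mu_act]. *)
Definition mu V (t : Ind V) : V := tlift (fun m v => cm m *: v) t.
Lemma mu_bal V : bal V (fun m v => cm m *: v).
Proof.
split=> [x x' v|x v v'|c x v].
- rewrite -scalerDl; congr (_ *: _); by apply: val_inj; rewrite /= mulrDr.
- exact: scalerDr.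
- by rewrite scalerA; congr (_ *: _); apply: val_inj; rewrite /= mulrA.
Qed.
Lemma muE V m (v : V) : mu (ip m v) = cm m *: v.
Proof. exact: (tliftE (mu_bal V)). Qed.
Lemma muD V (t u : Ind V) : mu (t + u) = mu t + mu u.
Proof. exact: (tliftD (mu_bal V)). Qed.
Lemma mu0 V : mu (0 : Ind V) = 0.
Proof. exact: (tlift0 (mu_bal V)). Qed.

Lemma mu_act V (t : Ind V) : (e : R) *: t = ip (peir 1) (mu t).
Proof.
elim/ind_ind: t => [|t u IH IH'|m v].
- by rewrite scaler0 mu0; exact/esym/ptens0r.
- by rewrite scalerDr IH IH' muD; exact/esym/ptensDr.
- rewrite muE ind_act [RHS]/ip -ptensZ; congr ptens; apply: (@val_inj _ _ (peirce (idem1 R) e)).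
  by rewrite /= mul1r mulrA idemP.
Qed.
Lemma mu_map V W (h : {linear V -> W}) t : h (mu t) = mu (ind_map h t).
Proof.
elim/ind_ind: t => [|t u IH IH'|m v]; first by rewrite linear0 mu0 linear0 mu0.
  by rewrite muD !linearD IH IH' muD.
by rewrite ind_mapE !muE linearZ.
Qed.

(** e (Ind V) is naturally isomorphic to V through [mu], so for t in the kernel [mu t] is killed by
    the injective h. *)
Lemma ind_ker_inj V W (h : {linear V -> W}) t : injective h -> ind_map h t = 0 ->
  (e : R) *: t = 0.
Proof.
move=> hi t0; have m0 : mu t = 0 by apply: hi; rewrite mu_map t0 mu0 linear0.
by rewrite mu_act m0; exact: ptens0r.
Qed.

Definition counit X : {linear Ind (emod e X) -> X} := ind_lift (idfun : {linear emod e X -> emod e X}).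
Lemma counitE X m x : counit X (ip m x) = pv m *: emv x.
Proof. exact: ind_liftE. Qed.
Lemma counit_mu X t : (e : R) *: counit X t = emv (mu t).
Proof.
elim/ind_ind: t => [|t u IH IH'|m v]; first by rewrite linear0 scaler0 mu0.
  by rewrite linearD scalerDr IH IH' muD.
by rewrite counitE muE /= scalerA.
Qed.
(** By [counit_mu], [mu t] is e times the counit of t, and it determines e t. For the cokernel see
    [counit_img]. *)
Lemma counit_ker X t : counit X t = 0 -> (e : R) *: t = 0.
Proof.
move=> t0; have m0 : mu t = 0 by apply: val_inj; rewrite /= -counit_mu t0 scaler0.
by rewrite mu_act m0; exact: ptens0r.
Qed.
Lemma counit_img X x : counit X (ip (peir 1) (emp e x)) = (e : R) *: x.
Proof. by rewrite counitE /= mul1r scalerA idemP. Qed.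
End InducedMaps.

(** * Inflation of modules over the quotient *)

Section Inflation.
Variables (R : pzRingType) (e : idem R).
Local Notation f := (idemC e).
Local Notation ev := (idem_val e).
Local Notation fv := (idem_val f).
Local Notation B := (corner f).
Hypothesis fef : forall x y, fv * x * ev * y * fv = 0.

Lemma cpr_subproof r : fv * r * fv \in peirce_pred f f.
Proof. by rewrite unfold_in !mulrA idemP -!mulrA idemP. Qed.
Definition cpr r : B := Peirce (cpr_subproof r).
Lemma cprM r s : cpr (r * s) = cpr r * cpr s.
Proof.
apply: (@val_inj _ _ (peirce f f)).
transitivity (fv * r * s * fv); first by rewrite -[LHS]/(fv * (r * s) * fv) !mulrA.
transitivity (fv * r * fv * (fv * s * fv)); last by [].
rewrite !mulrA -[_ * fv * fv]mulrA idemP.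
apply/eqP; rewrite -subr_eq0 -mulrBl -mulrBl -[X in X - _]mulr1 -mulrBr.
have e1 : 1 - fv = ev by rewrite -[fv]/(1 - ev) subKr.
by rewrite e1 fef.
Qed.
Lemma cpr1 : cpr 1 = 1.
Proof. by apply: (@val_inj _ _ (peirce f f)); rewrite -[LHS]/(fv * 1 * fv) mulr1 idemP. Qed.
Lemma cprD r s : cpr (r + s) = cpr r + cpr s.
Proof.
apply: (@val_inj _ _ (peirce f f)); rewrite -[LHS]/(fv * (r + s) * fv).
by rewrite (mulrDr fv) (mulrDl _ _ fv).
Qed.
Lemma cprK (b : B) : cpr (peirce_val b) = b.
Proof. by apply: (@val_inj _ _ (peirce f f)); exact: peirceE. Qed.

Definition infl_of (_ : forall x y, fv * x * ev * y * fv = 0) (Z : lmodType B) : Type := Z.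
Local Notation Infl := (infl_of fef).
Section Obj.
Variable Z : lmodType B.
HB.instance Definition _ := GRing.Zmodule.on (Infl Z).
Definition infl_scale (r : R) (z : Infl Z) : Infl Z := cpr r *: (z : Z).
Lemma infl_scaleA a b z : infl_scale a (infl_scale b z) = infl_scale (a * b) z.
Proof. by rewrite /infl_scale scalerA cprM. Qed.
Lemma infl_scale1 : left_id 1 infl_scale.
Proof. by move=> z; rewrite /infl_scale cpr1; exact: (@scale1r _ Z). Qed.
Lemma infl_scaleDr : right_distributive infl_scale +%R.
Proof. by move=> a x y; exact: (@scalerDr _ Z). Qed.
Lemma infl_scaleDl z : {morph infl_scale^~ z : a b / a + b}.
Proof. by move=> a b; rewrite /infl_scale cprD; exact: (@scalerDl _ Z). Qed.
HB.instance Definition _ := GRing.Zmodule_isLmodule.Build R (Infl Z)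
  infl_scaleA infl_scale1 infl_scaleDr infl_scaleDl.
End Obj.

Lemma infl_map_linear (Z Z' : lmodType B) (h : {linear Z -> Z'}) :
  GRing.linear_for *:%R (h : Infl Z -> Infl Z').
Proof.
have hZ (b : B) z : h (b *: z) = b *: h z by exact: linearZ.
by move=> r x y; rewrite [LHS]linearD; congr (_ + _); exact: hZ.
Qed.
Definition infl_map (Z Z' : lmodType B) (h : {linear Z -> Z'}) : {linear Infl Z -> Infl Z'} :=
  mklin (infl_map_linear h).

(** On a module killed by e the idempotent f acts as the identity, so Y is its own fY, inflated from
    fRf. *)
Lemma infl_emod n (Y : lmodType R) : (forall y : Y, ev *: y = 0) ->
  pdle n (Infl (emod f Y)) -> pdle n Y.
Proof.
move=> hY; have gl : GRing.linear_for *:%R (fun y : Infl (emod f Y) => emv (y : emod f Y)).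
  move=> r x y; congr (_ + _); have ex := emE (x : emod f Y).
  transitivity ((fv * r * fv) *: emv (x : emod f Y)); first by [].
  by rewrite -scalerA ex -scalerA /= scalerBl scale1r hY subr0.
apply: (proj1 (@pdle_iso _ n _ _ (mklin gl) _ _)) => [x y|y]; first exact: val_inj.
exists (emp f y); by rewrite /= scalerBl scale1r hY subr0.
Qed.

Section Bound.
Variables (a : nat).
Hypothesis ha : forall J : choiceType, pdle a (Ind (emod e (FM R J))).
Hypothesis hi : forall (J : choiceType) (t : Ind (emod e (FM R J))), counit e (FM R J) t = 0 -> t = 0.

(* [FM R J] maps onto the inflation of [FM B J] with kernel [R e (FM R J)], the image of
   the counit. *)
Lemma infl_free (J : choiceType) : pdle a.+1 (Infl (FM B J)).
Proof.
pose q := fm_lin (fun j : J => (fm_gen B j : Infl (FM B J))).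
have q0 : q 0 = 0 :> FM B J by exact: (linear0 q).
have qD x y : q (x + y) = (q x : FM B J) + (q y : FM B J) :> FM B J by exact: (linearD q).
have qZ r x : q (r *: x) = cpr r *: (q x : FM B J) :> FM B J.
  have qZ' (u : R) (y : FM R J) : q (u *: y) = u *: q y by exact: linearZ.
  exact: qZ'.
have c0 : cpr 0 = 0.
  by apply: (@val_inj _ _ (peirce f f)); rewrite -[LHS]/(fv * 0 * fv) mulr0 mul0r.
have qE (x : FM R J) (j : J) : fm_co B j (q x : FM B J) = cpr (fm_co R j x) :> B.
  rewrite (fm_sum x); elim: (fm_rep x) => [|p s IH].
    by rewrite big_nil q0 !linear0 c0.
  rewrite big_cons qD linearD IH linearD [RHS]cprD; congr (_ + _).
  rewrite qZ linearZ [q _]fm_lift_gen fm_co_gen.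
  have -> : fm_co R j (p.1 *: fm_gen R p.2) = p.1 *: fm_co R j (fm_gen R p.2) by exact: linearZ.
  rewrite fm_co_gen [RHS]cprM; congr (_ * _).
  by case: (p.2 == j); rewrite ?cpr1 ?c0.
have qs z : exists x, q x = z.
  rewrite (fm_sum (z : FM B J)); elim: (fm_rep _) => [|p l [x hx]]; first by exists 0; rewrite big_nil q0.
  exists (peirce_val p.1 *: fm_gen R p.2 + x); rewrite big_cons qD hx qZ; congr (_ + _).
  by rewrite [q _]fm_lift_gen cprK.
have cpre : cpr ev = 0.
  apply: (@val_inj _ _ (peirce f f)); rewrite -[LHS]/(fv * ev * fv) -[fv * ev]/((1 - ev) * ev).
  by rewrite mulrBl mul1r idemP subrr mul0r.
have fe1 : ev + fv = 1 by rewrite addrC subrK.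
have hse : lses (counit e (FM R J)) q.
  split=> // [x y h|x].
    by apply/eqP; rewrite -subr_eq0; apply/eqP/hi; rewrite linearB h subrr.
  split=> [x0|[t <-]]; last first.
    elim/ind_ind: t => [|t u IH IH'|m y]; first by rewrite linear0 q0.
      by rewrite linearD qD IH IH' addr0.
    rewrite counitE qZ -(emE y) qZ cpre scale0r scaler0; done.
  have hx j : fv * (fm_co R j x : R) * fv = 0.
    by have := qE x j; rewrite x0 linear0 => /(congr1 (@peirce_val _ _ _)) /esym.
  have [s [us hs]] : exists s, uniq s /\ forall j, j \notin s -> fm_co R j x = 0.
    exists (undup [seq p.2 | p <- fm_rep x]); split=> [|j]; first exact: undup_uniq.
    by rewrite mem_undup; exact: fm_co_fin.
  rewrite (fm_co_sum us hs); elim: s {us hs} => [|j l [t ht]].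
    by exists 0; rewrite big_nil linear0.
  set r : R := fm_co R j x; set g := fm_gen R j.
  (* From f r f = 0 one gets r = e r + f r e; the two summands applied to the generator are the
     images of e (x) e r g and f r e (x) e g. *)
  exists (ip (peir e 1) (emp e (r *: g)) + ip (peir e (fv * r)) (emp e g) + t).
  rewrite big_cons !linearD ht; congr (_ + _).
  rewrite counit_img counitE [emv _]/= [peirce_val _]/= !scalerA -scalerDl; congr (_ *: _).
  rewrite -[LHS]addr0 -(hx j) -/r -[_ * ev * ev]mulrA idemP -addrA -mulrDr fe1 mulr1.
  by rewrite -mulrDl fe1 mul1r.
have pF : projective (FM R J : lmodType R) by exact: FM_projective.
exact: (pdle_quot hse (ha J) (pdle_le (leq0n a.+1) (pF : pdle 0 _))).
Qed.

Lemma infl_proj (Z : lmodType B) : projective Z -> pdle a.+1 (Infl Z).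
Proof.
move=> hZ; have [s hs] := hZ _ _ (fcov Z) (idfun : {linear Z -> Z}) (@fcov_surj _ Z).
apply: (pdle_retract (i := infl_map s) (r := infl_map (fcov Z))) (infl_free Z) => z.
exact: hs.
Qed.

(** Inflation is exact and sends projectives to modules of dimension at most a + 1; each step of the
    resolution then adds one. *)
Lemma infl_pdle d (Z : lmodType B) : pdle d Z -> pdle (a.+1 + d) (Infl Z).
Proof.
elim: d Z => [|d IH] Z; first by rewrite addn0; exact: infl_proj.
case=> [P [g [hP gs /IH hk]]]; rewrite addnS.
apply: (@pdle_quot _ _ _ _ _ (infl_map (kincl g)) (infl_map g)) hk _.
  by have [i0 s0 k0] := kmod_ses gs.
by apply: pdle_le (infl_proj hP); rewrite -addnS leq_addr.
Qed.
End Bound.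
End Inflation.

(** * Global dimension *)

Section GlobalDimCorners.
Variables (R : pzRingType) (e : idem R).
Local Notation C := (corner e).
Local Notation M := (peirce_right (idem1 R) e).
Local Notation N := (peirce_left e (idem1 R)).
Local Notation f := (idemC e).
Local Notation ev := (idem_val e).
Local Notation fv := (idem_val f).
Local Notation nv := (@peirce_val R e (idem1 R)).
Local Notation mv := (@peirce_val R (idem1 R) e).
Local Notation TZ V := (tens_acyclic (free_res (M : lmodType C^c)) V).

Section FreeCoordinates.
Variable J : choiceType.
Local Notation F := (FM R J).

Lemma fm_coZ (j : J) (r : R) (x : F) : fm_co R j (r *: x) = r * fm_co R j x.
Proof. exact: linearZ. Qed.

Lemma kap_subproof (j : J) (x : emod e F) : (fm_co R j (emv x) : R) \in peirce_pred e (idem1 R).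
Proof.
by rewrite unfold_in mulr1 -fm_coZ emE.
Qed.
Definition kap_fun j x : N := Peirce (kap_subproof j x).
Lemma kap_linear j : GRing.linear_for *:%R (kap_fun j).
Proof.
move=> c x y; apply: (@val_inj _ _ (peirce e (idem1 R))).
rewrite [LHS](linearD (fm_co R j)); congr (_ + _).
exact: fm_coZ.
Qed.
Definition kap j : {linear emod e F -> N} := mklin (kap_linear j).

Lemma iot_subproof (j : J) (n : N) : nv n *: fm_gen R j \in @em_pred R e F.
Proof. by rewrite unfold_in scalerA (peirce_l (n : peirce _ _)). Qed.
Definition iot_fun j n : emod e F := Emod (iot_subproof j n).
Lemma iot_linear j : GRing.linear_for *:%R (iot_fun j).
Proof. by move=> c x y; apply: val_inj; rewrite /= scalerDl scalerA. Qed.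
Definition iot j : {linear N -> emod e F} := mklin (iot_linear j).

(** eF is a direct sum of copies of eR with projections [kap] and inclusions [iot], and a tensor
    involves finitely many of them. *)
Lemma emod_free_coords (X : lmodType C^c) (t : tens X (emod e F)) :
  exists s : seq J, t = \sum_(j <- s) tmap (@idfun X) (iot j) (tmap (@idfun X) (kap j) t).
Proof.
have [l hl] := tens_sumP t.
have [s [us hs]] : exists s : seq J, uniq s /\
    forall p, p \in l -> forall j, j \notin s -> fm_co R j (emv p.2) = 0.
  exists (undup (flatten [seq [seq q.2 | q <- fm_rep (emv p.2)] | p <- l])).
  split=> [|p pl j]; first exact: undup_uniq.
  rewrite mem_undup => hj; apply: fm_co_fin; apply: contra hj => hj.
  apply/flattenP; exists [seq q.2 | q <- fm_rep (emv p.2)] => //.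
  by apply/mapP; exists p.
exists s; rewrite {}hl [LHS]big_seq.
transitivity (\sum_(p <- l | p \in l) \sum_(j <- s) ptens p.1 (iot j (kap j p.2))).
  apply: eq_bigr => p pl.
  rewrite -[RHS](big_morph _ (fun v v' => ptensDr p.1 v v') (ptens0r _ p.1)).
  congr ptens; apply: val_inj; rewrite [LHS](fm_co_sum us (hs p pl)).
  have vD : {morph @emv R e F : a b / a + b} by [].
  have v0 : emv (0 : emod e F) = 0 by [].
  by rewrite -[RHS]/(emv (\sum_(j <- s) iot j (kap j p.2))) (big_morph _ vD v0).
rewrite exchange_big; apply: eq_bigr => j _.
rewrite -[LHS]big_seq (tmap_sum idfun (kap j)) (tmap_sum idfun (iot j)); apply: eq_bigr => p _.
by rewrite !(tmapE idfun).
Qed.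

Hypothesis TI : forall s : seq (M * N), \sum_(p <- s) mv p.1 * nv p.2 = 0 ->
  \sum_(p <- s) ptens p.1 p.2 = 0 :> tens M N.

(** Coordinatewise this is the injectivity of Re (x) eR -> R, the hypothesis [TI]. *)
Lemma counit_free_inj (t : Ind (emod e F)) : counit e F t = 0 -> t = 0.
Proof.
move=> t0; have [s ->] := emod_free_coords t; apply: big1 => j _.
suff -> : tmap (@idfun M) (kap j) t = 0 by exact: (tmap0 idfun).
have [l hl] := tens_sumP t.
have -> : tmap (@idfun M) (kap j) t = \sum_(p <- [seq (p.1, kap j p.2) | p <- l]) ptens p.1 p.2.
  by rewrite hl (tmap_sum idfun) big_map; apply: eq_bigr => p _; rewrite [LHS](tmapE idfun).
apply: TI; rewrite big_map.
transitivity (fm_co R j (counit e F t)); last by rewrite t0 linear0.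
rewrite hl [counit _ _ _](linear_sum (counit e F)) [RHS](linear_sum (fm_co R j)).
apply: eq_bigr => p _; rewrite [X in fm_co R j X]counitE.
exact/esym/fm_coZ.
Qed.

Hypothesis TA : TZ N.

Lemma emod_free_acyclic : TZ (emod e F).
Proof.
case=> // n _ z z0; set P := free_res _ in z z0 *.
have [s hs] := emod_free_coords z.
have /choice [w hw] : forall j, exists w : tens (P n.+2) N,
    tmap (res_diff P n.+1) (@idfun N) w = tmap (@idfun (P n.+1)) (kap j) z.
  move=> j; apply: (TA (n := n.+1) isT).
  rewrite [tens_map _ _](@tmap_comp _ _ _ _ idfun (res_diff P n) (res_diff P n) _ _ _ (kap j) idfun (kap j)) //.
  rewrite -(@tmap_comp _ _ _ _ (res_diff P n) idfun (res_diff P n) _ _ _ idfun (kap j) (kap j)) //.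
  by rewrite [tmap _ idfun z]z0 (tmap0 idfun).
exists (\sum_(j <- s) tmap (@idfun (P n.+2)) (iot j) (w j)); rewrite [RHS]hs.
rewrite [LHS](tmap_sum _ idfun); apply: eq_bigr => j _; rewrite -hw.
rewrite [LHS](@tmap_comp _ _ _ _ idfun (res_diff P n.+1) (res_diff P n.+1) _ _ _ (iot j) idfun (iot j)) //.
by rewrite [RHS](@tmap_comp _ _ _ _ (res_diff P n.+1) idfun (res_diff P n.+1) _ _ _ idfun (iot j) (iot j)).
Qed.
End FreeCoordinates.
End GlobalDimCorners.

Section GlobalDimBound.
Variables (R : pzRingType) (e : idem R).
Local Notation C := (corner e).
Local Notation M := (peirce_right (idem1 R) e).
Local Notation N := (peirce_left e (idem1 R)).
Local Notation f := (idemC e).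
Local Notation ev := (idem_val e).
Local Notation fv := (idem_val f).
Local Notation TZ V := (tens_acyclic (free_res (M : lmodType C^c)) V).

Lemma ind_surj (V W : lmodType C) (q : {linear V -> W}) : (forall w, exists v, q v = w) ->
  forall t, exists u, ind_map (e := e) q u = t.
Proof.
exact: (tmap_sur (g := idfun) (fun m : M => ex_intro (fun y => idfun y = m) m erefl)).
Qed.

Lemma ind_exact (U V W : lmodType C) (i : {linear U -> V}) (q : {linear V -> W}) : lses i q ->
  forall t, ind_map (e := e) q t = 0 <-> exists u, ind_map (e := e) i u = t.
Proof.
move=> hs; have [_ qs hk] := hs; move=> t; split=> [|[u <-]]; first exact: tens_rexact hs t.
elim/ind_ind: u => [|t' u IH IH'|m v]; first by rewrite !linear0.
  by rewrite !linearD IH IH' addr0.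
by rewrite !ind_mapE (proj2 (hk _)) //; [exact: ptens0r|exists v].
Qed.

Lemma lin_inj (X Y : lmodType R) (g : {linear X -> Y}) : (forall x, g x = 0 -> x = 0) -> injective g.
Proof.
by move=> h x y exy; apply/eqP; rewrite -subr_eq0; apply/eqP/h; rewrite linearB exy subrr.
Qed.

(** If Tor(Re, V) vanishes in positive degrees, so it does for the syzygies of V, and [Ind] keeps
    the short exact sequences of a resolution exact. *)
Lemma ind_pdle_acyclic m (V : lmodType C) : TZ V -> pdle m V -> pdle m (Ind V).
Proof.
elim: m V => [|m IH] V hV; first exact: ind_projective.
case=> [P [g [hP gs hk]]]; have hs := kmod_ses gs.
have hi : injective (ind_map (e := e) (kincl g)).
  by apply: lin_inj => t; exact: (tens_acyclic_inj hs hP hV).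
have hse : lses (ind_map (e := e) (kincl g)) (ind_map (e := e) g).
  by split=> //; [exact: ind_surj|exact: ind_exact].
apply: (pdle_quot hse).
  by apply: IH => //; exact: (tens_acyclic_ker hs hP hV).
by apply: (pdle_le (leq0n m.+1)); exact: ind_projective.
Qed.

Variable c : nat.
Hypothesis hc : forall Y : lmodType R, (forall y : Y, ev *: y = 0) -> pdle c Y.

(** The kernel of X -> I is killed by e, so [hc] bounds its dimension by c. *)
Lemma pdle_img n (X Y : lmodType R) (g : {linear X -> Y}) (I : lmodType R) (i : {linear I -> Y}) :
  (forall x, g x = 0 -> ev *: x = 0) -> injective i ->
  (forall y, (exists z, i z = y) <-> exists x, g x = y) ->
  pdle n X -> pdle (maxn c n).+1 I.
Proof.
move=> gk ii gi hX.
have [|p hp] := lin_factor (f := g) ii; first by move=> x; apply/gi; exists x.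
have ps z : exists x, p x = z.
  have [x hx] : exists x, g x = i z by apply/gi; exists z.
  by exists x; apply: ii; rewrite hp.
apply: (pdle_quot (kmod_ses ps)).
  apply: (pdle_le (leq_maxl c n)); apply: hc => y; apply: val_inj.
  by rewrite /= gk // -hp kvalE linear0.
by apply: pdle_le hX; rewrite ltnW // ltnS leq_maxr.
Qed.

(* [Ind] need not preserve syzygies, but the kernel it creates is killed by [e]. *)
Lemma ind_pdle m : exists n, forall V : lmodType C, pdle m V -> pdle n (Ind V).
Proof.
elim: m => [|m [n IH]]; first by exists 0%N => V; exact: ind_projective.
(* Passing to the image of [Ind (kmod g)] in [Ind P] costs one over [maxn c n], and taking the
   quotient one more. *)
exists (maxn c n).+2 => V [P [g [hP gs /IH hk]]].
apply: (pdle_quot (kmod_ses (ind_surj gs))).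
  apply: (@pdle_img n _ _ (ind_map (e := e) (kincl g)) _ (kincl (ind_map (e := e) g))) hk.
  - by move=> t; apply: ind_ker_inj; exact: kval_inj.
  - exact: kval_inj.
  - move=> y; split=> [[z <-]|[x hx]].
      exact: (proj1 (ind_exact (kmod_ses gs) _) (kvalE z)).
    by apply: ker_mem; apply/(ind_exact (kmod_ses gs)); exists x.
by apply: (pdle_le (leq0n (maxn c n).+2)); exact: ind_projective.
Qed.

(** The counit Ind (eX) -> X has kernel and cokernel killed by e. Its image is bounded by
    [pdle_img], and X is an extension of the cokernel by the image. *)
Lemma finite_gldim_ind : finite_gldim C -> finite_gldim R.
Proof.
move=> /finite_gldimP [d hd]; have [n hn] := ind_pdle d.
apply/finite_gldimP; exists (maxn c n).+1 => X.
have [Q [p [ps pk]]] := quotient_module (counit e X).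
apply: (pdle_ext (kmod_ses ps)).
  apply: (@pdle_img n _ _ (counit e X) _ (kincl p)) (hn _ (hd _)).
  - by move=> t; exact: counit_ker.
  - exact: kval_inj.
  - move=> y; split=> [[z <-]|h]; first exact/pk/(kvalE z).
    by apply: ker_mem; apply/pk.
apply: (@pdle_le _ c); first by rewrite ltnW // ltnS leq_maxl.
apply: hc => q; have [x <-] := ps q; rewrite -linearZ /=; apply/pk.
by exists (ip (peir e 1) (emp e x)); exact: counit_img.
Qed.
End GlobalDimBound.

(** The constant a + 1 + b: a module killed by e is inflated from fRf, where dimensions are at most
    b, and inflated projectives have dimension at most a + 1. *)
Lemma finite_gldim_corners (R : pzRingType) (e : idem R) :
  (forall s : seq (peirce_right (idem1 R) e * peirce_left e (idem1 R)),
    \sum_(p <- s) @peirce_val R (idem1 R) e p.1 * @peirce_val R e (idem1 R) p.2 = 0 ->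
    \sum_(p <- s) ptens p.1 p.2 = 0 :> tens _ _) ->
  tens_acyclic (free_res (peirce_right (idem1 R) e : lmodType (corner e)^c))
    (peirce_left e (idem1 R)) ->
  (forall x y, (idemC e : R) * x * (e : R) * y * (idemC e : R) = 0) ->
  finite_gldim (corner e) -> finite_gldim (corner (idemC e)) -> finite_gldim R.
Proof.
move=> TI TA fef hC /finite_gldimP [b hb]; have /finite_gldimP [a ha] := hC.
apply: (@finite_gldim_ind R e (a.+1 + b)) => // Y hY.
apply: (infl_emod (fef := fef) hY); apply: infl_pdle (hb _) => J.
  by apply: ind_pdle_acyclic (ha _); exact: emod_free_acyclic.
exact: counit_free_inj.
Qed.

(** * Local algebras *)

Section LocalAlgebra.
Variables (k : fieldType) (A : falgType k).

(** The powers of x up to the dimension are linearly dependent. Solving a relation for its lowest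
    term x^m makes it x^(m+1) times a polynomial in x. *)
Lemma fitting (x : A) : exists m (z : A), GRing.comm x z /\ x ^+ m = x ^+ m.+1 * z.
Proof.
pose d := \dim {:A}; pose X := [tuple x ^+ i | i < d.+1].
have nf : ~~ free X.
  apply/negP; rewrite /free => /eqP hX; have := dimvS (subvf <<X>>%VS).
  by rewrite hX size_tuple ltnn.
have /existsNP [c hc] : ~ forall c : 'I_d.+1 -> k, \sum_i c i *: X`_i = 0 -> forall i, c i = 0.
  by move=> h; case/negP: nf; apply/freeP.
have {hc} [h0 /existsNP [i0 /eqP hi0]] := (not_implyP _ _).1 hc.
pose m := [arg min_(i < i0 | c i != 0) (i : nat)].
have [hm mmin] : c m != 0 /\ forall i, c i != 0 -> (m <= i)%N.
  by rewrite /m; case: arg_minnP.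
have hX (i : 'I_d.+1) : X`_i = x ^+ i by rewrite -tnth_nth tnth_mktuple.
pose z := - (c m)^-1 *: \sum_(i < d.+1 | (m < i)%N) c i *: x ^+ (i - m.+1).
exists m, z; split.
  rewrite /GRing.comm -scalerAl -scalerAr; congr (_ *: _).
  rewrite mulr_suml mulr_sumr; apply: eq_bigr => i _.
  by rewrite -scalerAl -scalerAr -exprS -exprSr.
move: h0; under eq_bigr do rewrite hX.
rewrite (bigID (fun i : 'I_d.+1 => (m < i)%N)) /= [X in _ + X](bigD1 m) ?ltnn //=.
rewrite [X in _ + (_ + X)]big1 ?addr0 => [|i /andP[]]; last first.
  rewrite -leqNgt => im ne; case: (eqVneq (c i) 0) => [->|/mmin mi]; first by rewrite scale0r.
  by case/eqP: ne; apply/val_inj/eqP; rewrite eqn_leq im.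
move/eqP; rewrite addrC addr_eq0 => /eqP h0.
rewrite -[LHS]scale1r -(mulVf hm) -scalerA h0 scalerN -scaleNr -scalerAr; congr (_ *: _).
rewrite mulr_sumr; apply: eq_bigr => i mi.
by rewrite -scalerAr -exprD subnKC.
Qed.

(* If [x ^+ m = x ^+ m.+1 * z] with [x] and [z] commuting, then [x ^+ m * z ^+ m] is idempotent. *)
Lemma nilp_or_unit (x : A) : (forall p : A, p * p = p -> p = 0 \/ p = 1) ->
  (exists m, x ^+ m = 0) \/ exists u, u * x = 1.
Proof.
move=> hp; have [m [z [cz e]]] := fitting x.
have czm : GRing.comm (x ^+ m) (z ^+ m) by apply: commrX; apply/commr_sym/commrX/commr_sym.
have em i : x ^+ m = x ^+ (m + i) * z ^+ i.
  elim: i => [|i IH]; first by rewrite addn0 mulr1.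
  by rewrite [LHS]IH (addnC m i) exprD {1}e !mulrA -exprD -mulrA -exprS addnC addSnnS.
pose p := x ^+ m * z ^+ m.
have pp : p * p = p.
  transitivity (x ^+ m * x ^+ m * z ^+ m * z ^+ m).
    by rewrite /p mulrA -(mulrA (x ^+ m) (z ^+ m)) -czm !mulrA.
  by rewrite -exprD -(em m).
have [p0|p1] := hp p pp.
  by left; exists m; rewrite (em m) exprD -mulrA -/p p0 mulr0.
have cx i : GRing.comm x (z ^+ i) by apply: commrX.
right; move: e p1; rewrite /p {p pp em czm}; case: m => [|m] e p1.
  by exists z; rewrite -cz -[RHS](expr0 x) e expr1.
by exists (x ^+ m * z ^+ m.+1); rewrite -mulrA -cx mulrA -exprSr.
Qed.

(** By [nilp_or_unit] an element is nilpotent exactly when it has no left inverse. The nilpotent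
    elements then form a left ideal, which contains every proper left ideal. *)
Lemma local_of_idem : (forall p : A, p * p = p -> p = 0 \/ p = 1) -> local_ring A.
Proof.
move=> hp; pose LI (x : A) := exists u, u * x = 1.
pose nil (x : A) := exists m, x ^+ m = 0.
have nilN x : nil x -> ~ LI x.
  case=> m xm [u ux]; have um i : u ^+ i * x ^+ i = 1.
    elim: i => [|i IH]; first by rewrite mulr1.
    by rewrite exprSr exprS mulrA -(mulrA _ u) ux mulr1.
  by have := um m; rewrite xm mulr0 => /esym/eqP; rewrite oner_eq0.
have nilP x : ~ LI x -> nil x by move=> h; case: (nilp_or_unit x hp).
have nil_mul r x : nil x -> nil (r * x).
  move=> /nilN h; apply: nilP => -[u hu]; apply: h; exists (u * r); by rewrite -mulrA.
have lI : left_ideal nil.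
  split=> [|x y hx hy|//]; first by exists 1%N; rewrite expr1.
  apply: nilP => -[u hu]; apply: (nilN _ (nil_mul u _ hx)).
  have [m hm] := nil_mul u _ hy.
  have e : u * x = 1 - u * y by rewrite -hu mulrDr addrK.
  (* The geometric series inverts u x = 1 - u y, where u y is nilpotent; but u x is nilpotent as
     well. *)
  exists (\sum_(i < m) (u * y) ^+ i).
  have c : GRing.comm (\sum_(i < m) (u * y) ^+ i) (u * y).
    by apply/commr_sym; apply: commr_sum => i _; exact/commrX/commr_refl.
  by rewrite e mulrBr mulr1 c -{1}[X in X - _]mul1r -mulrBl -opprB mulNr -subrX1 hm sub0r opprK.
have n1 : ~ nil 1 by move=> /nilN; apply; exists 1; rewrite mulr1.
exists nil.
  split=> // J hJ hIJ J1 x Jx; apply: nilP => -[u hu]; apply: J1; rewrite -hu.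
  by case: hJ => _ _; apply.
move=> J [hJ J1 Jm] x; split; last by apply: Jm => // y Jy; apply: nilP => -[u hu]; apply: J1; rewrite -hu; case: hJ => _ _; apply.
by move=> Jy; apply: nilP => -[u hu]; apply: J1; rewrite -hu; case: hJ => _ _; apply.
Qed.
End LocalAlgebra.

(** * Transport along ring isomorphisms *)

(** The quotients of L in the chain and those of its corner fLf are different types, only
    isomorphic, so the Tor conditions have to be carried along isomorphisms. *)
Record riso (S S' : pzRingType) := RIso {
  rf : S -> S'; rg : S' -> S; rfK : cancel rf rg; rgK : cancel rg rf;
  rfD : forall x y, rf (x + y) = rf x + rf y;
  rfM : forall x y, rf (x * y) = rf x * rf y;
  rf1 : rf 1 = 1 }.

Section RIsoTheory.
Variables (S S' : pzRingType) (i : riso S S').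
Lemma rgD x y : rg i (x + y) = rg i x + rg i y.
Proof. by rewrite -{1}(rgK i x) -{1}(rgK i y) -rfD rfK. Qed.
Lemma rgM x y : rg i (x * y) = rg i x * rg i y.
Proof. by rewrite -{1}(rgK i x) -{1}(rgK i y) -rfM rfK. Qed.
Lemma rg1 : rg i 1 = 1.
Proof. by rewrite -(rf1 i) rfK. Qed.
Definition riso_inv : riso S' S := RIso (rgK i) (rfK i) rgD rgM rg1.
Definition riso_op : riso S^c S'^c :=
  @RIso S^c S'^c (rf i) (rg i) (rfK i) (rgK i) (rfD i) (fun x y => rfM i y x) (rf1 i).
Definition rs (X : lmodType S) : lmodType S' := scmod rgD rgM rg1 X.
End RIsoTheory.

Definition semilin (S S' : pzRingType) (i : riso S S') (X : lmodType S) (X' : lmodType S')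
  (h : X -> X') : Prop :=
  (forall x y, h (x + y) = h x + h y) /\ (forall a x, h (a *: x) = rf i a *: h x).

Section Restrict.
Variables (S S' : pzRingType) (i : riso S S').

Lemma rs_semi (X : lmodType S) : semilin i (fun x : X => (x : rs i X)).
Proof.
split=> // a x; transitivity (rg i (rf i a) *: x); first by rewrite rfK.
by [].
Qed.
Lemma semi_rs (X : lmodType S) (X' : lmodType S') (h : X -> X') : semilin i h ->
  GRing.linear_for *:%R (h : rs i X -> X').
Proof.
case=> hD hZ a x y; rewrite [LHS]hD; congr (_ + _).
by rewrite [LHS](hZ (rg i a) (x : X)) rgK.
Qed.
Lemma rs_lin (X Y : lmodType S) (g : {linear X -> Y}) :
  GRing.linear_for *:%R (g : rs i X -> rs i Y).
Proof.
move=> a x y; rewrite [LHS]linearD; congr (_ + _).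
have gZ (b : S) z : g (b *: z) = b *: g z by exact: linearZ.
exact: (gZ (rg i a)).
Qed.
Definition rsl (X Y : lmodType S) (g : {linear X -> Y}) : {linear rs i X -> rs i Y} :=
  mklin (@rs_lin X Y g).
End Restrict.

Section RestrictProj.
Variables (S S' : pzRingType) (i : riso S S').
Lemma rs_proj (X : lmodType S) : projective X -> projective (rs i X).
Proof.
move=> hX A B q f hq; pose j := riso_inv i.
have fl : GRing.linear_for *:%R (f : X -> rs j B).
  move=> a x y; rewrite [LHS](linearD f); congr (_ + _).
  have fZ (b : S') (z : rs i X) : f (b *: z) = b *: f z by exact: linearZ.
  rewrite -[RHS]/(rf i a *: f x) -fZ; congr (f _).
  by transitivity (rg i (rf i a) *: x); first by rewrite rfK.
have [h hh] := hX _ _ (rsl j q) (mklin fl) hq.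
have hl : GRing.linear_for *:%R (h : rs i X -> A).
  move=> a x y; rewrite [LHS](linearD h); congr (_ + _).
  have hZ (b : S) (z : X) : h (b *: z) = b *: h z by exact: linearZ.
  rewrite [LHS](hZ (rg i a)) -[LHS]/(rf i (rg i a) *: (h x : A)); by rewrite rgK.
by exists (mklin hl).
Qed.

Section Resolution.
Variables (X : lmodType S) (P : proj_resolution X) (X' : lmodType S') (th : X -> X').
Hypotheses (ths : semilin i th) (thi : injective th) (thj : forall y, exists x, th x = y).
Lemma rs_aug_semi : semilin i (fun x : P 0%N => th (res_aug P x)).
Proof.
case: ths => hD hZ; split=> [x y|a x]; first by rewrite linearD hD.
by rewrite linearZ hZ.
Qed.
Definition rs_aug : {linear rs i (P 0%N) -> X'} := mklin (semi_rs rs_aug_semi).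
Lemma th0 : th 0 = 0.
Proof. by case: ths => hD _; apply: (addIr (th 0)); rewrite -hD !add0r. Qed.
Lemma rs_aug_surj m : exists x, rs_aug x = m.
Proof. by have [x <-] := thj m; have [y <-] := res_aug_surj P x; exists y. Qed.
Lemma rs_exact0 x : rs_aug x = 0 <-> exists y, rsl i (res_diff P 0) y = x.
Proof.
split=> [h|h]; first by apply/res_exact0; apply: thi; rewrite th0.
by rewrite -[LHS]/(th (res_aug P x)) (proj2 (res_exact0 x) h) th0.
Qed.
Definition rs_res : proj_resolution X' :=
  @ProjResolution S' X' (fun n => rs i (P n)) (fun n => rsl i (res_diff P n)) rs_aug
    (fun n => rs_proj (@res_proj _ _ P n)) rs_aug_surj rs_exact0 (@res_exact _ _ P).
End Resolution.
End RestrictProj.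

Section TensorIso.
Variables (C C' : pzRingType) (i : riso C C').
Local Notation o := (riso_op i).
Implicit Types (X : lmodType C^c) (V : lmodType C).

Section TSemi.
Variables (X : lmodType C^c) (V : lmodType C) (X' : lmodType C'^c) (V' : lmodType C').
Variables (th : X -> X') (nu : V -> V').
Hypotheses (ths : semilin o th) (nus : semilin i nu).
Definition tsemi : tens X V -> tens X' V' := tlift (fun x v => ptens (th x) (nu v)).
Lemma tsemi_bal : @balanced C X V (fun (a : C) (x : X) => (a : C^c) *: x)
  (fun (a : C) (y : V) => a *: y) _ (fun x v => ptens (th x) (nu v)).
Proof.
have [tD tZ] := ths; have [nD nZ] := nus; split=> [x x' v|x v v'|a x v].
- by rewrite tD ptensDl.
- by rewrite nD ptensDr.
- by rewrite tZ nZ -ptensZ.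
Qed.
Lemma tsemiD t u : tsemi (t + u) = tsemi t + tsemi u. Proof. exact: (tliftD tsemi_bal). Qed.
Lemma tsemi0 : tsemi 0 = 0. Proof. exact: (tlift0 tsemi_bal). Qed.
Lemma tsemiE x v : tsemi (ptens x v) = ptens (th x) (nu v). Proof. exact: (tliftE tsemi_bal). Qed.
Lemma tsemi_surj : (forall y, exists x, th x = y) -> (forall w, exists v, nu v = w) ->
  forall t, exists u, tsemi u = t.
Proof.
move=> ts ns t; elim/tens_ind: t => [|t u [t' <-] [u' <-]|x v].
- by exists 0; rewrite tsemi0.
- by exists (t' + u'); rewrite tsemiD.
- by have [y <-] := ts x; have [w <-] := ns v; exists (ptens y w); rewrite tsemiE.
Qed.
Lemma tens_trivial_semi : (forall y, exists x, th x = y) -> (forall w, exists v, nu v = w) ->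
  tens_trivial X V -> tens_trivial X' V'.
Proof. by move=> ts ns h t; have [u <-] := tsemi_surj ts ns t; rewrite (h u) tsemi0. Qed.
End TSemi.
End TensorIso.

Section TensorIsoInv.
Variables (C C' : pzRingType) (i : riso C C').
Local Notation o := (riso_op i).

Section TSemiInv.
Variables (X : lmodType C^c) (V : lmodType C) (X' : lmodType C'^c) (V' : lmodType C').
Variables (th : X -> X') (nu : V -> V') (nu' : V' -> V) (th' : X' -> X).
Hypotheses (ths : semilin o th) (nus : semilin i nu).
Hypotheses (nuK : cancel nu nu') (nu'K : cancel nu' nu) (thK : cancel th th') (th'K : cancel th' th).

Lemma tsemi_inj t : tsemi th nu t = 0 -> t = 0.
Proof.
have [tD tZ] := ths; have [nD nZ] := nus.
have nus' : semilin (riso_inv i) nu'.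
  split=> [x y|a x]; first by rewrite -{1}(nu'K x) -{1}(nu'K y) -nD nuK.
  by rewrite -{1}(nu'K x) -{1}(rgK i a) -nZ nuK.
have ths' : semilin (riso_op (riso_inv i)) th'.
  split=> [x y|a x]; first by rewrite -{1}(th'K x) -{1}(th'K y) -tD thK.
  by rewrite -{1}(th'K x) -{1}(rgK o a) -tZ thK.
have inv (u : tens X V) : tsemi th' nu' (tsemi th nu u) = u.
  elim/tens_ind: u => [|u u' IH IH'|x v].
  - by rewrite (tsemi0 ths nus) (tsemi0 ths' nus').
  - by rewrite (tsemiD ths nus) (tsemiD ths' nus') IH IH'.
  - by rewrite (tsemiE ths nus) (tsemiE ths' nus') nuK thK.
by move=> h; rewrite -(inv t) h (tsemi0 ths' nus').
Qed.
End TSemiInv.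

Section TorIso.
Variables (X : lmodType C^c) (V : lmodType C) (X' : lmodType C'^c) (V' : lmodType C').
Variables (th : X -> X') (nu : V -> V') (nu' : V' -> V).
Hypotheses (ths : semilin o th) (nus : semilin i nu).
Hypotheses (thi : injective th) (thj : forall y, exists x, th x = y).
Hypotheses (nuK : cancel nu nu') (nu'K : cancel nu' nu).

(** Restriction along the inverse isomorphism turns a resolution of X into one of X', and [T]
    identifies the two tensored complexes degree by degree. *)
Lemma Tor_zero_semi n : Tor_zero X V n -> Tor_zero X' V' n.
Proof.
case=> P hP; exists (rs_res P ths thi thj).
pose T m : tens (P m) V -> tens (rs o (P m)) V' := tsemi (fun x : P m => (x : rs o (P m))) nu.
have sm m := rs_semi o (P m).
have Ts m t : exists u, T m u = t.
  apply: (tsemi_surj (sm m) nus) => w; first by exists w.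
  by exists (nu' w).
have Ti m t : T m t = 0 -> t = 0.
  by apply: (tsemi_inj (nu := nu) (nu' := nu') (th' := fun x : rs o (P m) => (x : P m)) (sm m) nus nuK nu'K).
have nat m t : tens_map (rsl o (res_diff P m)) (T m.+1 t) = T m (tens_map (res_diff P m) t).
  have T0 q : T q 0 = 0 := tsemi0 (sm q) nus.
  have TD q t1 t2 : T q (t1 + t2) = T q t1 + T q t2 := tsemiD (sm q) nus t1 t2.
  have TE q x v : T q (ptens x v) = ptens (x : rs o (P q)) (nu v) := tsemiE (sm q) nus x v.
  elim/tens_ind: t => [|t u IH IH'|x v].
  - by rewrite T0 [LHS](tmap0 (rsl o (res_diff P m)) idfun) [tens_map _ 0](tmap0 (res_diff P m) idfun) T0.
  - rewrite TD [LHS](tmapD (rsl o (res_diff P m)) idfun) [tens_map _ (t + u)](tmapD (res_diff P m) idfun) TD.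
    by rewrite -IH -IH'.
  - by rewrite TE [LHS](tmapE (rsl o (res_diff P m)) idfun) [tens_map _ _](tmapE (res_diff P m) idfun) TE.
move=> z hz; have [y hy] := Ts n z; rewrite -hy in hz *.
have [|w hw] := hP y.
  case: n y hz {z hy hP} => // m y hz; apply: Ti; rewrite -nat; exact: hz.
by exists (T n.+1 w); rewrite -hw -nat.
Qed.
End TorIso.
End TensorIsoInv.

Section PeirceIso.
Variables (R R' : pzRingType) (i : riso R R').

Section Map.
Variables (a b : idem R) (a' b' : idem R').
Hypotheses (ha : rf i a = a' :> R') (hb : rf i b = b' :> R').
Lemma pmap_subproof (x : peirce a b) : rf i x \in peirce_pred a' b'.
Proof. by rewrite unfold_in -ha -hb -!rfM peirceE. Qed.
Definition pmap x : peirce a' b' := Peirce (pmap_subproof x).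
Lemma pmap_inv_subproof (y : peirce a' b') : rg i y \in peirce_pred a b.
Proof. by rewrite unfold_in -[idem_val a](rfK i) -[idem_val b](rfK i) ha hb -!rgM peirceE. Qed.
Definition pmap_inv y : peirce a b := Peirce (pmap_inv_subproof y).
Lemma pmapK : cancel pmap pmap_inv.
Proof. by move=> x; apply: val_inj; exact: rfK. Qed.
Lemma pmap_invK : cancel pmap_inv pmap.
Proof. by move=> x; apply: val_inj; exact: rgK. Qed.
Lemma pmapD x y : pmap (x + y) = pmap x + pmap y.
Proof. by apply: val_inj; exact: rfD. Qed.
End Map.

Lemma corner_iso_mul (a : idem R) (a' : idem R') (ha : rf i a = a' :> R') (x y : corner a) :
  pmap ha ha (x * y) = (pmap ha ha x : corner a') * pmap ha ha y :> corner a'.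
Proof. by apply: (@val_inj _ _ (peirce a' a')); exact: rfM. Qed.
Lemma corner_iso_one (a : idem R) (a' : idem R') (ha : rf i a = a' :> R') :
  pmap ha ha (1 : corner a) = (1 : corner a').
Proof. by apply: (@val_inj _ _ (peirce a' a')). Qed.
Definition corner_iso (a : idem R) (a' : idem R') (ha : rf i a = a' :> R') : riso (corner a) (corner a') :=
  @RIso (corner a) (corner a') _ _ (pmapK ha ha) (pmap_invK ha ha) (pmapD ha ha)
    (corner_iso_mul ha) (corner_iso_one ha).

Definition tor_stratifying (S : pzRingType) (e : idem S) : Prop :=
  (forall n, (0 < n)%N ->
     @Tor_zero (corner e) (peirce_right (idem1 S) e) (peirce_left e (idem1 S)) n) /\
  @tens_trivial (corner e) (peirce_right (idemC e) e) (peirce_left e (idemC e)).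

Section Transport.
Variables (e : idem R) (e' : idem R') (he : rf i e = e' :> R').

Lemma pmap_right_semi (a : idem R) (a' : idem R') (ha : rf i a = a' :> R') :
  semilin (riso_op (corner_iso he)) (pmap ha he : peirce_right a e -> peirce_right a' e').
Proof. by split=> [x y|c x]; apply: val_inj; [exact: rfD|exact: rfM]. Qed.
Lemma pmap_left_semi (a : idem R) (a' : idem R') (ha : rf i a = a' :> R') :
  semilin (corner_iso he) (pmap he ha : peirce_left e a -> peirce_left e' a').
Proof. by split=> [x y|c x]; apply: val_inj; [exact: rfD|exact: rfM]. Qed.

Lemma tor_stratifying_iso : tor_stratifying e -> tor_stratifying e'.
Proof.
have h1 : rf i (idem1 R) = idem1 R' :> R' by exact: rf1.
have rN x : rf i (- x) = - rf i x.
  by apply: (addIr (rf i x)); rewrite -rfD !addNr; apply: (addIr (rf i 0)); rewrite -rfD !add0r.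
have hC : rf i (idemC e) = idemC e' :> R' by rewrite /= rfD rf1 rN he.
case=> hT ht; split=> [n hn|].
  apply: (Tor_zero_semi (pmap_right_semi h1) (pmap_left_semi h1)) (hT n hn).
  - exact: (can_inj (pmapK h1 he)).
  - by move=> y; exists (pmap_inv h1 he y); exact: pmap_invK.
  - exact: (pmapK he h1).
  - exact: (pmap_invK he h1).
apply: (tens_trivial_semi (pmap_right_semi hC) (pmap_left_semi hC)) ht => y.
- by exists (pmap_inv hC he y); exact: pmap_invK.
- by exists (pmap_inv he hC y); exact: pmap_invK.
Qed.
End Transport.
End PeirceIso.

Section QuotientIso.
Variables (R R' : pzRingType) (h : R -> R') (s : R' -> R).
Hypotheses (hD : forall x y, h (x + y) = h x + h y) (hM : forall x y, h (x * y) = h x * h y)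
  (h1 : h 1 = 1) (hs : cancel s h).
Variables (a : R) (a' : R').
Hypothesis ha : forall x, in_ideal a x <-> in_ideal a' (h x).
Let hB x y : h (x - y) = h x - h y.
Proof. by apply: (addIr (h y)); rewrite -hD !subrK. Qed.
Let F (t : quot_ring a) : quot_ring a' := to_quot a' (h (of_quot t)).
Let G (t : quot_ring a') : quot_ring a := to_quot a (s (of_quot t)).
Let FE x : F (to_quot a x) = to_quot a' (h x).
Proof. by apply/to_quotP; rewrite -hB; apply/ha; exact: to_quot_repr. Qed.
Let GK : cancel G F.
Proof. by move=> t; rewrite /G FE hs of_quotK. Qed.
Let Fi : injective F.
Proof.
move=> x y; rewrite -(of_quotK x) -(of_quotK y) !FE => /to_quotP; rewrite -hB => /ha e.
by apply/to_quotP.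
Qed.
Let FK : cancel F G. Proof. by move=> t; apply: Fi; rewrite GK. Qed.
Let FD x y : F (x + y) = F x + F y.
Proof.
by rewrite -(of_quotK x) -(of_quotK y) [_ + _]quot_addE !FE hD; exact/esym/quot_addE.
Qed.
Let FM x y : F (x * y) = F x * F y.
Proof.
by rewrite -(of_quotK x) -(of_quotK y) [_ * _]quot_mulE !FE hM; exact/esym/quot_mulE.
Qed.
Let F1 : F 1 = 1. Proof. by rewrite [LHS]FE h1. Qed.
Lemma quot_iso : exists i : riso (quot_ring a) (quot_ring a'),
  forall x, rf i (to_quot a x) = to_quot a' (h x).
Proof. by exists (RIso FK GK FD FM F1). Qed.
End QuotientIso.

(** The first ring of a chain is encoded as a quotient by the ideal of 0, not as the ring itself. *)
Lemma quot0_iso (R : pzRingType) (a : R) : a = 0 ->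
  exists i : riso (quot_ring a) R, forall x, rf i (to_quot a x) = x.
Proof.
move=> a0; have i0 x : in_ideal a x -> x = 0.
  by case=> s ->; apply: big1 => p _; rewrite a0 mulr0 mul0r.
have E x : of_quot (to_quot a x) = x by apply/eqP; rewrite -subr_eq0; apply/eqP/i0/to_quot_repr.
have D (x y : quot_ring a) : of_quot (x + y) = of_quot x + of_quot y.
  by rewrite -(of_quotK x) -(of_quotK y) [_ + _]quot_addE !E.
have M (x y : quot_ring a) : of_quot (x * y) = of_quot x * of_quot y.
  by rewrite -(of_quotK x) -(of_quotK y) [_ * _]quot_mulE !E.
by exists (RIso (@of_quotK R a) E D M (E 1)).
Qed.

(** * Induction along the chain *)

Section CornerQuotient.
Variables (R : pzRingType) (e : idem R).
Local Notation f := (idemC e).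
Hypothesis fef : forall x y, (f : R) * x * (e : R) * y * (f : R) = 0.

(** The map x -> f x f presents fRf as R / ReR, and the ideal of e + b contains e; so dividing R by
    it amounts to dividing fRf by the ideal of b. *)
Lemma corner_quot_iso (b : corner f) (a : R) : a = (e : R) + peirce_val b ->
  exists i : riso (quot_ring a) (quot_ring b), forall x, rf i (to_quot a x) = to_quot b (cpr e x).
Proof.
move=> ae.
have fe : (f : R) * (e : R) = 0 by rewrite /= mulrBl mul1r idemP subrr.
have ef : (e : R) * (f : R) = 0 by rewrite /= mulrBr mulr1 idemP subrr.
have fb : (f : R) * peirce_val b = peirce_val b by exact: (peirce_l (b : peirce f f)).
have bf : peirce_val b * (f : R) = peirce_val b by exact: (peirce_r (b : peirce f f)).
have fa : (f : R) * a = peirce_val b by rewrite ae mulrDr fe add0r.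
have ca : cpr e a = b.
  by apply: (@val_inj _ _ (peirce f f)); rewrite -[LHS]/((f : R) * a * (f : R)) fa.
have c0 : cpr e 0 = 0.
  by apply: (@val_inj _ _ (peirce f f)); rewrite -[LHS]/((f : R) * 0 * (f : R)) mulr0 mul0r.
apply: (@quot_iso _ _ (cpr e) (fun x : corner f => peirce_val x) (@cprD R e) (cprM fef) (cpr1 e) (@cprK R e)).
move=> x; split=> [[s ->]|[s hs]].
  exists [seq (cpr e p.1, cpr e p.2) | p <- s].
  rewrite big_map (big_morph _ (@cprD R e) c0); apply: eq_bigr => p _.
  by rewrite !(cprM fef) ca.
(* e = e a e, because e b = 0. *)
have ie : in_ideal a (e : R).
  exists [:: ((e : R), (e : R))]; rewrite big_seq1 ae mulrDr idemP mulrDl idemP.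
  by rewrite -[X in _ * X * _]fb mulrA ef !mul0r addr0.
(* x = f x f + e x + f x e, where the last two terms lie in the ideal of e. *)
have -> : x = (f : R) * x * (f : R) + (e : R) * x + (f : R) * x * (e : R).
  rewrite addrAC -mulrDr.
  have -> : (f : R) + (e : R) = 1 by rewrite subrK.
  by rewrite mulr1 -mulrDl subrK mul1r.
apply: in_idealD; last exact: in_idealMl.
apply: in_idealD; last exact: in_idealMr.
exists [seq (peirce_val p.1, peirce_val p.2) | p <- s].
rewrite big_map; have /(congr1 (@peirce_val _ _ _)) := hs => /= hs'.
rewrite [LHS]hs'.
have vD : {morph @peirce_val R f f : u v / u + v} by [].
have v0 : peirce_val (0 : corner f) = 0 by [].
rewrite (big_morph _ vD v0); apply: eq_bigr => p _ /=.
by rewrite -fa mulrA (peirce_r (p.1 : peirce f f)).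
Qed.
End CornerQuotient.

Definition tor_stratifying_chain (R : pzRingType) (n : nat) (e : 'I_n -> idem R) : Prop :=
  [/\ forall i j, i != j -> (e i : R) * (e j : R) = 0,
      \sum_(i < n) (e i : R) = 1
    & forall i : 'I_n, tor_stratifying (quot_idem (\sum_(j < n | (j < i)%N) (e j : R)) (e i))].

Lemma tor_stratifying_first (R : pzRingType) n (e : 'I_n.+1 -> idem R) : tor_stratifying_chain e -> tor_stratifying (e ord0).
Proof.
case=> _ _ /(_ ord0) h.
have a0 : \sum_(j < n.+1 | (j < (ord0 : 'I_n.+1))%N) (e j : R) = 0 by rewrite big_pred0.
have [i hi] := quot0_iso a0.
exact: (@tor_stratifying_iso _ _ i (quot_idem _ (e ord0)) (e ord0) (hi (e ord0 : R)) h).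
Qed.

Section ChainCorner.
Variables (R : pzRingType) (n : nat) (e : 'I_n.+1 -> idem R).
Local Notation e0 := (e ord0).
Local Notation f := (idemC e0).
Local Notation es i := (e (lift ord0 i) : R).
Hypothesis orth : forall i j, i != j -> (e i : R) * (e j : R) = 0.

Lemma orth_compl i : (f : R) * es i = es i /\ es i * (f : R) = es i.
Proof.
have o0 : (e0 : R) * es i = 0 by exact: orth.
have o1 : es i * (e0 : R) = 0 by exact: orth.
by rewrite /= mulrBl mulrBr o0 o1 !subr0 mul1r mulr1.
Qed.
Lemma tail_subproof i : es i \in peirce_pred f f.
Proof. by have [h1 h2] := orth_compl i; rewrite unfold_in h1 h2. Qed.
Definition tail_val i : corner f := Peirce (tail_subproof i).
Lemma tail_idem_subproof i : tail_val i * tail_val i = tail_val i.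
Proof. by apply: (@val_inj _ _ (peirce f f)); exact: idemP. Qed.
Definition chain_tail i : idem (corner f) := Idem (tail_idem_subproof i).

Hypothesis fef : forall x y, (f : R) * x * (e0 : R) * y * (f : R) = 0.

Lemma tor_stratifying_chain_tail : tor_stratifying_chain e -> tor_stratifying_chain chain_tail.
Proof.
case=> _ sum1 strat.
have vD : {morph @peirce_val R f f : u v / u + v} by [].
have v0 : peirce_val (0 : corner f) = 0 by [].
split=> [i j ij||i].
- apply: (@val_inj _ _ (peirce f f)); apply: orth; by apply: contra ij => /eqP /lift_inj ->.
- apply: (@val_inj _ _ (peirce f f)); rewrite [LHS](big_morph _ vD v0).
  by rewrite -[RHS]/(1 - (e0 : R)) -[X in X - _]sum1 [X in X - _]big_ord_recl addrAC subrr add0r.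
(* The ideal at position i + 1 of the chain is generated by e_0 plus the first i idempotents of the
   tail. *)
have ab : \sum_(j < n.+1 | (j < lift ord0 i)%N) (e j : R) =
    (e0 : R) + peirce_val (\sum_(j < n | (j < i)%N) tail_val j).
  by rewrite (big_morph _ vD v0) big_mkcond big_ord_recl /= [in RHS]big_mkcond.
have [u hu] := corner_quot_iso fef ab.
apply: (tor_stratifying_iso (i := u) _ (strat (lift ord0 i))).
rewrite [LHS]hu; congr to_quot; apply: (@val_inj _ _ (peirce f f)).
by have [h1 h2] := orth_compl i; rewrite -[LHS]/((f : R) * es i * (f : R)) h1 h2.
Qed.

Lemma primitive_tail i : primitive (e (lift ord0 i)) -> primitive (chain_tail i).
Proof.
move=> [h0 hp]; split=> [c0|a b ab ba cab].
  by apply: h0; exact: (congr1 (@peirce_val R f f) c0).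
have pv (x : idem (corner f)) : peirce_val (idem_val x) * peirce_val (idem_val x) = peirce_val (idem_val x).
  exact: (congr1 (@peirce_val R f f) (idemP x)).
have [|||h|h] := hp (Idem (pv a)) (Idem (pv b)).
- exact: (congr1 (@peirce_val R f f) ab).
- exact: (congr1 (@peirce_val R f f) ba).
- exact: (congr1 (@peirce_val R f f) cab).
- by left; apply: (@val_inj _ _ (peirce f f)).
- by right; apply: (@val_inj _ _ (peirce f f)).
Qed.
End ChainCorner.

Section Induction.
Variable k : fieldType.
Hypothesis Han_local : forall A : falgType k, local_ring A -> Han A.

(** An idempotent p of eLe gives an orthogonal decomposition e = p + (e - p), so p is 0 or e. *)
Lemma idem_primitive (L : falgType k) (e : idem L) (ne : iv e != 0) : primitive e ->
  local_ring (cornerF ne).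
Proof.
move=> [_ he]; apply: local_of_idem => p pp.
pose q : L := cval p.
have qq : q * q = q by rewrite -[RHS]/(cval p) -[in RHS]pp.
have eq : iv e * q = q by exact: (peirce_l (p : peirce e e)).
have qe : q * iv e = q by exact: (peirce_r (p : peirce e e)).
have rr : (iv e - q) * (iv e - q) = iv e - q.
  by rewrite mulrBr !mulrBl ivP eq qe qq subrr subr0.
case: (he (Idem qq) (Idem rr)) => /= [||| h|h].
- by rewrite mulrBr qe qq subrr.
- by rewrite mulrBl eq qq subrr.
- by rewrite addrC subrK.
- by left; apply: (@val_inj _ _ (peirce e e)).
- right; apply: (@val_inj _ _ (peirce e e)); apply/esym/eqP; rewrite -subr_eq0; exact/eqP.
Qed.

(** Length 0 would force 1 = 0. Length 1 is separate because then f = 0 and there is no second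
    corner: L itself is local. In longer chains f is nonzero, as it fixes the nonzero second
    idempotent. *)
Lemma Han_tor_stratifying_chain n (L : falgType k) (e : 'I_n -> idem L) :
  tor_stratifying_chain e -> (forall i, primitive (e i)) -> Han L.
Proof.
elim: n L e => [|[|n] IH] L e che prim; have [orth sum1 _] := che.
- by have /eqP := sum1; rewrite big_ord0 eq_sym oner_eq0.
- apply: Han_local; apply: local_of_idem => p pp.
  have e1 : iv (e ord0) = 1 by rewrite -sum1 big_ord1.
  have [_ he] := prim ord0.
  have rr : (1 - p) * (1 - p) = 1 - p by rewrite mulrBl mul1r mulrBr mulr1 pp subrr subr0.
  case: (he (Idem pp) (Idem rr)) => /= [||| h|/eqP h].
  + by rewrite mulrBr mulr1 pp subrr.
  + by rewrite mulrBl mul1r pp subrr.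
  + by rewrite addrC subrK.
  + by left.
  + by right; apply/esym/eqP; rewrite -subr_eq0.
pose e0 := e ord0; pose f := idemC e0.
have ne : iv e0 != 0 by apply/eqP; case: (prim ord0).
have nf : iv f != 0.
  apply/eqP => f0; case: (prim (lift ord0 ord0)) => h _; apply: h.
  by have [<- _] := orth_compl orth ord0; rewrite [X in X * _]f0 mul0r.
have [hT hMN] : tor_stratifying e0 by exact: tor_stratifying_first che.
have fef x y : iv f * x * iv e0 * y * iv f = 0.
  have := MN_zero hMN x y; rewrite !mulrA -[_ * iv e0 * iv e0]mulrA ivP; exact.
move=> /(HH_corners ne hT hMN nf) [hA hB].
have gA : finite_gldim (cornerF ne) by apply: Han_local hA; exact: idem_primitive (prim ord0).
have gB : finite_gldim (cornerF nf).
  apply: (IH (cornerF nf) (chain_tail orth)) hB; first exact: tor_stratifying_chain_tail.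
  by move=> i; exact: primitive_tail.
apply: (finite_gldim_corners (e := e0)) => //.
- by move=> s; exact: (tens_MN_inj ne hMN).
- exact: (Tor_free_res ne hT).
Qed.
End Induction.

Theorem corollary5p8 (k : fieldType)
  (Han_local : forall A : falgType k, local_ring A -> Han A)
  (Lambda : falgType k) (n : nat) (e : 'I_n -> idem Lambda)
  (chain : strongly_stratifying_chain e)
  (e_primitive : forall i, primitive (e i)) :
  Han Lambda.
Proof.
apply: (Han_tor_stratifying_chain Han_local _ e_primitive); case: chain => orth sum1 strat.
by split=> // i; have [hT ht _] := strat i.
Qed.
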